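(* Let $v:\mathbb X\times\mathbb X\to[0,\infty]$ be a measurable symmetric pair potential and $z:\mathbb X\to[0,\infty)$ measurable with $\int_B z\,d\lambda<\infty$ for all $B\in\mathcal X_{\mathsf b}$, and assume $f\le0$ $\lambda^2$-a.e. Suppose there exist a measurable $a:\mathbb X\to[0,\infty)$ and $t>0$ such that for $\lambda$-almost all $x_0\in\mathbb X$, $$\sum_{k=1}^\infty\frac{e^{tk}}{k!}\int_{\mathbb X^k}\prod_{j=1}^k|f(x_0,y_j)|\prod_{1\le i<j\le k}\bigl(1+f(y_i,y_j)\bigr)\prod_{j=1}^k z(y_j)e^{a(y_j)}\,d\lambda^k(\mathbf y)\le e^{a(x_0)}-1.$$ Then the truncated correlation functions of the unique Gibbs measure $\mathsf P\in\mathscr G(z)$ satisfy, for all $n\in\mathbb N$ and $\lambda^n$-almost all $(x_1,\dots,x_n)\in\mathbb X^n$, $$\rho_n^{\mathsf T}(x_1,\dots,x_n)=\prod_{j=1}^nz(x_j)\Bigl(\varphi_n^{\mathsf T}(x_1,\dots,x_n)+\sum_{k=1}^\infty\frac1{k!}\int_{\mathbb X^k}\varphi_{n+k}^{\mathsf T}(x_1,\dots,x_n,y_1,\dots,y_k)\,d\lambda_z^k(\mathbf y)\Bigr),$$ and, for $\lambda$-almost all $x_1$, $$\sum_{k=0}^\infty\frac1{k!}\int_{\mathbb X^{n-1+k}}|\varphi_{n+k}^{\mathsf T}(x_1,\dots,x_{n+k})|\,d\lambda_z(x_2)\cdots d\lambda_z(x_{n+k})\le\frac{(n-1)!}{(e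^t-1)^{n-1}}\,e^{a(x_1)}.$$
   Context: $(\mathbb X,\mathrm{dist})$ is a complete separable metric space with Borel $\sigma$-algebra $\mathcal X$, $\mathcal X_{\mathsf b}$ the bounded Borel sets, $\lambda$ a measure finite on bounded sets. $\mathcal N$ is the set of locally finite counting measures on $\mathbb X$ with $\sigma$-algebra $\mathfrak N$ generated by $\eta\mapsto\eta(B)$, $B\in\mathcal X_{\mathsf b}$. $f(x,y)=e^{-v(x,y)}-1$, $W(x;\eta)=\int v(x,y)\,d\eta(y)$, $\lambda_z(dx)=z(x)\lambda(dx)$. $\mathsf P\in\mathscr G(z)$ (Gibbs measure) means $\mathsf E[\int F(x,\eta)\,d\eta(x)]=\int\mathsf E[F(x,\eta+\delta_x)e^{-W(x;\eta)}]z(x)\,d\lambda(x)$ for all measurable $F:\mathbb X\times\mathcal N\to[0,\infty)$. The correlation functions of $\mathsf P$ are $\rho_n(x_1,\dots,x_n)=\prod_{j}z(x_j)\,e^{-\sum_{i<j}v(x_i,x_j)}\int_{\mathcal N}e^{-\sum_{i=1}^nW(x_i;\eta)}\,d\mathsf P(\eta)$ (densities w.r.t. $\lambda^n$ of the factorial moment measures). The truncated correlation functions $\rho_n^{\mathsf T}$ are the symmetric functions uniquely determined by $\rho_n(x_1,\dots,x_n)=\sum_{\{V_1,\dots,V_r\}\in\mathcal P_n}\prod_{k=1}^r\rho^{\mathsf T}_{\#V_k}((x_i)_{i\in V_k})$ for all $n$, where $\mathcal P_n$ is the set of set partitions of $\{1,\dots,n\}$. The Ursell function is $\varphi_n^{\mathsf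 T}(x_1,\dots,x_n)=\sum_{G\in\mathcal C_n}\prod_{\{i,j\}\in E(G)}f(x_i,x_j)$, with $\mathcal C_n$ the connected simple graphs on vertex set $\{1,\dots,n\}$. *)

(* Defs.v *)
From HB Require Import structures.
From mathcomp Require Import all_boot all_order all_algebra.
From mathcomp Require Import all_classical all_reals all_analysis.
From mathcomp Require Import measurable_realfun.
Unset Printing Implicit Defensive.
Import Order.TTheory GRing.Theory Num.Theory.
Local Open Scope classical_set_scope.
Local Open Scope ring_scope.

Section Defs.
Context {d : measure_display} {X : measurableType d} {R : realType}.

Definition is_metric (dist : X -> X -> R) : Prop :=
  [/\ forall x y, 0 <= dist x y,
      forall x y, dist x y = 0 <-> x = y,
      forall x y, dist x y = dist y x &
      forall x y w, dist x w <= dist x y + dist y w].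

Definition dcomplete (dist : X -> X -> R) : Prop :=
  forall u : nat -> X,
    (forall e, 0 < e -> exists N, forall m n, (N <= m)%N -> (N <= n)%N -> dist (u m) (u n) < e) ->
    exists l, forall e, 0 < e -> exists N, forall n, (N <= n)%N -> dist (u n) l < e.

Definition dseparable (dist : X -> X -> R) : Prop :=
  exists D : set X, countable D /\ forall x e, 0 < e -> exists2 y, D y & dist x y < e.

Definition dopen (dist : X -> X -> R) (A : set X) : Prop :=
  forall x, A x -> exists2 e, 0 < e & forall y, dist x y < e -> A y.

Definition dbounded (dist : X -> X -> R) (B : set X) : Prop :=
  exists x r, forall y, B y -> dist x y <= r.

Record lfcm (dist : X -> X -> R) := LFCM {
  lfcm_meas : {measure set X -> \bar R} ;
  lfcm_count : forall A, measurable A ->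
      lfcm_meas A = +oo%E \/ exists k : nat, lfcm_meas A = (k%:R)%:E ;
  lfcm_lf : forall B, measurable B -> dbounded dist B -> (lfcm_meas B < +oo)%E }.

Lemma mzero_count (A : set X) : measurable A ->
  (@mzero d X R A) = +oo%E \/ exists k : nat, (@mzero d X R A) = (k%:R)%:E.
Proof. by move=> _; right; exists 0%N. Qed.

Lemma mzero_lf (dist : X -> X -> R) (B : set X) : measurable B -> dbounded dist B ->
  ((@mzero d X R) B < +oo)%E.
Proof. by move=> _ _; rewrite /mzero ltry. Qed.

Definition lfcm0 (dist : X -> X -> R) : lfcm dist := @LFCM dist _ (@mzero_count) (@mzero_lf dist).

Arguments lfcm_meas {dist}.
HB.instance Definition _ dist := gen_eqMixin (lfcm dist).
HB.instance Definition _ dist := gen_choiceMixin (lfcm dist).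
HB.instance Definition _ dist := isPointed.Build (lfcm dist) (lfcm0 dist).

Definition lfcm_gen (dist : X -> X -> R) : set (set (lfcm dist)) :=
  [set S | exists (B : set X) (A : set (\bar R)), [/\ measurable B, dbounded dist B &
      S = (fun eta : lfcm dist => lfcm_meas eta B) @^-1` A]].

Definition NN (dist : X -> X -> R) := g_sigma_algebraType (lfcm_gen dist).


(* eta + delta_x, as an element of lfcm; the sum of a locally finite counting
   measure and a Dirac mass is again one, so the first branch is the one
   actually taken (the fallback branch is never used). *)
Definition addd {dist : X -> X -> R} (eta : lfcm dist) (x : X) : lfcm dist :=
  let m := measure_add (lfcm_meas eta) (@dirac _ X x R) in
  match pselect ((forall A, measurable A -> m A = +oo%E \/ exists k : nat, m A = (k%:R)%:E)
           /\ (forall B, measurable B -> dbounded dist B -> (m B < +oo)%E)) with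
  | left p => @LFCM dist m (proj1 p) (proj2 p)
  | right _ => eta
  end.

Local Open Scope ereal_scope.

(* f(x,y) = e^{-v(x,y)} - 1  (with e^{-oo} = 0) *)
Definition fpot (v : X -> X -> \bar R) (x y : X) : R := fine (expeR (- v x y)) - 1.

Definition Wint {dist : X -> X -> R} (v : X -> X -> \bar R) (x : X) (eta : lfcm dist) : \bar R :=
  \int[lfcm_meas eta]_y v x y.

Definition lamz (lam : {measure set X -> \bar R}) (z : X -> R) (A : set X) : \bar R :=
  \int[lam]_(x in A) (z x)%:E.

(* P is a Gibbs measure for activity z (GNZ equation) *)
Definition is_gibbs {dist : X -> X -> R} (lam : {measure set X -> \bar R})
    (v : X -> X -> \bar R) (z : X -> R) (P : probability (NN dist) R) : Prop :=
  forall F : X * NN dist -> R, measurable_fun setT F -> (forall p, (0 <= F p)%R) ->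
    \int[P]_eta (\int[lfcm_meas (eta : lfcm dist)]_x (F (x, eta))%:E)
    = \int[lam]_x ((\int[P]_eta ((F (x, (addd eta x : NN dist)))%:E
                                  * expeR (- Wint v x eta))) * (z x)%:E).

Definition nthX (xs : seq X) (i : nat) : X := nth point xs i.

Definition rho {dist : X -> X -> R} (v : X -> X -> \bar R) (z : X -> R)
    (P : probability (NN dist) R) (xs : seq X) : \bar R :=
  (\prod_(i < size xs) z (nthX xs i))%:E
  * expeR (- \sum_(i < size xs) \sum_(j < size xs | (i < j)%N) v (nthX xs i) (nthX xs j))
  * \int[P]_eta expeR (- \sum_(i < size xs) Wint v (nthX xs i) (eta : lfcm dist)).

Definition subtup {xs : seq X} (V : {set 'I_(size xs)}) : seq X :=
  [seq nthX xs (val i) | i <- enum V].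

Definition is_truncated (rh : seq X -> \bar R) (rhoT : seq X -> R) : Prop :=
  forall xs : seq X, (0 < size xs)%N ->
    rh xs = (\sum_(Pi : {set {set 'I_(size xs)}} | finset.partition Pi [set: 'I_(size xs)])
               \prod_(V in Pi) rhoT (subtup (V : {set _})))%R%:E.

Definition conn_graph {n : nat} (E : {set 'I_n * 'I_n}) : bool :=
  [forall e in E, (e.1 < e.2)%N] &&
  [forall i, [forall j, connect (fun i j : 'I_n => ((i, j) \in E) || ((j, i) \in E)) i j]].

Definition ursell (v : X -> X -> \bar R) (xs : seq X) : R :=
  (\sum_(E : {set 'I_(size xs) * 'I_(size xs)} | conn_graph E)
     \prod_(e in E) fpot v (nthX xs e.1) (nthX xs e.2))%R.

(* X^(k+1) as the iterated product X * (X * ( ... * X)) *)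
Fixpoint pdisp (k : nat) : measure_display :=
  match k with 0 => d | k'.+1 => (d, pdisp k').-prod%mdisp end.
Fixpoint Xpow (k : nat) : measurableType (pdisp k) :=
  match k return measurableType (pdisp k) with
  | 0 => X
  | k'.+1 => (X * Xpow k')%type
  end.
Fixpoint plist (k : nat) : Xpow k -> seq X :=
  match k return Xpow k -> seq X with
  | 0 => fun x => [:: x]
  | k'.+1 => fun p => p.1 :: plist k' p.2
  end.
Fixpoint pmeas (mu : set X -> \bar R) (k : nat) : set (Xpow k) -> \bar R :=
  match k return set (Xpow k) -> \bar R with
  | 0 => mu
  | k'.+1 => (mu \x pmeas mu k')%E
  end.

Definition Iprod (mu : set X -> \bar R) (m : nat) (g : seq X -> \bar R) : \bar R :=
  match m with
  | 0 => g [::]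
  | m'.+1 => \int[pmeas mu m']_p g (plist m' p)
  end.

Definition ae_pow (mu : set X -> \bar R) (k : nat) (Q : seq X -> Prop) : Prop :=
  exists N : set (Xpow k), [/\ measurable N, pmeas mu k N = 0 &
                             forall p, ~ N p -> Q (plist k p)].

End Defs.

(* Main.v *)
(** Write [w = - f]. [ga w xs ys] is the absolute value of the sum over the graphs
    on [xs ++ ys] in which each entry of [ys] is connected to [xs]; for
    [xs = [:: x]] it is the absolute value of the Ursell function.  Removing the first
    root gives a recursion for [ga], through which the hypothesis propagates: if
    [Aint m xs] is [ga w xs ys] integrated over [m] points and divided by [m!], then
    [sum_m e^(tm) Aint m xs <= Z(xs) e^(a(xs))].

    For the Gibbs measure, the Bonferroni inequalities for the product
    [exp (- Wint v x eta)], whose elementary symmetric functions are computed from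
    power sums by Newton's identities and integrated by the Gibbs equation, give
    Kirkwood-Salsburg inequalities of alternating sign for
    [Rt xs = Z(xs) E exp (- sum_i Wint v x_i eta)].  Inserting them into the recursion
    shows that the partial sums of [sum_m (-1)^m Aint m xs] bracket [Rt xs], to
    which they therefore converge.  No a priori uniqueness of the solution of the
    Kirkwood-Salsburg equations is involved.  A Cauchy product then identifies the
    truncated functions, and the quantitative bound follows from
    [C(m, n-1) (e^t - 1)^(n-1) <= e^(tm)]. *)
Require Import Defs.
From HB Require Import structures.
From mathcomp Require Import all_boot all_order all_algebra.
From mathcomp Require Import all_classical all_reals all_analysis.
From mathcomp Require Import measurable_realfun.
From mathcomp Require Import ring lra zify.
Set Implicit Arguments.
Unset Strict Implicit.
Unset Printing Implicit Defensive.
Import Order.TTheory GRing.Theory Num.Theory.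
Local Open Scope ring_scope.
Import numFieldNormedType.Exports.

(** * Splittings of lists and rooted graph sums *)

(** Since [v >= 0], all values of [w] lie in [0, 1], and the recursion for [ga] only multiplies and
    adds nonnegative numbers. The integrals that get bounded are therefore, up to a known sign, the
    very terms of the alternating series, and nothing is lost by absolute values.

    With several points the Ursell series is not governed by [ga (x :: s) ys] but by [ga [:: x] (s
    ++ ys)], where the points of [s] are no longer roots. An identity writes the former through
    products of the latter with shorter lists, which carries summability over by induction on [s].

    A configuration may be infinite and its energy too. Power sums are integrals against it, so
    Newton's identities give symmetric functions that are measurable and whose change under adding a
    point is explicit, without enumerating points measurably. The interaction is cut off to a ball,
    where finitely many points count, and the cut-off is removed after integration.

    Infinite values also forbid subtraction: alternating inequalities are kept with even and odd
    terms on opposite sides. All estimates hold pointwise for lists avoiding one null set, off which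
    the hypothesis holds. *)

Section Splits.
Context {T : Type}.

(* Sum of [H a b] over all ways to distribute the entries of [s] into two
   subsequences [a] and [b]. *)
Fixpoint spl {V : nmodType} (H : seq T -> seq T -> V) (s : seq T) : V :=
  if s is x :: s' then
    spl (fun a b => H (x :: a) b) s' + spl (fun a b => H a (x :: b)) s'
  else H [::] [::].

Lemma eq_spl (V : nmodType) (H H' : seq T -> seq T -> V) s :
  (forall a b, H a b = H' a b) -> spl H s = spl H' s.
Proof. by elim: s H H' => [|x s IH] H H' e //=; congr (_ + _); apply: IH. Qed.

Lemma splD (V : nmodType) (H H' : seq T -> seq T -> V) s :
  spl (fun a b => H a b + H' a b) s = spl H s + spl H' s.
Proof. by elim: s H H' => [|x s IH] H H' //=; rewrite !IH addrACA. Qed.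

Lemma spl_morph (V W : nmodType) (f : V -> W) (H : seq T -> seq T -> V) s :
  {morph f : x y / x + y} -> f (spl H s) = spl (fun a b => f (H a b)) s.
Proof. by move=> fD; elim: s H => [|x s IH] H //=; rewrite fD !IH. Qed.

Lemma spl_mull (A : pzRingType) (c : A) (H : seq T -> seq T -> A) s :
  c * spl H s = spl (fun a b => c * H a b) s.
Proof. by apply: spl_morph => x y; rewrite mulrDr. Qed.

Lemma spl_mulr (A : pzRingType) (c : A) (H : seq T -> seq T -> A) s :
  spl H s * c = spl (fun a b => H a b * c) s.
Proof. by apply: (spl_morph (f := fun x => x * c)) => x y; rewrite mulrDl. Qed.

Lemma splA (V : nmodType) (H : seq T -> seq T -> seq T -> V) s :
  spl (fun a c => spl (fun a1 a2 => H a1 a2 c) a) s =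
  spl (fun a c => spl (fun c1 c2 => H a c1 c2) c) s.
Proof. by elim: s H => [|x s IH] H //=; rewrite !splD !IH addrA. Qed.

Lemma splC (V : nmodType) (H : seq T -> seq T -> V) s :
  spl (fun a b => H b a) s = spl H s.
Proof.
by elim: s H => [|x s IH] H //=; rewrite addrC; congr (_ + _); [exact: (IH (fun a b => H (x :: a) b))|exact: (IH (fun a b => H a (x :: b)))].
Qed.

Lemma spl_cat (V : nmodType) (H : seq T -> seq T -> V) s w :
  spl H (s ++ w) = spl (fun a b => spl (fun c e => H (a ++ c) (b ++ e)) w) s.
Proof. by elim: s H => [|x s IH] H //=; rewrite !IH. Qed.

Lemma spl_exchange (V : nmodType) (H : seq T -> seq T -> seq T -> seq T -> V) s w :
  spl (fun a b => spl (fun c e => H a b c e) w) s =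
  spl (fun c e => spl (fun a b => H a b c e) s) w.
Proof. by elim: s H => [|x s IH] H //=; rewrite !IH -splD. Qed.

Lemma spl_nil2 (V : nmodType) (H : seq T -> seq T -> V) s :
  (forall a x b, H a (x :: b) = 0) -> spl H s = H s [::].
Proof.
move=> H0; elim: s H H0 => [|x s IH] H H0 //=; rewrite IH // IH //.
by rewrite H0 addr0.
Qed.
End Splits.

Section SplitsEq.
Context {T : eqType}.

Lemma eq_in_spl (V : nmodType) (H H' : seq T -> seq T -> V) s :
  (forall a b, perm_eq (a ++ b) s -> H a b = H' a b) -> spl H s = spl H' s.
Proof.
elim: s H H' => [|x s IH] H H' e /=; first exact: e.
congr (_ + _); apply: IH => a b p; apply: e; first by rewrite /= perm_cons.
by rewrite perm_catC /= perm_cons perm_catC.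
Qed.

Lemma spl_ge0 (R : numDomainType) (H : seq T -> seq T -> R) s :
  (forall a b, perm_eq (a ++ b) s -> 0 <= H a b) -> 0 <= spl H s.
Proof.
elim: s H => [|x s IH] H e /=; first exact: e.
apply: addr_ge0; apply: IH => a b p; apply: e; first by rewrite /= perm_cons.
by rewrite perm_catC /= perm_cons perm_catC.
Qed.

Lemma spl_split_last (V : nmodType) (H : seq T -> seq T -> V) s :
  spl H s = H s [::] + spl (fun a b => if b is _ :: _ then H a b else 0) s.
Proof.
rewrite -[X in X + _](spl_nil2 (H := fun a b => if b is _ :: _ then 0 else H a b)) //.
by rewrite -splD; apply: eq_spl => a [|x b]; rewrite ?addr0 ?add0r.
Qed.
End SplitsEq.

(** * Graph sums with several roots *)

Section Graphs.
Context {T : eqType} {R : realDomainType} (w : T -> T -> R).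
Hypothesis w_sym : forall x y, w x y = w y x.
Hypothesis w01 : forall x y, 0 <= w x y <= 1.

Definition cprod x (s : seq T) : R := \prod_(y <- s) (1 - w x y).
Definition wprod x (s : seq T) : R := \prod_(y <- s) w x y.
Fixpoint Zprod (s : seq T) : R := if s is x :: s' then cprod x s' * Zprod s' else 1.

Lemma cprod_cons x y s : cprod x (y :: s) = (1 - w x y) * cprod x s.
Proof. by rewrite /cprod big_cons. Qed.
Lemma wprod_cons x y s : wprod x (y :: s) = w x y * wprod x s.
Proof. by rewrite /wprod big_cons. Qed.
Lemma cprod_cat x s t : cprod x (s ++ t) = cprod x s * cprod x t.
Proof. by rewrite /cprod big_cat. Qed.
Lemma cprod_perm x s t : perm_eq s t -> cprod x s = cprod x t.
Proof. exact: perm_big. Qed.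

Lemma cprod01 x s : 0 <= cprod x s <= 1.
Proof.
elim: s => [|y s /andP[IH0 IH1]]; first by rewrite /cprod big_nil ler01 lexx.
rewrite cprod_cons; have /andP[w0 w1] := w01 x y.
have h0 : 0 <= 1 - w x y by rewrite subr_ge0.
have h1 : 1 - w x y <= 1 by rewrite gerBl.
by rewrite mulr_ge0 //= mulr_ile1.
Qed.

Lemma wprod01 x s : 0 <= wprod x s <= 1.
Proof.
elim: s => [|y s /andP[IH0 IH1]]; first by rewrite /wprod big_nil ler01 lexx.
by rewrite wprod_cons; have /andP[w0 w1] := w01 x y; rewrite mulr_ge0 //= mulr_ile1.
Qed.

Lemma Zprod01 s : 0 <= Zprod s <= 1.
Proof.
elim: s => [|x s /andP[IH0 IH1]] /=; first by rewrite ler01 lexx.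
by have /andP[c0 c1] := cprod01 x s; rewrite mulr_ge0 //= mulr_ile1.
Qed.

Lemma Zprod_mid x a b : Zprod (a ++ x :: b) = Zprod (x :: a ++ b).
Proof.
elim: a => [|y a IH] //=; rewrite IH /= cprod_cons !cprod_cat cprod_cons (w_sym y x).
ring.
Qed.

Lemma Zprod_perm s t : perm_eq s t -> Zprod s = Zprod t.
Proof.
elim: s t => [|x s IH] t p.
  by move: p; rewrite perm_sym => /perm_nilP ->.
have xt : x \in t by rewrite -(perm_mem p) mem_head.
have [t1 [t2 e]] : exists t1 t2, t = t1 ++ x :: t2.
  by case/splitPr: xt => t1 t2; exists t1, t2.
have q : perm_eq s (t1 ++ t2).
  by move: p; rewrite e perm_sym perm_catC /= perm_cons perm_catC perm_sym.
by rewrite e Zprod_mid /= (IH _ q) (cprod_perm _ q).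
Qed.

Lemma cprod_spl x s : cprod x s = spl (fun a _ => (-1) ^+ size a * wprod x a) s.
Proof.
elim: s => [|y s IH] /=; first by rewrite /cprod /wprod !big_nil mulr1.
rewrite cprod_cons mulrBl mul1r IH addrC; congr (_ + _).
rewrite -mulNr spl_mull; apply: eq_spl => a b; rewrite wprod_cons exprS; ring.
Qed.

(** The root [x] is removed: [cprod x xs'] accounts for its edges to the other roots, and its
    neighbours [a] in [ys] become roots. The list of roots may grow, but the total number of points
    drops by one at each call; this is what the fuel [n] counts. *)
Fixpoint ga_rec n (xs ys : seq T) : R :=
  match n, xs with
  | _, [::] => if ys is [::] then 1 else 0
  | n'.+1, x :: xs' => cprod x xs' * spl (fun a b => wprod x a * ga_rec n' (a ++ xs') b) ys
  | 0, _ => 0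
  end.
(* Up to the sign [(-1) ^+ size ys], this is the sum over all graphs on
   [xs ++ ys] in which every entry of [ys] is connected to an entry of [xs]. *)
Definition ga (xs ys : seq T) : R := ga_rec (size xs + size ys) xs ys.

Lemma ga_rec_fuel n xs ys : (size xs + size ys <= n)%N -> ga_rec n xs ys = ga xs ys.
Proof.
rewrite /ga; elim: n {-2}n (leqnn n) xs ys => [|m IH] n nm xs ys.
  by move: nm; rewrite leqn0 => /eqP ->; rewrite leqn0 => /eqP ->.
case: xs => [|x xs]; first by case: n {nm} => [|n]; case: ys => [|y ys].
case: n nm => [|n] nm //= le; congr (_ * _); apply: eq_in_spl => a b /perm_size.
rewrite size_cat => e; congr (_ * _); rewrite IH ?size_cat //; last by lia.
by rewrite [RHS]IH ?size_cat //; lia.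
Qed.

Lemma ga_nil ys : ga [::] ys = (ys == [::])%:R.
Proof. by rewrite /ga; case: ys. Qed.

Lemma ga_cons x xs ys :
  ga (x :: xs) ys = cprod x xs * spl (fun a b => wprod x a * ga (a ++ xs) b) ys.
Proof.
rewrite {1}/ga /=; congr (_ * _); apply: eq_in_spl => a b /perm_size.
by rewrite size_cat => e; rewrite ga_rec_fuel // size_cat; lia.
Qed.

(** With [w] in [0, 1] every factor of the recursion is nonnegative. Hence the graph sum with weight
    [- w] on each edge has the exact sign [(-1) ^+ size ys]. *)
Lemma ga_ge0 xs ys : 0 <= ga xs ys.
Proof.
rewrite /ga; move: (size xs + size ys)%N => n; elim: n xs ys => [|n IH] xs ys; case: xs => [|x xs] /=; try by case: ys.
apply: mulr_ge0; first by have /andP[] := cprod01 x xs.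
by apply: spl_ge0 => a b _; rewrite mulr_ge0 //; have /andP[] := wprod01 x a.
Qed.

(** The graph sum itself, each edge having weight [- w]. *)
Definition gs xs ys : R := (-1) ^+ size ys * ga xs ys.

Lemma gs_cons x xs ys : gs (x :: xs) ys =
  cprod x xs * spl (fun a b => (-1) ^+ size a * wprod x a * gs (a ++ xs) b) ys.
Proof.
rewrite /gs ga_cons mulrCA; congr (_ * _); rewrite spl_mull.
apply: eq_in_spl => a b /perm_size <-; rewrite size_cat exprD; ring.
Qed.

(** [Zprod] is the sum over all graphs with edge weights [- w]. Grouping them by the points [a] of
    [s] that are connected to the roots leaves an arbitrary graph on the rest [b]. The proof peels
    off one root and its neighbours, as the recursion of [gs] does. *)
Lemma Zprod_gs xs s : Zprod (xs ++ s) = spl (fun a b => gs xs a * Zprod b) s.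
Proof.
have base t : Zprod t = spl (fun a b => gs [::] a * Zprod b) t.
  rewrite -splC spl_nil2 => [|a x b]; first by rewrite /gs ga_nil eqxx !mul1r.
  by rewrite /gs ga_nil /= mulr0 mul0r.
move: {2}(size xs + size s)%N (leqnn (size xs + size s)%N) => n.
elim: n xs s => [|n IH] xs s le.
  by case: xs le => // _; exact: base.
case: xs le => [|x xs] le; first exact: base.
rewrite /= cprod_cat -mulrA (cprod_spl x s) spl_mulr.
rewrite [RHS](eq_spl (H' := fun a b => spl (fun a1 a2 =>
  cprod x xs * ((-1) ^+ size a1 * wprod x a1 * gs (a1 ++ xs) a2 * Zprod b)) a)); last first.
  by move=> a b; rewrite gs_cons -mulrA spl_mulr spl_mull.
rewrite splA spl_mull; apply: eq_in_spl => a b p.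
have -> : Zprod (xs ++ s) = Zprod ((a ++ xs) ++ b).
  by apply: Zprod_perm; rewrite perm_sym perm_catAC perm_catC perm_cat2l.
rewrite IH; last by move/perm_size: p; move: le; rewrite /= !size_cat; lia.
by rewrite !spl_mull; apply: eq_spl => c e; rewrite !mulrA.
Qed.

(** The term with [b] empty is [F s], and all others evaluate [F] on shorter lists: the system is
    triangular in the length of [s]. *)
Lemma spl_Zprod_inj (F G : seq T -> R) :
  (forall s, spl (fun a b => F a * Zprod b) s = spl (fun a b => G a * Zprod b) s) ->
  forall s, F s = G s.
Proof.
move=> e s; move: {2}(size s) (leqnn (size s)) => n; elim: n s => [|n IH] s le.
  by move: (e [::]); rewrite /= !mulr1; case: s le.
move: (e s); rewrite spl_split_last [RHS]spl_split_last /= !mulr1.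
rewrite (eq_in_spl (H' := fun a b => if b is _ :: _ then G a * Zprod b else 0)).
  by move/addIr.
move=> a [|y b] // /perm_size; rewrite size_cat /= => sz.
by rewrite IH //; lia.
Qed.

(** The points connected to [x] in the absence of the others are not singled out by the recursion,
    but by uniqueness: both sides, convolved with [Zprod], give [Zprod (x :: s ++ t)]. On the right,
    [a] and [c] are the points of [s] and [t] in the component of [x]. *)
Lemma gs_cons_spl x s t : gs (x :: s) t =
  spl (fun a b => spl (fun c e => gs [:: x] (a ++ c) * gs b e) t) s.
Proof.
move: t; apply: spl_Zprod_inj => t; rewrite -Zprod_gs.
rewrite -[(x :: s) ++ t]/([:: x] ++ (s ++ t)) Zprod_gs spl_cat.
under [RHS]eq_spl => a b do rewrite spl_mulr.
rewrite [RHS]spl_exchange; apply: eq_spl => a b.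
under eq_spl => c e do rewrite Zprod_gs spl_mull.
under [RHS]eq_spl => c e do rewrite spl_mulr.
apply: etrans _ (esym (splA (fun a1 a2 c => gs [:: x] (a ++ a1) * gs b a2 * Zprod c) t)).
by apply: eq_spl => c e; apply: eq_spl => e1 e2; rewrite mulrA.
Qed.

(** The sign [(-1) ^+ size a] appears because the roots in [a] count as non-roots in [ga [:: x] (a
    ++ c)]. *)
Lemma ga_cons_spl x s t : ga (x :: s) t =
  spl (fun a b => (-1) ^+ size a * spl (fun c e => ga [:: x] (a ++ c) * ga b e) t) s.
Proof.
apply: (@mulfI _ ((-1) ^+ size t)); first by rewrite signr_eq0.
rewrite -[LHS]/(gs _ _) gs_cons_spl spl_mull; apply: eq_spl => a b.
rewrite mulrA spl_mull; apply: eq_in_spl => c e /perm_size <-.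
by rewrite /gs !size_cat !exprD; ring.
Qed.
End Graphs.

(** * Set partitions and connected graphs *)

Lemma spl_map (S T : Type) (V : nmodType) (u : S -> T) (H : seq T -> seq T -> V) s :
  spl H (map u s) = spl (fun a b => H (map u a) (map u b)) s.
Proof. by elim: s H => [|x s IH] H //=; rewrite !IH. Qed.

Section SubsetSums.
Context {I : finType}.

(** Partitions and graphs give sums over finite sets, the rooted graph calculus gives sums [spl].
    This is the dictionary: a subset of [l] is read as a subsequence in the order of [l]. *)
Lemma sum_subset_filter_spl (V : nmodType) (H : seq I -> seq I -> V) (l : seq I) : uniq l ->
  \sum_(B : {set I} | B \subset [set x in l]) H [seq x <- l | x \in B] [seq x <- l | x \notin B]
  = spl H l.
Proof.
elim: l H => [|x l IH] H /=.
  move=> _; rewrite (bigD1 (finset.set0)) ?finset.sub0set //= big1 ?addr0 // => B /andP[].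
  rewrite (_ : [set x in [::]] = finset.set0); last by apply/finset.setP => y; rewrite !inE.
  by rewrite finset.subset0 => ->.
case/andP=> xl ul; rewrite (bigID (fun B : {set I} => x \in B)) /=; congr (_ + _).
- rewrite -IH // (reindex_onto (fun B => x |: B) (fun B => B :\ x)) /=; last first.
    by move=> B /andP[_ xB]; rewrite finset.setD1K.
  rewrite (eq_bigl (fun B : {set I} => B \subset [set y in l])); last first.
    move=> B; rewrite finset.setU11 andbT; apply/andP/idP => [[/fintype.subsetP sB /eqP e]|/fintype.subsetP sB].
      apply/fintype.subsetP => y yB; have : y \in x |: B by rewrite !inE yB orbT.
      move/sB; rewrite !inE => /orP[/eqP yx|//]; move: yB; rewrite yx -e.
      by rewrite !inE eqxx.
    split; first by apply/fintype.subsetP => y; rewrite !inE => /orP[->//|/sB]; rewrite !inE => ->; rewrite orbT.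
    apply/eqP; rewrite finset.setU1K //; apply/negP => /sB; rewrite !inE; exact/negP.
  apply: eq_bigr => B _; rewrite !inE eqxx /=; congr (H (_ :: _) _); apply: eq_in_filter => y yl;
    by rewrite !inE; case: eqP => // yx; move: xl; rewrite -yx yl.
- rewrite -IH //; apply: eq_big => [B|B /andP[_ xB]].
    apply/andP/idP => [[/fintype.subsetP sB xB]|/fintype.subsetP sB].
      apply/fintype.subsetP => y yB; move/sB: (yB); rewrite !inE => /orP[/eqP yx|//].
      by move: xB; rewrite -yx yB.
    split; first by apply/fintype.subsetP => y /sB; rewrite !inE => ->; rewrite orbT.
    by apply/negP => /sB; rewrite !inE; exact/negP.
  by rewrite (negbTE xB).
Qed.

Lemma sum_subset_spl (V : nmodType) (H : seq I -> seq I -> V) (A : {set I}) :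
  \sum_(B : {set I} | B \subset A) H (enum B) (enum (A :\: B)) = spl H (enum A).
Proof.
rewrite -sum_subset_filter_spl ?enum_uniq //.
have eA : [set x in enum A] = A by apply/finset.setP => x; rewrite inE mem_enum.
rewrite eA; apply: eq_bigr => B /fintype.subsetP BA; congr H; rewrite /enum_mem -filter_predI;
  apply: eq_filter => x /=; rewrite ?inE //; last first.
by apply/idP/andP => [xB|[]//]; split => //; exact: BA.
Qed.

Lemma sum_subset_head_spl (V : nmodType) (H : seq I -> seq I -> V) (A : {set I}) x s :
  enum A = x :: s ->
  \sum_(B : {set I} | (x \in B) && (B \subset A)) H (enum B) (enum (A :\: B))
  = spl (fun a b => H (x :: a) b) s.
Proof.
move=> e; have us : uniq (x :: s) by rewrite -e enum_uniq.
pose H' a b := if x \in a then H a b else 0.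
transitivity (spl H' (enum A)).
  rewrite -sum_subset_spl big_mkcond [RHS]big_mkcond; apply: eq_bigr => B _.
  by rewrite /H' mem_enum; case: (x \in B) => //=; case: ifP.
rewrite e /= (eq_spl (H' := fun a b => H (x :: a) b)); last first.
  by move=> a b; rewrite /H' mem_head.
(* When [x] goes to the second list it cannot also occur in [a], the list having no repetitions, so
   all these terms vanish. *)
rewrite [X in _ + X](eq_in_spl (H' := fun a b => 0 *+ 0)) => [|a b p].
  have -> : spl (fun a b : seq I => 0 *+ 0 : V) s = 0.
    by elim: {us e} s => [|y s IH] //=; rewrite !IH addr0.
  by rewrite addr0.
rewrite /H'; case: ifP => // xa; move: us => /= /andP[/negP []].
by rewrite -(perm_mem p) mem_cat xa.
Qed.

Lemma sum_prod_subset (R : comPzRingType) (F : I -> R) (A : {set I}) :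
  \sum_(B : {set I} | B \subset A) \prod_(i in B) F i = \prod_(i in A) (1 + F i).
Proof.
rewrite -[RHS]big_enum /=.
under eq_bigr => B _ do rewrite -big_enum /=.
rewrite (sum_subset_spl (fun a b => \prod_(i <- a) F i) A).
elim: (enum A) => [|x s IH] /=; first by rewrite !big_nil.
rewrite big_cons mulrDl mul1r -IH addrC spl_mull; congr (_ + _).
by apply: eq_spl => a b; rewrite big_cons.
Qed.
End SubsetSums.

Section PartitionSums.
Context {I : finType} {R : comPzRingType}.

Definition Psum (wt : {set I} -> R) (A : {set I}) : R :=
  \sum_(Q : {set {set I}} | finset.partition Q A) \prod_(B in Q) wt B.

Lemma Psum0 wt : Psum wt finset.set0 = 1.
Proof.
rewrite /Psum (eq_bigl (fun Q => Q == finset.set0)) ?big_pred1_eq ?big_set0 // => Q.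
exact: partition_set0.
Qed.

(* Group the partitions of [A] by the block containing [x]. *)
Lemma PsumE wt (A : {set I}) x : x \in A ->
  Psum wt A = \sum_(B : {set I} | (x \in B) && (B \subset A)) wt B * Psum wt (A :\: B).
Proof.
move=> xA; rewrite /Psum.
rewrite (partition_big (fun Q => finset.pblock Q x) (fun B => (x \in B) && (B \subset A))) /=; last first.
  move=> Q pQ; rewrite mem_pblock (cover_partition pQ) xA /=.
  by apply: (partitionS pQ); rewrite pblock_mem // (cover_partition pQ).
apply: eq_bigr => B /andP[xB BA].
have B0 : B != finset.set0 by apply/finset.set0Pn; exists x.
have nB Q : finset.partition Q (A :\: B) -> B \notin Q.
  move=> pQ; apply/negP => BQ; have /fintype.subsetP/(_ x xB) := partitionS pQ BQ.
  by rewrite !inE xB.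
rewrite (reindex_onto (fun Q => B |: Q) (fun Q => Q :\ B)) /=; last first.
  move=> Q /andP[pQ /eqP <-]; rewrite finset.setD1K // pblock_mem //.
  by rewrite (cover_partition pQ).
rewrite big_distrr /=; apply: eq_big => [Q|Q /andP[/andP[pQ _] /eqP e]]; last first.
  by rewrite big_setU1 //= -e !inE eqxx.
apply/idP/idP => [/andP[/andP[pQ /eqP e1] /eqP e]|pQ].
  by rewrite -e; apply: partitionD1 => //; rewrite !inE eqxx.
have pQ' : finset.partition (B |: Q) A.
  rewrite -[A](finset.setID A B) (finset.setIidPr BA); apply: partitionU1 => //.
  by rewrite -finset.setI_eq0; apply/eqP/finset.setP => y; rewrite !inE; case: (y \in B).
rewrite pQ' /= (def_pblock (partition_trivIset pQ') _ xB) ?eqxx ?inE ?eqxx //=.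
by rewrite finset.setU1K // nB.
Qed.
End PartitionSums.

(** * Graphs grouped by connected component *)

Section GraphSums.
Context {n : nat} {R : comPzRingType} (F : 'I_n * 'I_n -> R).

Definition pairs (A : {set 'I_n}) : {set 'I_n * 'I_n} :=
  [set e : 'I_n * 'I_n | [&& (e.1 < e.2)%N, e.1 \in A & e.2 \in A]].

Lemma in_pairs A e : (e \in pairs A) = [&& (e.1 < e.2)%N, e.1 \in A & e.2 \in A].
Proof. by rewrite inE. Qed.

Definition adj (E : {set 'I_n * 'I_n}) (i j : 'I_n) := ((i, j) \in E) || ((j, i) \in E).

Definition connected_on (E : {set 'I_n * 'I_n}) (A : {set 'I_n}) :=
  [forall i in A, [forall j in A, connect (adj E) i j]].

Definition Gsum (A : {set 'I_n}) : R :=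
  \sum_(E : {set 'I_n * 'I_n} | E \subset pairs A) \prod_(e in E) F e.

Definition Csum (A : {set 'I_n}) : R :=
  \sum_(E : {set 'I_n * 'I_n} | (E \subset pairs A) && connected_on E A) \prod_(e in E) F e.

Lemma adj_sym (E : {set 'I_n * 'I_n}) : symmetric (adj E).
Proof. by move=> i j; rewrite /adj orbC. Qed.

Lemma adjS (E E' : {set 'I_n * 'I_n}) : E \subset E' -> subrel (adj E) (adj E').
Proof. by move=> /fintype.subsetP s i j; rewrite /adj => /orP[] /s -> //; rewrite orbT. Qed.

Lemma adj_pairs (E : {set 'I_n * 'I_n}) (A : {set 'I_n}) i j : E \subset pairs A -> adj E i j ->
  (i \in A) && (j \in A).
Proof. by move=> /fintype.subsetP s /orP[] /s; rewrite inE /= => /and3P[_ -> ->]. Qed.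

Lemma connected_onP (E : {set 'I_n * 'I_n}) (A : {set 'I_n}) :
  reflect (forall i j, i \in A -> j \in A -> connect (adj E) i j) (connected_on E A).
Proof.
apply: (iffP forall_inP) => [h i j iA jA|h i iA]; first exact: (forall_inP (h _ iA)).
by apply/forall_inP => j jA; exact: h.
Qed.

Definition component E x : {set 'I_n} := [set j | connect (adj E) x j].

Lemma component_adj (E : {set 'I_n * 'I_n}) x i j : adj E i j -> (i \in component E x) = (j \in component E x).
Proof.
move=> e; rewrite !inE; apply/idP/idP => h; apply: (connect_trans h); apply: connect1 => //.
by rewrite adj_sym.
Qed.

Lemma component_sub (E : {set 'I_n * 'I_n}) (A : {set 'I_n}) x : x \in A -> E \subset pairs A -> component E x \subset A.
Proof.
move=> xA EA; apply/fintype.subsetP => j; rewrite inE => /connectP[p].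
elim: p x xA => [|y p IH] x xA /=; first by move=> _ ->.
by case/andP => /(adj_pairs EA)/andP[_ yA] /IH; exact.
Qed.

(** A path of [E] starting at [x] never leaves the component, so all its edges survive the
    restriction to pairs inside it. *)
Lemma component_connected (E : {set 'I_n * 'I_n}) (A : {set 'I_n}) x : E \subset pairs A ->
  connected_on (E :&: pairs (component E x)) (component E x).
Proof.
move=> /fintype.subsetP EA; set B := component E x; set E' := _ :&: _.
have step i j : i \in B -> adj E i j -> adj E' i j && (j \in B).
  move=> iB a; have jB : j \in B by rewrite -(component_adj _ a).
  have sub e : e \in E -> e.1 \in B -> e.2 \in B -> e \in E'.
    by move=> eE e1 e2; move/EA: (eE); rewrite finset.in_setI eE !in_pairs e1 e2 => /and3P[->].
  by rewrite jB andbT; case/orP: a => /sub /= h; rewrite /adj h ?orbT.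
have lift i : i \in B -> connect (adj E') x i.
  rewrite inE => /connectP[p px ->]; apply/connectP; exists p => //.
  have : x \in B by rewrite inE connect0.
  elim: p x px {B E' step} (B) (E') (step) => [|y p IH] {}x //= /andP[xy py] B E' step xB.
  by have /andP[-> yB] := step _ _ xB xy; exact: (IH _ py B).
apply/connected_onP => i j /lift xi /lift; apply: connect_trans.
by rewrite (sym_connect_sym (@adj_sym E')).
Qed.

Lemma component_cut (E : {set 'I_n * 'I_n}) (A : {set 'I_n}) x : E \subset pairs A ->
  (E :&: pairs (component E x)) :|: (E :&: pairs (A :\: component E x)) = E.
Proof.
move=> /fintype.subsetP EA; rewrite -finset.setIUr; apply/finset.setIidPl.
apply/fintype.subsetP => -[i j] e; have := EA _ e; rewrite in_pairs /= => /and3P[ij iA jA].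
have a : adj E i j by rewrite /adj e.
rewrite finset.in_setU !in_pairs /= ij !finset.in_setD iA jA (component_adj x a).
by case: (j \in component E x).
Qed.

(** No edge joins [B] to its complement, and [E1] connects [B]. Together with [component_connected]
    and [component_cut] this matches the graphs having component [B] with pairs of graphs on [B] and
    on [A :\: B]. *)
Lemma component_glue (E1 E2 : {set 'I_n * 'I_n}) (A B : {set 'I_n}) x :
  E1 \subset pairs B -> connected_on E1 B -> E2 \subset pairs (A :\: B) -> x \in B ->
  component (E1 :|: E2) x = B.
Proof.
move=> sE1 /connected_onP cE1 sE2 xB; apply/finset.setP => j; rewrite inE.
have cl : fingraph.closed (adj (E1 :|: E2)) (mem B).
  move=> i k; rewrite /adj !finset.in_setU orbACA => /orP[/(adj_pairs sE1)|/(adj_pairs sE2)].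
    by case/andP => /= -> ->.
  by rewrite !finset.in_setD => /andP[/andP[/negbTE -> _] /andP[/negbTE -> _]].
apply/idP/idP => [/(closed_connect cl) <- //|jB].
by apply: connect_sub (cE1 _ _ xB jB) => i k /(adjS (finset.subsetUl E1 E2)); exact: connect1.
Qed.

Lemma pairsS (A B : {set 'I_n}) : A \subset B -> pairs A \subset pairs B.
Proof.
move=> /fintype.subsetP AB; apply/fintype.subsetP => e; rewrite !inE => /and3P[-> /AB -> /AB ->].
by [].
Qed.

Lemma pairs_disj (A B : {set 'I_n}) : pairs B :&: pairs (A :\: B) = finset.set0.
Proof.
apply/finset.setP => e; rewrite !inE; case: (e.1 \in B); rewrite /= ?andbF //.
Qed.

(* Group the graphs on [A] by the connected component of [x]. *)
Lemma GsumE (A : {set 'I_n}) x : x \in A ->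
  Gsum A = \sum_(B : {set 'I_n} | (x \in B) && (B \subset A)) Csum B * Gsum (A :\: B).
Proof.
move=> xA; rewrite /Gsum.
rewrite (partition_big (fun E => component E x) (fun B => (x \in B) && (B \subset A))) /=; last first.
  by move=> E EA; rewrite component_sub // inE connect0.
apply: eq_bigr => B /andP[xB BA].
rewrite /Csum big_distrlr /= pair_big_dep /=.
rewrite (reindex_onto (fun E : {set 'I_n * 'I_n} * {set 'I_n * 'I_n} => E.1 :|: E.2)
  (fun E => (E :&: pairs B, E :&: pairs (A :\: B)))) /=; last first.
  by move=> E /andP[EA /eqP <-]; exact: component_cut.
apply: eq_big => [[E1 E2]|[E1 E2]] /=.
  apply/idP/idP => [/andP[/andP[EA /eqP cE]]|/andP[/andP[E1B cE1] E2A]].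
    rewrite xpair_eqE => /andP[/eqP e1 /eqP e2].
    rewrite -e2 finset.subsetIr andbT -{1}e1 finset.subsetIr /=.
    by have := component_connected x EA; rewrite cE e1.
  rewrite (component_glue E1B cE1 E2A xB) eqxx andbT finset.subUset.
  rewrite (fintype.subset_trans E1B (pairsS BA)) (fintype.subset_trans E2A) ?pairsS ?finset.subsetDl //=.
  rewrite xpair_eqE !finset.setIUl (finset.setIidPl E1B) (finset.setIidPl E2A).
  rewrite -[in X in _ :|: X](finset.setIidPl E2A) -finset.setIA [pairs (A :\: B) :&: _]finset.setIC pairs_disj.
  rewrite -[in X in X :|: _ == E2](finset.setIidPl E1B) -finset.setIA pairs_disj.
  by rewrite !finset.setI0 finset.setU0 finset.set0U !eqxx.
case/andP => /andP[EA /eqP cE]; rewrite xpair_eqE => /andP[/eqP e1 /eqP e2].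
rewrite (eq_bigl [predU E1 & E2]); last by move=> e; rewrite finset.in_setU.
rewrite bigU //= -finset.setI_eq0 -finset.subset0 -(pairs_disj A B).
by apply: finset.setISS; [rewrite -e1|rewrite -e2]; exact: finset.subsetIr.
Qed.

Lemma Gsum_prod (A : {set 'I_n}) : Gsum A = \prod_(e in pairs A) (1 + F e).
Proof. exact: sum_prod_subset. Qed.
End GraphSums.

Section SortedEnum.
Context {n : nat}.

Lemma sorted_enum_set (A : {set 'I_n}) : sorted (fun i j : 'I_n => (i < j)%N) (enum A).
Proof.
have tr : transitive (fun i j : 'I_n => (i < j)%N) by move=> j i k; exact: ltn_trans.
rewrite /enum_mem -enumT; apply: sorted_filter => //.
by rewrite -(sorted_map (f := val) (e' := ltn)) val_enum_ord iota_ltn_sorted.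
Qed.

Lemma Zprod_sorted (R : realDomainType) (w : 'I_n -> 'I_n -> R) l :
  sorted (fun i j : 'I_n => (i < j)%N) l ->
  Zprod w l = \prod_(i <- l) \prod_(j <- l | (i < j)%N) (1 - w i j).
Proof.
have tr : transitive (fun i j : 'I_n => (i < j)%N) by move=> j i k; exact: ltn_trans.
elim: l => [|x l IH] /=; first by rewrite big_nil.
move=> px; rewrite big_cons big_cons ltnn IH; last exact: path_sorted px.
have /allP al := order_path_min tr px; congr (_ * _).
  by rewrite /cprod big_seq [RHS]big_seq_cond; apply: eq_bigl => j; case: (boolP (j \in l)) => // /al ->.
apply: eq_big_seq => i /al xi; rewrite big_cons.
by rewrite (ltnNge i x) (ltnW xi).
Qed.

Lemma pairs_prod (R : realDomainType) (w : 'I_n -> 'I_n -> R) (A : {set 'I_n}) :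
  \prod_(e in pairs A) (1 - w e.1 e.2) = Zprod w (enum A).
Proof.
rewrite (Zprod_sorted _ (sorted_enum_set A)) big_enum /=.
under [RHS]eq_bigr => i _ do rewrite big_enum_cond /=.
rewrite pair_big_dep /=; apply: eq_bigl => -[i j].
by rewrite in_pairs /= [RHS]andbA andbC.
Qed.
End SortedEnum.

Lemma Zprod_map (S T : eqType) (R : realDomainType) (u : S -> T) (w : T -> T -> R) s :
  Zprod w (map u s) = Zprod (fun i j => w (u i) (u j)) s.
Proof. by elim: s => //= x s ->; rewrite /cprod big_map. Qed.

Section Ursell.
Context {T : eqType} {R : realDomainType} (w : T -> T -> R).
Hypothesis w_sym : forall x y, w x y = w y x.
Context {n : nat} (u : 'I_n -> T).

(** [Csum] and [gs] solve the same equation: [GsumE] for the former, [Zprod_gs] with one root for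
    the latter. By induction on the cardinality the terms with [B] a proper subset of [A] agree,
    hence so do the terms [B = A], where the other factor is 1. *)
Lemma Csum_gs (A : {set 'I_n}) x s : enum A = x :: s ->
  Csum (fun e => - w (u e.1) (u e.2)) A = gs w [:: u x] (map u s).
Proof.
set F := fun e => _; pose Phi (l : seq 'I_n) := if l is x :: s then gs w [:: u x] (map u s) else 0.
suff h : forall A : {set 'I_n}, A != finset.set0 -> Csum F A = Phi (enum A).
  move=> e; rewrite h ?e //; apply/finset.set0Pn; exists x.
  by rewrite -mem_enum e mem_head.
move=> {x s}{}A; move: {2}#|A| (leqnn #|A|) => m.
elim: m A => [|m IH] A; first by rewrite leqn0 cards_eq0 => ->.
move=> cA A0; case e : (enum A) => [|x s].
  by move: A0; rewrite -cards_eq0 cardE e.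
have xA : x \in A by rewrite -mem_enum e mem_head.
have GZ B : Gsum F B = Zprod w (map u (enum B)).
  by rewrite Gsum_prod /F Zprod_map -pairs_prod; apply: eq_bigr => k _.
have : \sum_(B : {set 'I_n} | (x \in B) && (B \subset A)) Csum F B * Gsum F (A :\: B) =
       \sum_(B : {set 'I_n} | (x \in B) && (B \subset A)) Phi (enum B) * Gsum F (A :\: B).
  rewrite -GsumE // GZ.
  under [RHS]eq_bigr => B _ do rewrite GZ.
  rewrite (sum_subset_head_spl (fun a b => Phi a * Zprod w (map u b)) e) e /=.
  by rewrite -[LHS]/(Zprod w ([:: u x] ++ map u s)) Zprod_gs // spl_map.
rewrite (bigD1 A) ?xA ?fintype.subxx //= [RHS](bigD1 A) ?xA ?fintype.subxx //=.
rewrite (eq_bigr (fun B : {set 'I_n} => Phi (enum B) * Gsum F (A :\: B))); last first.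
  move=> B /andP[/andP[xB BA] BnA]; rewrite IH //.
    by rewrite -ltnS; apply: leq_trans cA; apply: proper_card; rewrite finset.properEneq BnA.
  by apply/finset.set0Pn; exists x.
move/addIr; rewrite finset.setDv GZ enum_set0 /= !mulr1 => ->.
by rewrite /Phi e.
Qed.
End Ursell.

(** * Truncated functions and the recursion on the block of the first point *)

Section Truncation.
Context {T : eqType} {R : comPzRingType} (rh Q : seq T -> R).
Hypothesis rh_nil : rh [::] = 1.
Context {n : nat} (u : 'I_n -> T).
Hypothesis rhQ : forall x s, {subset x :: s <= [pred y | y \in codom u]} ->
  rh (x :: s) = spl (fun a b => Q (x :: a) * rh b) s.

(** [rhQ] mirrors the grouping of partitions by the block of the first point, so both sides obey the
    same recursion. It is restricted to points in the range of [u] because it will be available only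
    off a null set. *)
Lemma Psum_rh (A : {set 'I_n}) :
  Psum (fun B : {set 'I_n} => Q (map u (enum B))) A = rh (map u (enum A)).
Proof.
move: {2}#|A| (leqnn #|A|) => m; elim: m A => [|m IH] A.
  by rewrite leqn0 cards_eq0 => /eqP ->; rewrite Psum0 enum_set0 /= rh_nil.
move=> cA; case e : (enum A) => [|x s].
  have -> : A = finset.set0 by apply/eqP; rewrite -cards_eq0 cardE e.
  by rewrite Psum0 rh_nil.
have xA : x \in A by rewrite -mem_enum e mem_head.
rewrite (PsumE _ xA) /= rhQ; last first.
  by move=> y; rewrite -map_cons -e => /mapP[i _ ->]; rewrite inE codom_f.
rewrite spl_map -(sum_subset_head_spl (fun a b => Q (map u a) * rh (map u b)) e).
apply: eq_bigr => B /andP[xB BA]; rewrite IH //.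
rewrite -ltnS; apply: leq_trans cA; apply: proper_card; rewrite properE finset.subsetDl /=.
by apply/fintype.subsetPn; exists x => //; rewrite inE xB.
Qed.

(** The value on the full list enters only through the one-block partition; every other partition
    has blocks that are proper subsets, where [Q'] and [Q] agree. *)
Lemma truncated_unique (Q' : seq T -> R) : (0 < n)%N ->
  (forall V : {set 'I_n}, V \proper [set: 'I_n] -> Q' (map u (enum V)) = Q (map u (enum V))) ->
  rh (map u (enum 'I_n)) = Psum (fun B : {set 'I_n} => Q' (map u (enum B))) [set: 'I_n] ->
  Q' (map u (enum 'I_n)) = Q (map u (enum 'I_n)).
Proof.
move=> n0 QQ; have e : enum 'I_n = enum [set: 'I_n] by apply: eq_enum => i; rewrite !inE.
rewrite !e -Psum_rh; pose x := Ordinal n0.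
rewrite !(PsumE _ (finset.in_setT x)).
rewrite (bigD1 [set: 'I_n]) ?finset.subsetT ?finset.in_setT //=.
rewrite [X in _ = X -> _](bigD1 [set: 'I_n]) ?finset.subsetT ?finset.in_setT //=.
rewrite finset.setDv !Psum0 !mulr1.
rewrite (eq_bigr (fun B : {set 'I_n} => Q' (map u (enum B)) *
  Psum (fun B : {set 'I_n} => Q' (map u (enum B))) ([set: 'I_n] :\: B))) => [/addIr //|B].
case/andP => /andP[xB _] BT.
rewrite QQ ?finset.properT //; congr (_ * _); apply: eq_bigr => P PP.
apply: eq_bigr => C CP; rewrite QQ // finset.properT; apply/eqP => CT.
by have := fintype.subsetP (partitionS PP CP) x; rewrite CT !inE xB => /(_ isT).
Qed.
End Truncation.

Local Open Scope classical_set_scope.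
Local Open Scope ring_scope.

(** * Iterated integrals of functions of lists *)

Section ListMeasurability.
Context {d : measure_display} {X : measurableType d}.

Fixpoint mall {d'} {T : measurableType d'} (us : seq (T -> X)) : Prop :=
  if us is u :: us' then measurable_fun setT u /\ mall us' else True.

Definition ev {T : Type} (us : seq (T -> X)) (t : T) : seq X := [seq u t | u <- us].

(* A function of a list of points is measurable if it is so along every finite
   family of measurable maps; this avoids putting a sigma-algebra on lists. *)
Definition lmf {dU} {U : measurableType dU} (G : seq X -> U) : Prop :=
  forall d' (T : measurableType d') (us : seq (T -> X)), mall us ->
    measurable_fun setT (fun t => G (ev us t)).

Definition lmf2 {dU} {U : measurableType dU} (H : seq X -> seq X -> U) : Prop :=
  forall d' (T : measurableType d') (us vs : seq (T -> X)), mall us -> mall vs ->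
    measurable_fun setT (fun t => H (ev us t) (ev vs t)).

Lemma mall_cat d' (T : measurableType d') (us vs : seq (T -> X)) :
  mall us -> mall vs -> mall (us ++ vs).
Proof. by elim: us => //= u us IH [mu /IH h] /h. Qed.

Lemma mall_comp d' d'' (T : measurableType d') (S : measurableType d'') (e : S -> T)
    (us : seq (T -> X)) : measurable_fun setT e -> mall us -> mall [seq u \o e | u <- us].
Proof.
by move=> me; elim: us => //= u us IH [mu /IH h]; split => //; exact: measurableT_comp.
Qed.

Lemma ev_comp (T S : Type) (e : S -> T) (us : seq (T -> X)) s :
  ev [seq u \o e | u <- us] s = ev us (e s).
Proof. by rewrite /ev -map_comp. Qed.

Lemma ev_cat (T : Type) (us vs : seq (T -> X)) t : ev (us ++ vs) t = ev us t ++ ev vs t.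
Proof. exact: map_cat. Qed.

Definition cstl (T : Type) (s : seq X) : seq (T -> X) := [seq cst x | x <- s].

Lemma mall_cstl d' (T : measurableType d') s : mall (cstl T s).
Proof. by elim: s => //= x s IH; split => //; exact: measurable_cst. Qed.

Lemma ev_cstl (T : Type) s t : ev (cstl T s) t = s.
Proof. by rewrite /ev /cstl -map_comp /comp /= map_id. Qed.

Section Closure.
Context {dU : measure_display} {U : measurableType dU}.

Lemma lmf2_lmf1 (H : seq X -> seq X -> U) s : lmf2 H -> lmf (H s).
Proof.
move=> mH d' T us mus; have := mH _ _ _ _ (mall_cstl T s) mus.
by under eq_fun do rewrite ev_cstl.
Qed.

Lemma lmf_lmf2 (H : seq X -> seq X -> U) s : lmf2 H -> lmf (fun a => H a s).
Proof.
move=> mH d' T us mus; have := mH _ _ _ _ mus (mall_cstl T s).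
by under eq_fun do rewrite ev_cstl.
Qed.

Lemma lmf2_swap (H : seq X -> seq X -> U) : lmf2 H -> lmf2 (fun a b => H b a).
Proof. by move=> mH d' T us vs mu mv; exact: mH. Qed.

Lemma lmf2_cat (G : seq X -> U) : lmf G -> lmf2 (fun a b => G (a ++ b)).
Proof.
move=> mG d' T us vs mu mv; have := mG _ _ _ (mall_cat mu mv).
by under eq_fun do rewrite ev_cat.
Qed.

Lemma lmf2_fst (G : seq X -> U) : lmf G -> lmf2 (fun a _ => G a).
Proof. by move=> mG d' T us vs mu mv; exact: mG. Qed.

Lemma lmf2_snd (G : seq X -> U) : lmf G -> lmf2 (fun _ b => G b).
Proof. by move=> mG d' T us vs mu mv; exact: mG. Qed.

Lemma lmf2_catr (H : seq X -> seq X -> U) s : lmf2 H -> lmf2 (fun a b => H (a ++ s) b).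
Proof.
move=> mH d' T us vs mu mv.
have := mH _ _ _ _ (mall_cat mu (mall_cstl T s)) mv.
by under eq_fun do rewrite ev_cat ev_cstl.
Qed.

Lemma lmf2_catl (H : seq X -> seq X -> U) s : lmf2 H -> lmf2 (fun a b => H (s ++ a) b).
Proof.
move=> mH d' T us vs mu mv.
have := mH _ _ _ _ (mall_cat (mall_cstl T s) mu) mv.
by under eq_fun do rewrite ev_cat ev_cstl.
Qed.

Lemma lmf2_catl2 (H : seq X -> seq X -> U) s : lmf2 H -> lmf2 (fun a b => H a (s ++ b)).
Proof. by move=> /lmf2_swap/(lmf2_catl s)/lmf2_swap. Qed.

Lemma lmf_catr (G : seq X -> U) s : lmf G -> lmf (fun a => G (a ++ s)).
Proof. by move=> /lmf2_cat; exact: lmf_lmf2. Qed.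

Lemma lmf_catl (G : seq X -> U) s : lmf G -> lmf (fun a => G (s ++ a)).
Proof. by move=> /lmf2_cat; exact: lmf2_lmf1. Qed.

Lemma lmf_cst (c : U) : lmf (fun _ => c).
Proof. by move=> d' T us _; exact: measurable_cst. Qed.

(** Lets an integration variable travel at the head of the parameter list, so that the induction in
    [lmf_It] treats it as one more parameter, on [T * X]. The default [point] covers the empty
    list. *)
Definition move_head (H : seq X -> seq X -> U) l s := H (behead l) (head point l :: s).

Lemma lmf2_move_head H : lmf2 H -> lmf2 (move_head H).
Proof.
move=> mH d' T [|u us] vs mu mv.
  exact: (mH _ T [::] (cst point :: vs) I (conj (measurable_cst _) mv)).
by case: mu => mu mus; exact: (mH _ T us (u :: vs) mus (conj mu mv)).
Qed.
End Closure.

Lemma lmf_spl (R : realType) d' (T : measurableType d') (H : T -> seq X -> seq X -> R) vs :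
  mall vs ->
  (forall as_ bs, mall as_ -> mall bs -> measurable_fun setT (fun t => H t (ev as_ t) (ev bs t))) ->
  measurable_fun setT (fun t => spl (H t) (ev vs t)).
Proof.
elim: vs H => [|v vs IH] H /=; first by move=> _ h; exact: (h [::] [::]).
case=> mv mvs h; apply: measurable_funD.
- by apply: (IH (fun t a b => H t (v t :: a) b)) => // as_ bs ma mb; exact: (h (v :: as_) bs).
- by apply: (IH (fun t a b => H t a (v t :: b))) => // as_ bs ma mb; exact: (h as_ (v :: bs)).
Qed.

Lemma lmf2_spl (R : realType) (H : seq X -> seq X -> R) : lmf2 H -> lmf (spl H).
Proof.
by move=> mH d' T us mus; apply: (lmf_spl (H := fun _ => H)) => // as_ bs; exact: mH.
Qed.

Section GraphFunctions.
Context {R : realType} (w : X -> X -> R).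
Hypothesis mw : measurable_fun setT (uncurry w).

Lemma mw2 d' (T : measurableType d') (u u' : T -> X) : measurable_fun setT u ->
  measurable_fun setT u' -> measurable_fun setT (fun t => w (u t) (u' t)).
Proof.
by move=> mu mu'; exact: (measurableT_comp mw (measurable_fun_pair mu mu')).
Qed.

Lemma measurable_wprod d' (T : measurableType d') (u : T -> X) us :
  measurable_fun setT u -> mall us -> measurable_fun setT (fun t => wprod w (u t) (ev us t)).
Proof.
move=> mu; elim: us => [|v us IH] /=.
  by move=> _; rewrite /wprod; under eq_fun do rewrite big_nil; exact: measurable_cst.
case=> mv /IH h; under eq_fun do rewrite wprod_cons.
by apply: measurable_funM => //; exact: mw2.
Qed.

Lemma measurable_cprod d' (T : measurableType d') (u : T -> X) us :
  measurable_fun setT u -> mall us -> measurable_fun setT (fun t => cprod w (u t) (ev us t)).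
Proof.
move=> mu; elim: us => [|v us IH] /=.
  by move=> _; rewrite /cprod; under eq_fun do rewrite big_nil; exact: measurable_cst.
case=> mv /IH h; under eq_fun do rewrite cprod_cons.
apply: measurable_funM => //; apply: measurable_funB; first exact: measurable_cst.
exact: mw2.
Qed.

Lemma lmf_wprod x : lmf (wprod w x).
Proof. by move=> d' T us; apply: (measurable_wprod (u := cst x)); exact: measurable_cst. Qed.

Lemma lmf_Zprod : lmf (Zprod w).
Proof.
move=> d' T; elim=> [|u us IH] /=; first by move=> _; exact: measurable_cst.
by case=> mu mus; apply: measurable_funM; [exact: measurable_cprod|exact: IH].
Qed.

Lemma lmf2_ga : lmf2 (ga w).
Proof.
have h n : lmf2 (ga_rec w n).
  elim: n => [|n IH] d' T [|u us] vs /=.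
  - by move=> _ _; case: vs => [|v vs]; exact: measurable_cst.
  - by move=> _ _; exact: measurable_cst.
  - by move=> _ _; case: vs => [|v vs]; exact: measurable_cst.
  move=> [mu mus] mvs; apply: measurable_funM; first exact: measurable_cprod.
  apply: (lmf_spl (H := fun t a b => wprod w (u t) a * ga_rec w n (a ++ ev us t) b)) => //.
  move=> as_ bs ma mb; apply: measurable_funM; first exact: measurable_wprod.
  have := IH _ _ _ _ (mall_cat ma mus) mb.
  by under eq_fun do rewrite ev_cat.
move=> d' T us vs mu mv; have := h (size us + size vs)%N _ _ _ _ mu mv.
by rewrite /ga; under [X in _ -> measurable_fun _ X]eq_fun do rewrite !size_map.
Qed.
End GraphFunctions.
End ListMeasurability.

Section IteratedIntegral.
Context {d : measure_display} {X : measurableType d} {R : realType}.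
Variable mu : {sigma_finite_measure set X -> \bar R}.
Local Open Scope ereal_scope.

Fixpoint It k (G : seq X -> \bar R) : \bar R :=
  if k is k'.+1 then \int[mu]_x It k' (fun s => G (x :: s)) else G [::].

Lemma It_ge0 k G : (forall s, 0 <= G s) -> 0 <= It k G.
Proof. by elim: k G => [|k IH] G G0 //=; apply: integral_ge0 => x _; exact: IH. Qed.

Lemma eq_It k G G' : (forall s, size s = k -> G s = G' s) -> It k G = It k G'.
Proof.
elim: k G G' => [|k IH] G G' e /=; first exact: e.
by apply: eq_integral => x _; apply: IH => s sk; apply: e; rewrite /= sk.
Qed.

Lemma lmf_It k (H : seq X -> seq X -> \bar R) : lmf2 H -> (forall a b, 0 <= H a b) ->
  lmf (fun a => It k (H a)).
Proof.
elim: k H => [|k IH] H mH H0 d' T us mus /=; first exact: (mH _ T us [::]).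
pose f (p : T * X) := It k (move_head H (ev (snd :: [seq u \o fst | u <- us]) p)).
have mf : measurable_fun setT f.
  apply: (IH (move_head H) (lmf2_move_head mH)) => [a b|/=]; first exact: H0.
  by split; [exact: measurable_snd|exact: mall_comp measurable_fst mus].
rewrite (_ : (fun t => _) = fubini_F mu f); last first.
  apply/funext => t; apply: eq_integral => x _; apply: eq_It => s _.
  by rewrite /move_head /= -/(ev [seq u \o fst | u <- us] (t, x)) ev_comp.
by apply: measurable_fun_fubini_tonelli_F => // p; apply: It_ge0 => s; exact: H0.
Qed.

(** Two parameter lists are passed as one by concatenation and cut again after [n] entries; this
    brings statements about two lists under [lmf_It]. *)
Lemma lmf2_take_drop (dU : measure_display) (U : measurableType dU) n
  (H : seq X -> seq X -> U) : lmf2 H -> lmf2 (fun c b => H (take n c) (drop n c ++ b)).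
Proof.
move=> mH d' T us vs mus mvs.
have [m1 m2] : mall (take n us) /\ mall (drop n us).
  elim: n us mus => [|n IH] [|u us] //=.
  by case=> mu_ /IH [].
have := mH _ _ _ _ m1 (mall_cat m2 mvs).
by under eq_fun do rewrite ev_cat /ev map_take map_drop.
Qed.

Lemma lmf2_It l (H : seq X -> seq X -> \bar R) : lmf2 H -> (forall a b, 0 <= H a b) ->
  lmf2 (fun a c => It l (fun b => H a (c ++ b))).
Proof.
move=> mH H0 d' T us vs mus mvs.
have := lmf_It l (lmf2_take_drop (size us) mH) (fun _ _ => H0 _ _) (mall_cat mus mvs).
rewrite [X in _ -> measurable_fun _ X](_ : _ = fun t => It l (fun b =>
  H (take (size us) (ev (us ++ vs) t)) (drop (size us) (ev (us ++ vs) t) ++ b))) //.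
by apply/funext => t; rewrite ev_cat take_size_cat ?size_map // drop_size_cat ?size_map.
Qed.

Lemma measurable_It k (G : seq X -> \bar R) : lmf G -> (forall s, 0 <= G s) ->
  measurable_fun setT (fun x => It k (fun s => G (x :: s))).
Proof.
move=> mG G0; have := lmf_It k (lmf2_cat mG) (fun a b => G0 _).
by move=> /(_ _ X [:: id] (conj (@measurable_id _ _ _) I)).
Qed.

Lemma lmf_cons (dU : measure_display) (U : measurableType dU) (G : seq X -> U) x :
  lmf G -> lmf (fun s => G (x :: s)).
Proof. exact: (lmf_catl [:: x]). Qed.

Lemma ItD k (G G' : seq X -> \bar R) : lmf G -> lmf G' -> (forall s, 0 <= G s) ->
  (forall s, 0 <= G' s) -> It k (fun s => G s + G' s) = It k G + It k G'.
Proof.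
elim: k G G' => [|k IH] G G' mG mG' G0 G0' //=.
rewrite -ge0_integralD //; first by apply: eq_integral => x _; rewrite IH //; exact: lmf_cons.
- by move=> x _; exact: It_ge0.
- exact: measurable_It.
- by move=> x _; exact: It_ge0.
- exact: measurable_It.
Qed.

Lemma It0 k : It k (fun _ => 0) = 0.
Proof. by elim: k => [|k IH] //=; rewrite integral0_eq // => x _. Qed.

Lemma It_sum k (I : Type) (r : seq I) (P : pred I) (G : I -> seq X -> \bar R) :
  (forall i, lmf (G i)) -> (forall i s, 0 <= G i s) ->
  It k (fun s => \sum_(i <- r | P i) G i s) = \sum_(i <- r | P i) It k (G i).
Proof.
move=> mG G0; have mS (r' : seq I) : lmf (fun s => \sum_(i <- r' | P i) G i s).
  move=> d' T us mus; under eq_fun do rewrite big_mkcond; apply: emeasurable_sum => i.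
  by case: (P i); [exact: mG|exact: measurable_cst].
elim: r => [|i r IH].
  by rewrite big_nil -[RHS](It0 k); apply: eq_It => s _; rewrite big_nil.
rewrite big_cons -IH; case: ifP => Pi; last by apply: eq_It => s _; rewrite big_cons Pi.
rewrite -ItD //; last by move=> s; exact: sume_ge0.
by apply: eq_It => s _; rewrite big_cons Pi.
Qed.

Lemma ItZl k c (G : seq X -> \bar R) : lmf G -> (forall s, 0 <= G s) -> 0 <= c ->
  It k (fun s => c * G s) = c * It k G.
Proof.
elim: k G => [|k IH] G mG G0 c0 //=.
rewrite -ge0_integralZl //; first by apply: eq_integral => x _; rewrite IH //; exact: lmf_cons.
- exact: measurable_It.
- by move=> x _; exact: It_ge0.
Qed.

Lemma It_swap k (H : seq X -> seq X -> \bar R) : lmf2 H -> (forall a b, 0 <= H a b) ->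
  \int[mu]_x It k (H [:: x]) = It k (fun s => \int[mu]_x H [:: x] s).
Proof.
elim: k H => [|k IH] H mH H0 //=.
rewrite -[RHS](_ : \int[mu]_y \int[mu]_x It k (fun s => H [:: x] (y :: s)) = _).
  apply: (fubini_tonelli (fun p : X * X => It k (fun s => H [:: p.1] (p.2 :: s)))).
    exact: (lmf_It k (lmf2_take_drop 1 mH) (fun _ _ => H0 _ _) (us := [:: fst; snd])
      (conj measurable_fst (conj measurable_snd I))).
  by move=> p; exact: It_ge0.
apply: eq_integral => y _; rewrite (IH (fun a b => H a (y :: b))) //.
exact: (lmf2_catl2 [:: y]).
Qed.

Lemma lmf2_spl_ereal (H : seq X -> seq X -> \bar R) : lmf2 H -> lmf (spl H).
Proof.
suff h d' (T : measurableType d') (K : T -> seq X -> seq X -> \bar R) vs : mall vs ->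
    (forall as_ bs, mall as_ -> mall bs -> measurable_fun setT (fun t => K t (ev as_ t) (ev bs t))) ->
    measurable_fun setT (fun t => spl (K t) (ev vs t)).
  by move=> mH d' T us mus; apply: (h _ T (fun _ => H)) => // as_ bs; exact: mH.
elim: vs K => [|v vs IH] K /=; first by move=> _ h; exact: (h [::] [::]).
case=> mv mvs h; apply: emeasurable_funD.
- by apply: (IH (fun t a b => K t (v t :: a) b)) => // as_ bs ma mb; exact: (h (v :: as_) bs).
- by apply: (IH (fun t a b => K t a (v t :: b))) => // as_ bs ma mb; exact: (h as_ (v :: bs)).
Qed.

Lemma spl_ge0e (H : seq X -> seq X -> \bar R) s : (forall a b, 0 <= H a b) -> 0 <= spl H s.
Proof. by elim: s H => [|x s IH] H H0 //=; apply: adde_ge0; exact: IH. Qed.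

(** By Tonelli only the number [k] of points sent to the first list matters, and there are
    ['C(m, k)] choices of them. The induction sends the first variable to either side and ends with
    Pascal's rule. *)
Lemma It_spl m (H : seq X -> seq X -> \bar R) : lmf2 H -> (forall a b, 0 <= H a b) ->
  It m (spl H) = \sum_(k < m.+1) ('C(m, k))%:R%:E * It k (fun a => It (m - k) (H a)).
Proof.
elim: m H => [|m IH] H mH H0.
  by rewrite big_ord_recl big_ord0 /= bin0 addr0 mul1e.
have mItH l : lmf2 H -> lmf (fun a => It l (H a)) by move=> h; exact: lmf_It.
have m1 x : lmf2 (fun a b => H (x :: a) b) by exact: (lmf2_catl [:: x]).
have m2 x : lmf2 (fun a b => H a (x :: b)) by exact: (lmf2_catl2 [:: x]).
pose A k x := It k (fun a => It (m - k) (H (x :: a))).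
pose B k x := It k (fun a => It (m - k) (fun b => H a (x :: b))).
have A0 k x : 0 <= A k x by apply: It_ge0 => a; exact: It_ge0.
have B0 k x : 0 <= B k x by apply: It_ge0 => a; exact: It_ge0.
have mA k : measurable_fun setT (A k).
  by apply: (measurable_It k (G := fun a => It (m - k) (H a))); [exact: lmf_It|move=> s; exact: It_ge0].
have mB k : measurable_fun setT (B k).
  apply: (lmf_It k (lmf2_swap (lmf2_It (m - k) mH H0)) (fun _ _ => _) (us := [:: id]));
    [by move=> ? ?; exact: It_ge0 | by split].
rewrite [LHS]/=.
have C0 k : 0 <= ('C(m, k))%:R%:E :> \bar R by rewrite lee_fin ler0n.
transitivity (\int[mu]_x \sum_(k < m.+1) ('C(m, k))%:R%:E * (A k x + B k x)).
  apply: eq_integral => x _.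
  under eq_bigr do rewrite ge0_muleDr //.
  rewrite big_split /= -[X in _ = X + _]IH // -[X in _ = _ + X]IH //.
  by rewrite -ItD //; [exact: lmf2_spl_ereal|exact: lmf2_spl_ereal| |]; move=> s; exact: spl_ge0e.
have mAB (k : 'I_m.+1) : measurable_fun setT (fun x => A k x + B k x) by exact: emeasurable_funD.
rewrite ge0_integral_sum //; last 2 first.
- by move=> k; exact: emeasurable_funM.
- by move=> k x _; rewrite mule_ge0 ?adde_ge0.
transitivity (\sum_(k < m.+1) ('C(m, k))%:R%:E * (It k.+1 (fun a => It (m - k) (H a)) +
    It k (fun a => It (m.+1 - k) (H a)))).
  apply: eq_bigr => k _; rewrite ge0_integralZl //; last by move=> x _; exact: adde_ge0.
  congr (_ * _); rewrite ge0_integralD //; congr (_ + _).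
  rewrite /B (It_swap k (H := fun c a => It (m - k) (fun b => H a (c ++ b)))).
  - by apply: eq_It => a _; rewrite subSn // -ltnS.
  - exact/lmf2_swap/lmf2_It.
  - by move=> *; exact: It_ge0.
have I0 k l : 0 <= It k (fun a => It l (H a)) by apply: It_ge0 => a; exact: It_ge0.
under eq_bigr do rewrite ge0_muleDr //.
rewrite big_split /= addrC big_ord_recl [in RHS]big_ord_recl /= !bin0 -!addrA; congr (_ + _).
rewrite [in RHS]big_ord_recr /= binn [X in (_ + X)%R]big_ord_recr /= binn addrA; congr (_ + _).
rewrite -big_split /=; apply: eq_bigr => k _.
by rewrite binS natrD EFinD ge0_muleDl ?lee_fin ?ler0n // /bump /= add1n subSS.
Qed.

(** The factor [1 / m!] absorbs the binomial coefficients of [It_spl], so that splitting lists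
    becomes a Cauchy convolution in [J_spl]. *)
Definition J m (G : seq X -> \bar R) : \bar R := ((m`!)%:R^-1)%:E * It m G.

Lemma J_spl m (H : seq X -> seq X -> \bar R) : lmf2 H -> (forall a b, 0 <= H a b) ->
  J m (spl H) = \sum_(k < m.+1) J k (fun a => J (m - k) (H a)).
Proof.
move=> mH H0; rewrite /J It_spl // ge0_sume_distrr; last first.
  by move=> k _; rewrite mule_ge0 // ?lee_fin ?ler0n //; apply: It_ge0 => a; exact: It_ge0.
apply: eq_bigr => k _; rewrite ItZl; last 3 first.
- exact: lmf_It.
- by move=> a; exact: It_ge0.
- by rewrite lee_fin invr_ge0 ler0n.
rewrite !muleA -!EFinM; congr (_%:E * _).
have km : (k <= m)%N by rewrite -ltnS.
have fn0 j : ((j`!)%:R : R) != 0%R by rewrite pnatr_eq0 -lt0n fact_gt0.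
rewrite -(bin_fact km) !natrM; field.
by rewrite !fn0 pnatr_eq0 -lt0n bin_gt0 km.
Qed.
End IteratedIntegral.

(** * Densities, sigma-finiteness and product measures *)

Section Density.
Context {d : measure_display} {X : measurableType d} {R : realType}.
Variables (lam : {measure set X -> \bar R}) (z : X -> R).
Hypothesis z0 : forall x, 0 <= z x.
Hypothesis mz : measurable_fun setT z.
Local Open Scope ereal_scope.
Import HBNNSimple.

Lemma mzE : measurable_fun setT (EFin \o z).
Proof. exact/measurable_EFinP. Qed.

Lemma lamz0 : lamz lam z set0 = 0.
Proof. by rewrite /lamz integral_set0. Qed.

Lemma lamz_ge0 A : 0 <= lamz lam z A.
Proof. by apply: integral_ge0 => x _; rewrite lee_fin. Qed.

Lemma lamz_sigma_additive : semi_sigma_additive (lamz lam z).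
Proof.
move=> F mF tF mUF; rewrite /lamz ge0_integral_bigcup//.
- by apply: is_cvg_ereal_nneg_natsum_cond => n _ _; exact: lamz_ge0.
- by move: mzE => h; apply: measurable_funS h.
- by move=> x _; rewrite lee_fin.
Qed.

(** The proofs about [z] are arguments so that the measure structure can be attached to the term;
    the underlying set function is [lamz lam z] itself. *)
Definition densM of (forall x, 0 <= z x)%R & measurable_fun setT z := lamz lam z.
HB.instance Definition _ := isMeasure.Build _ _ _ (densM z0 mz)
  lamz0 lamz_ge0 lamz_sigma_additive.

Lemma integral_densM (f : X -> \bar R) : (forall x, 0 <= f x) -> measurable_fun setT f ->
  \int[densM z0 mz]_x f x = \int[lam]_x ((z x)%:E * f x).
Proof.
move=> f0 mf; pose h := nnsfun_approx measurableT mf.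
have -> : \int[densM z0 mz]_x f x =
    lim (\int[densM z0 mz]_x (h n x)%:E @[n --> \oo]).
  have fE x : f x = lim ((h n x)%:E @[n --> \oo]).
    by apply/esym/cvg_lim => //; exact: cvg_nnsfun_approx.
  under eq_integral do rewrite fE.
  apply: monotone_convergence => //.
  - by move=> n; exact/measurable_EFinP.
  - by move=> n x _ //=; rewrite lee_fin.
  - by move=> x _ a b ab; rewrite lee_fin; exact/lefP/nd_nnsfun_approx.
have -> : \int[lam]_x ((z x)%:E * f x) =
    lim (\int[lam]_x ((z x)%:E * (h n x)%:E) @[n --> \oo]).
  have fE x : (z x)%:E * f x = lim (((z x)%:E * (h n x)%:E) @[n --> \oo]).
    by apply/esym/cvg_lim => //; apply: cvgeZl => //; exact: cvg_nnsfun_approx.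
  under eq_integral do rewrite fE.
  apply: monotone_convergence => //.
  - by move=> n; apply: emeasurable_funM; [exact: mzE|exact/measurable_EFinP].
  - by move=> n x _ //=; rewrite mule_ge0 // lee_fin.
  - by move=> x _ a b ab; rewrite lee_wpmul2l ?lee_fin //; exact/lefP/nd_nnsfun_approx.
suff suf n : \int[densM z0 mz]_x (h n x)%:E = \int[lam]_x ((z x)%:E * (h n x)%:E).
  by under eq_fun do rewrite suf.
have indich r : measurable_fun setT (fun x => (r * \1_(h n @^-1` [set r]) x)%:E).
  by apply/measurable_EFinP; exact: measurable_funM.
under [in LHS]eq_integral do rewrite fimfunE -fsumEFin //.
rewrite ge0_integral_fsum//; last by move=> y x _; exact: nnfun_muleindic_ge0.
under [RHS]eq_integral.
  move=> x _; rewrite fimfunE -fsumEFin // ge0_mule_fsumr; last first.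
    by move=> y; exact: nnfun_muleindic_ge0.
  over.
rewrite ge0_integral_fsum//; last 2 first.
  - by move=> y; apply: emeasurable_funM; [exact: mzE|].
  - by move=> y x _; rewrite mule_ge0 ?lee_fin // -lee_fin nnfun_muleindic_ge0.
apply: eq_fsbigr => r rhn.
have mi : measurable_fun setT (fun x => (\1_(h n @^-1` [set r]) x)%:E : \bar R).
  by apply/measurable_EFinP; exact: measurable_indic.
have r0 : (0 <= r)%R by move: rhn; rewrite inE => -[t _ <-].
under eq_integral do rewrite EFinM.
rewrite ge0_integralZl //.
rewrite integral_indic // setIT.
under [RHS]eq_integral do rewrite EFinM muleCA.
rewrite ge0_integralZl //; last 2 first.
- by apply: emeasurable_funM => //; exact: mzE.
- by move=> x _; rewrite mule_ge0 // lee_fin.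
congr (_ * _); rewrite -[LHS]/(\int[lam]_(x in h n @^-1` [set r]) (z x)%:E).
rewrite integral_mkcond; apply: eq_integral => x _; rewrite epatch_indic //.
Qed.
End Density.

Section SigmaFinite.
Context {d : measure_display} {X : measurableType d} {R : realType}.
Variables (m : {measure set X -> \bar R}) (sf : sigma_finite setT m).

Definition sfM of sigma_finite setT m := (m : set X -> \bar R).
HB.instance Definition _ := Measure.on (sfM sf).
HB.instance Definition _ := Measure_isSigmaFinite.Build _ _ _ (sfM sf) sf.
End SigmaFinite.

Section ProductSigmaFinite.
Context {d1 d2 : measure_display} {T1 : measurableType d1} {T2 : measurableType d2} {R : realType}.
Variables (m1 : {sigma_finite_measure set T1 -> \bar R})
  (m2 : {sigma_finite_measure set T2 -> \bar R}).

Lemma sigma_finite_prod : sigma_finite setT (m1 \x m2)%E.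
Proof.
have /sigma_finiteP[F [TF ndF Foo]] := sigma_finiteT m1.
have /sigma_finiteP[G [TG ndG Goo]] := sigma_finiteT m2.
exists (fun n => F n `*` G n).
  rewrite -setXTT TF TG predeqE => -[x y]; split.
    move=> [/= [n _ Fnx] [k _ Gky]]; exists (maxn n k) => //; split.
    - by move: x Fnx; exact/subsetPset/ndF/leq_maxl.
    - by move: y Gky; exact/subsetPset/ndG/leq_maxr.
  by move=> [n _ []/= ? ?]; split; exists n.
move=> k; have [? ?] := Foo k; have [? ?] := Goo k.
split; first exact: measurableX.
by rewrite product_measure1E// lte_mul_pinfty// ge0_fin_numE.
Qed.

Definition prodM : {sigma_finite_measure set (T1 * T2)%type -> \bar R} :=
  sfM (m := [the {measure set (T1 * T2)%type -> \bar R} of (m1 \x m2)%E]) sigma_finite_prod.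
End ProductSigmaFinite.

Section IteratedIntegralOrder.
Context {d : measure_display} {X : measurableType d} {R : realType}.
Variable mu : {sigma_finite_measure set X -> \bar R}.
Local Open Scope ereal_scope.

(** With [N0] the exceptional null set of the hypothesis, statements almost everywhere on the powers
    of [X] become pointwise ones on such lists. *)
Definition avoids (N0 : set X) (s : seq X) : Prop := forall x, x \in s -> ~ N0 x.

Lemma avoids_cons N0 x s : avoids N0 (x :: s) <-> ~ N0 x /\ avoids N0 s.
Proof.
split=> [h|[h1 h2] y].
  by split; [apply: h; rewrite mem_head|move=> y ys; apply: h; rewrite inE ys orbT].
by rewrite inE => /orP[/eqP ->|/h2].
Qed.

Lemma avoids_cat N0 s t : avoids N0 (s ++ t) <-> avoids N0 s /\ avoids N0 t.
Proof.
split=> [h|[h1 h2] y]; last by rewrite mem_cat => /orP[/h1|/h2].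
by split=> y ys; apply: h; rewrite mem_cat ys ?orbT.
Qed.

Lemma le_It_ae (N0 : set X) k (G G' : seq X -> \bar R) : measurable N0 -> mu N0 = 0 ->
  lmf G -> lmf G' -> (forall s, 0 <= G s) -> (forall s, 0 <= G' s) ->
  (forall s, size s = k -> avoids N0 s -> G s <= G' s) -> It mu k G <= It mu k G'.
Proof.
move=> mN N0z; elim: k G G' => [|k IH] G G' mG mG' G0 G0' le /=; first exact: le.
apply: ae_ge0_le_integral => //.
- by move=> x _; exact: It_ge0.
- exact: measurable_It.
- by move=> x _; exact: It_ge0.
- exact: measurable_It.
exists N0; split => // x /= h; apply: contrapT => Nx; apply: h => _.
apply: IH; [exact: lmf_cons|exact: lmf_cons|by []|by []|].
by move=> s sk gs; apply: le; [rewrite /= sk|apply/avoids_cons].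
Qed.

Lemma le_It k (G G' : seq X -> \bar R) :
  lmf G -> lmf G' -> (forall s, 0 <= G s) -> (forall s, 0 <= G' s) ->
  (forall s, size s = k -> G s <= G' s) -> It mu k G <= It mu k G'.
Proof. by move=> mG mG' G0 G0' le; apply: (@le_It_ae set0) => // s sk _; exact: le. Qed.

(** The measure [pmeas mu k] with its sigma-finiteness bundled in, as Tonelli's theorem requires at
    each stage. *)
Fixpoint pmeasM k : {sigma_finite_measure set (@Xpow d X k) -> \bar R} :=
  match k return {sigma_finite_measure set (@Xpow d X k) -> \bar R} with
  | 0 => mu
  | k'.+1 => prodM mu (pmeasM k')
  end.

Lemma pmeasE k : pmeas mu k = pmeasM k :> (set (@Xpow d X k) -> \bar R).
Proof. by elim: k => [|k IH] //=; rewrite IH. Qed.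

Fixpoint projs k : seq (@Xpow d X k -> X) :=
  match k return seq (@Xpow d X k -> X) with
  | 0 => [:: id]
  | k'.+1 => fst :: [seq u \o snd | u <- projs k']
  end.

Lemma mall_projs k : mall (projs k).
Proof.
elim: k => [|k IH] /=; first by split => //; exact: measurable_id.
by split; [exact: measurable_fst|exact: mall_comp measurable_snd IH].
Qed.

Lemma plistE k (p : @Xpow d X k) : plist k p = ev (projs k) p.
Proof. by elim: k p => [|k IH] //= p; rewrite IH -ev_comp. Qed.

Lemma size_plist k (p : @Xpow d X k) : size (plist k p) = k.+1.
Proof. by elim: k p => [|k IH] //= p; rewrite IH. Qed.

Lemma measurable_plist dU (U : measurableType dU) (G : seq X -> U) k : lmf G ->
  measurable_fun setT (fun p : @Xpow d X k => G (plist k p)).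
Proof.
by move=> mG; under eq_fun do rewrite plistE; exact: mG (mall_projs k).
Qed.

Lemma Iprod_It k (G : seq X -> \bar R) : lmf G -> (forall s, 0 <= G s) ->
  Iprod mu k G = It mu k G.
Proof.
case: k => [//|k] mG G0; rewrite /Iprod pmeasE.
elim: k G mG G0 => [//|k IH] G mG G0.
rewrite [LHS](fubini_tonelli1 (fun p : X * @Xpow d X k => G (p.1 :: plist k p.2))) //; last first.
  exact: (measurable_plist (k := k.+1)).
apply: eq_integral => x _.
by apply: (IH (fun s => G (x :: s))) => //; exact: lmf_cons.
Qed.

Lemma pmeas_null (N0 : set X) k : measurable N0 -> mu N0 = 0 ->
  exists N : set (@Xpow d X k), [/\ measurable N, pmeas mu k N = 0 &
    forall p, ~ N p -> avoids N0 (plist k p)].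
Proof.
move=> mN N0z; rewrite pmeasE; elim: k => [|k [N [mNk Nk0 h]]].
  by exists N0; split => // x Nx y; rewrite inE => /eqP ->.
exists ((N0 `*` setT) `|` (setT `*` N)); split.
- by apply: measurableU; exact: measurableX.
- apply/eqP; rewrite eq_le measure_ge0 andbT.
  apply: (le_trans (measureU2 _ _ _)); [exact: measurableX|exact: measurableX|].
  rewrite [X in X + _](_ : _ = mu N0 * pmeasM k setT); last exact: product_measure1E.
  rewrite [X in _ + X](_ : _ = mu setT * pmeasM k N); last exact: product_measure1E.
  by rewrite N0z Nk0 mul0e mule0 adde0.
- move=> [x p] /= nN; apply/avoids_cons; split=> [Nx|]; first by apply: nN; left.
  by apply: h => Np; apply: nN; right.
Qed.
End IteratedIntegralOrder.

Section ItDensity.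
Context {d : measure_display} {X : measurableType d} {R : realType}.
Variables (lam nu : {sigma_finite_measure set X -> \bar R}) (z : X -> R).
Local Open Scope ereal_scope.
Hypothesis z0 : forall x, (0 <= z x)%R.
Hypothesis mz : measurable_fun setT z.
Hypothesis nuE : forall f : X -> \bar R, (forall x, 0 <= f x) -> measurable_fun setT f ->
  \int[nu]_x f x = \int[lam]_x ((z x)%:E * f x).

Lemma lmf_prod (g : X -> R) : measurable_fun setT g -> lmf (fun s => (\prod_(y <- s) g y)%R).
Proof.
move=> mg d' T; elim=> [|u us IH] /=.
  by move=> _; under eq_fun do rewrite big_nil; exact: measurable_cst.
case=> mu_ /IH h; under eq_fun do rewrite big_cons.
by apply: measurable_funM => //; exact: measurableT_comp mg mu_.
Qed.

Lemma It_density k (G : seq X -> \bar R) : lmf G -> (forall s, 0 <= G s) ->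
  It nu k G = It lam k (fun s => (\prod_(y <- s) z y)%R%:E * G s).
Proof.
elim: k G => [|k IH] G mG G0 /=; first by rewrite big_nil mul1e.
rewrite nuE; last 2 first.
- by move=> x; exact: It_ge0.
- exact: measurable_It.
apply: eq_integral => x _; rewrite IH //; last exact: lmf_cons.
rewrite -ItZl.
- by apply: eq_It => s _; rewrite big_cons EFinM muleA.
- move=> d' T us mus; apply: emeasurable_funM; last exact: (lmf_cons x mG).
  by apply/measurable_EFinP; exact: (lmf_prod mz).
- by move=> s; rewrite mule_ge0 // lee_fin prodr_ge0.
- by rewrite lee_fin.
Qed.
End ItDensity.

(** * Double sums and Cauchy products *)

Lemma sum_triangle (V : nmodType) (F : nat -> nat -> V) M :
  \sum_(m < M) \sum_(k < m.+1) F k (m - k)%N = \sum_(k < M) \sum_(l < M - k) F k l.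
Proof.
elim: M => [|M IH]; first by rewrite !big_ord0.
rewrite big_ord_recr /= IH [RHS]big_ord_recr /= subSnn big_ord_recr /= subnn big_ord1.
rewrite addrA; congr (_ + _); rewrite -big_split /=; apply: eq_bigr => k _.
by rewrite subSn ?(ltnW (ltn_ord k)) // big_ord_recr.
Qed.

Section CauchyProduct.
Context {R : realType}.
Implicit Types u v : nat -> R.

Definition abs_bounded u := exists C, forall M, \sum_(k < M) `|u k| <= C.

Definition seq_conv u v m := \sum_(k < m.+1) u k * v (m - k)%N.

Lemma nneg_bounded_cvg u C : (forall k, 0 <= u k) -> (forall M, \sum_(k < M) u k <= C) ->
  cvgn (fun M => \sum_(k < M) u k).
Proof.
move=> u0 uC; apply: nondecreasing_is_cvgn.
  apply/nondecreasing_seqP => n; rewrite big_ord_recr /= lerDl //.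
by exists C => _ [n _ <-].
Qed.

Lemma abs_bounded_cvg u : abs_bounded u -> cvgn (fun M => \sum_(k < M) u k).
Proof.
case=> C uC; have e (f : nat -> R) : (fun M => \sum_(k < M) f k) = series f.
  by apply/funext => M; rewrite /series /= big_mkord.
rewrite e; apply: normed_cvg; rewrite (_ : [normed _] = series (fun k => `|u k|)) // -e.
by apply: (@nneg_bounded_cvg (fun k => `|u k|) C).
Qed.

(** The square of indices minus the triangle [k + l < M] leaves the pairs with [k + l >= M]. *)
Lemma sum_square_conv u v M :
  (\sum_(k < M) u k) * (\sum_(l < M) v l) - \sum_(m < M) seq_conv u v m
  = \sum_(k < M) u k * \sum_(M - k <= l < M) v l.
Proof.
rewrite (sum_triangle (fun k l => u k * v l)) big_distrl /= -sumrB.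
apply: eq_bigr => k _; rewrite -mulr_sumr -mulrBr; congr (_ * _).
rewrite -!(big_mkord xpredT (fun l => v l)).
by rewrite (big_cat_nat (leq0n (M - k)%N) (leq_subr k M)) /= addrAC subrr add0r.
Qed.

Lemma conv_sum_le u v M : (forall k, 0 <= u k) -> (forall k, 0 <= v k) ->
  \sum_(m < M) seq_conv u v m <= (\sum_(k < M) u k) * (\sum_(l < M) v l).
Proof.
move=> u0 v0; rewrite -subr_ge0 sum_square_conv.
by apply: sumr_ge0 => k _; rewrite mulr_ge0 // sumr_ge0.
Qed.

Lemma ler_sum_widen u n m : (n <= m)%N -> (forall k, 0 <= u k) ->
  \sum_(k < n) u k <= \sum_(k < m) u k.
Proof.
move=> nm u0; rewrite -!(big_mkord xpredT) (big_cat_nat (leq0n n) nm) /= lerDl.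
exact: sumr_ge0.
Qed.

Lemma conv_sum_ge u v M : (forall k, 0 <= u k) -> (forall k, 0 <= v k) ->
  (\sum_(k < M./2) u k) * (\sum_(l < M./2) v l) <= \sum_(m < M) seq_conv u v m.
Proof.
move=> u0 v0; rewrite (sum_triangle (fun k l => u k * v l)) big_distrl /=.
apply: (@le_trans _ _ (\sum_(k < M./2) \sum_(l < M - k) u k * v l)).
  apply: ler_sum => k _; rewrite mulr_sumr; apply: (@ler_sum_widen (fun l => u k * v l)).
    by move: (ltn_ord k); lia.
  by move=> l; exact: mulr_ge0.
apply: (@ler_sum_widen (fun k => \sum_(l < M - k) u k * v l)); first by lia.
by move=> k; apply: sumr_ge0 => l _; exact: mulr_ge0.
Qed.

Lemma cvg_half (f : nat -> R) (l : R) : f @ \oo --> l -> (fun M => f M./2) @ \oo --> l.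
Proof.
move=> fl; apply: cvg_trans fl; move=> A [N _ NA]; exists N.*2 => // M /= NM; apply: NA => /=.
by rewrite -(doubleK N) half_leq.
Qed.

(** The triangle contains the square of side [M./2]. For absolute values, square minus triangle is
    thus at most a difference [B] of two squares with the same limit, and this dominates the
    corresponding difference [D] for [u] and [v]. *)
Lemma cauchy_product u v (U V : R) : abs_bounded u -> abs_bounded v ->
  (fun M => \sum_(k < M) u k) @ \oo --> U -> (fun M => \sum_(k < M) v k) @ \oo --> V ->
  (fun M => \sum_(m < M) seq_conv u v m) @ \oo --> U * V.
Proof.
move=> bu bv cu cv.
pose au k := `|u k|; pose av k := `|v k|.
have [/cvg_ex[/= AU cAU] /cvg_ex[/= AV cAV]] :
    cvgn (fun M => \sum_(k < M) au k) /\ cvgn (fun M => \sum_(k < M) av k).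
  case: bu bv => C1 b1 [C2 b2]; split;
    [exact: (nneg_bounded_cvg (fun k => normr_ge0 (u k)) b1)
    |exact: (nneg_bounded_cvg (fun k => normr_ge0 (v k)) b2)].
pose D M := (\sum_(k < M) u k) * (\sum_(l < M) v l) - \sum_(m < M) seq_conv u v m.
pose B M := (\sum_(k < M) au k) * (\sum_(l < M) av l)
   - (\sum_(k < M./2) au k) * (\sum_(l < M./2) av l).
have B0 : B @ \oo --> (0 : R).
  rewrite -[X in _ --> X](subrr (AU * AV)); apply: cvgB; first exact: cvgM.
  by apply: cvgM; [exact: (cvg_half cAU)|exact: (cvg_half cAV)].
have DB M : `|D M| <= B M.
  rewrite /D sum_square_conv.
  apply: (@le_trans _ _ (\sum_(k < M) au k * \sum_(M - k <= l < M) av l)).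
    apply: (le_trans (ler_norm_sum _ _ _)); apply: ler_sum => k _.
    by rewrite normrM ler_wpM2l // ler_norm_sum.
  rewrite -sum_square_conv /B lerD2l lerN2.
  by apply: conv_sum_ge => k; exact: normr_ge0.
have D0 : D @ \oo --> (0 : R).
  apply/cvgr0Pnorm_lt => e e0; move/cvgr0Pnorm_lt: B0 => /(_ _ e0).
  apply: filterS => M; apply: le_lt_trans; apply: (le_trans (DB M)); exact: ler_norm.
rewrite (_ : (fun M => \sum_(m < M) seq_conv u v m) =
    (fun M => (\sum_(k < M) u k) * (\sum_(l < M) v l) - D M)).
  by rewrite -[X in _ --> X]subr0; apply: cvgB D0; exact: cvgM.
by apply/funext => M; rewrite /D subKr.
Qed.
End CauchyProduct.

(** * Integrated graph sums and their bounds *)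

Section JLemmas.
Context {d : measure_display} {X : measurableType d} {R : realType}.
Variable nu : {sigma_finite_measure set X -> \bar R}.
Local Open Scope ereal_scope.

Lemma lmf_EFin (G : seq X -> R) : lmf G -> lmf (fun s => (G s)%:E).
Proof. by move=> mG d' T us mus; apply/measurable_EFinP; exact: mG. Qed.

Lemma lmf2_EFin (H : seq X -> seq X -> R) : lmf2 H -> lmf2 (fun a b => (H a b)%:E).
Proof. by move=> mH d' T us vs mus mvs; apply/measurable_EFinP; exact: mH. Qed.

Lemma lmfM (G G' : seq X -> \bar R) : lmf G -> lmf G' -> lmf (fun s => G s * G' s).
Proof. by move=> mG mG' d' T us mus; apply: emeasurable_funM; [exact: mG|exact: mG']. Qed.

Lemma lmfD (G G' : seq X -> \bar R) : lmf G -> lmf G' -> lmf (fun s => G s + G' s).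
Proof. by move=> mG mG' d' T us mus; apply: emeasurable_funD; [exact: mG|exact: mG']. Qed.

Lemma lmf_sum (I : Type) (r : seq I) (G : I -> seq X -> \bar R) : (forall i, lmf (G i)) ->
  lmf (fun s => \sum_(i <- r) G i s).
Proof. by move=> mG d' T us mus; apply: emeasurable_sum => i; exact: mG. Qed.

Lemma lmf2M (H H' : seq X -> seq X -> \bar R) : lmf2 H -> lmf2 H' ->
  lmf2 (fun a b => H a b * H' a b).
Proof. by move=> m m' d' T us vs mus mvs; apply: emeasurable_funM; [exact: m|exact: m']. Qed.

Lemma J_ge0 m G : (forall s, 0 <= G s) -> 0 <= J nu m G.
Proof. by move=> G0; apply: mule_ge0 => //; exact: It_ge0. Qed.

Lemma eq_J m G G' : (forall s, size s = m -> G s = G' s) -> J nu m G = J nu m G'.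
Proof. by move=> e; rewrite /J (eq_It _ e). Qed.

Lemma lmf_J m (H : seq X -> seq X -> \bar R) : lmf2 H -> (forall a b, 0 <= H a b) ->
  lmf (fun a => J nu m (H a)).
Proof. by move=> mH H0; apply: lmfM; [exact: lmf_cst|exact: lmf_It]. Qed.

Lemma JD m (G G' : seq X -> \bar R) : lmf G -> lmf G' -> (forall s, 0 <= G s) ->
  (forall s, 0 <= G' s) -> J nu m (fun s => G s + G' s) = J nu m G + J nu m G'.
Proof.
by move=> *; rewrite /J ItD // ge0_muleDr //; exact: It_ge0.
Qed.

Lemma J_sum m (I : Type) (r : seq I) (G : I -> seq X -> \bar R) :
  (forall i, lmf (G i)) -> (forall i s, 0 <= G i s) ->
  J nu m (fun s => \sum_(i <- r) G i s) = \sum_(i <- r) J nu m (G i).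
Proof.
move=> mG G0; rewrite /J It_sum // ge0_sume_distrr // => i _; exact: It_ge0.
Qed.

Lemma JZl m c (G : seq X -> \bar R) : lmf G -> (forall s, 0 <= G s) -> 0 <= c ->
  J nu m (fun s => c * G s) = c * J nu m G.
Proof. by move=> *; rewrite /J ItZl // muleCA. Qed.

Lemma le_J_ae (N0 : set X) m (G G' : seq X -> \bar R) : measurable N0 -> nu N0 = 0 ->
  lmf G -> lmf G' -> (forall s, 0 <= G s) -> (forall s, 0 <= G' s) ->
  (forall s, size s = m -> avoids N0 s -> G s <= G' s) -> J nu m G <= J nu m G'.
Proof. by move=> *; rewrite /J lee_wpmul2l //; exact: (@le_It_ae _ _ _ nu N0). Qed.

Lemma le_J m (G G' : seq X -> \bar R) :
  lmf G -> lmf G' -> (forall s, 0 <= G s) -> (forall s, 0 <= G' s) ->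
  (forall s, size s = m -> G s <= G' s) -> J nu m G <= J nu m G'.
Proof. by move=> *; rewrite /J lee_wpmul2l //; exact: le_It. Qed.

Lemma J_spl_fin m (K : seq X -> seq X -> seq X -> \bar R) s :
  (forall a b, lmf (K a b)) -> (forall a b t, 0 <= K a b t) ->
  J nu m (fun t => spl (fun a b => K a b t) s) = spl (fun a b => J nu m (K a b)) s.
Proof.
elim: s K => [|x s IH] K mK K0 //=.
have mS (K' : seq X -> seq X -> seq X -> \bar R) : (forall a b, lmf (K' a b)) -> lmf (fun t => spl (fun a b => K' a b t) s).
  elim: {IH} s K' => [|y s IH] K' mK' /=; first exact: mK'.
  by apply: lmfD; exact: IH.
rewrite -(IH (fun a b => K (x :: a) b)) // -(IH (fun a b => K a (x :: b))) // -JD //.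
- exact: (mS (fun a b => K (x :: a) b)).
- exact: (mS (fun a b => K a (x :: b))).
- by move=> t; apply: spl_ge0e.
- by move=> t; apply: spl_ge0e.
Qed.

Lemma spl_EFin (H : seq X -> seq X -> R) s : (spl H s)%:E = spl (fun a b => (H a b)%:E) s.
Proof. by apply: spl_morph => x y; rewrite EFinD. Qed.
End JLemmas.

Section Expansion.
Context {d : measure_display} {X : measurableType d} {R : realType}.
Variable nu : {sigma_finite_measure set X -> \bar R}.
Variable w : X -> X -> R.
Hypothesis w01 : forall x y, (0 <= w x y <= 1)%R.
Hypothesis mw : measurable_fun setT (uncurry w).
Local Open Scope ereal_scope.

Let gaE xs ys : \bar R := (ga w xs ys)%:E.
Let gaE0 xs ys : 0 <= gaE xs ys. Proof. by rewrite lee_fin ga_ge0. Qed.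
Let mgaE : lmf2 gaE. Proof. exact/lmf2_EFin/lmf2_ga. Qed.
Let wp0 x s : (0 <= wprod w x s)%R. Proof. by case/andP: (wprod01 w01 x s). Qed.
Let cp0 x s : (0 <= cprod w x s)%R. Proof. by case/andP: (cprod01 w01 x s). Qed.
Let Z0 s : (0 <= Zprod w s)%R. Proof. by case/andP: (Zprod01 w01 s). Qed.

Definition Aint m xs : \bar R := J nu m (gaE xs).

Lemma Aint_ge0 m xs : 0 <= Aint m xs.
Proof. exact: J_ge0. Qed.

Lemma lmf_Aint m : lmf (Aint m).
Proof. exact: lmf_J. Qed.

Lemma Aint_nil m : Aint m [::] = (m == 0%N)%:R%:E.
Proof.
rewrite /Aint; case: m => [|m].
  by rewrite /J /= /gaE ga_nil eqxx invr1 mul1e.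
rewrite (@eq_J _ _ _ nu m.+1 _ (fun _ => 0)) => [|s sm].
  by rewrite /J It0 mule0.
by rewrite /gaE ga_nil; case: s sm.
Qed.

(** The contribution of [k] unlabelled points, each joined to [x] by an edge, when [x] is removed
    from the roots. *)
Definition attach x k (G : seq X -> \bar R) : \bar R :=
  J nu k (fun ys => (wprod w x ys)%:E * G ys).

Lemma Aint_cons m x xs : Aint m (x :: xs) =
  (cprod w x xs)%:E * \sum_(k < m.+1) attach x k (fun ys => Aint (m - k) (ys ++ xs)).
Proof.
pose H a b := (wprod w x a)%:E * gaE (a ++ xs) b.
have mH : lmf2 H.
  by apply: lmf2M; [exact/lmf2_fst/lmf_EFin/lmf_wprod|exact: lmf2_catr].
have H0 a b : 0 <= H a b by apply: mule_ge0 => //; rewrite lee_fin.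
transitivity (J nu m (fun ys => (cprod w x xs)%:E * spl H ys)).
  apply: eq_J => ys _; rewrite /gaE ga_cons EFinM spl_EFin; congr (_ * _).
rewrite JZl ?lee_fin //; [|exact: lmf2_spl_ereal|by move=> s; exact: spl_ge0e].
rewrite J_spl //; congr (_ * _); apply: eq_bigr => k _; apply: eq_J => a _.
rewrite JZl // ?lee_fin //; exact: lmf2_lmf1.
Qed.

Definition Vsum (c : nat -> R) M xs : \bar R := \sum_(m < M.+1) (c m)%:E * Aint m xs.

Lemma Vsum_ge0 c M xs : (forall m, (0 <= c m)%R) -> 0 <= Vsum c M xs.
Proof. by move=> c0; apply: sume_ge0 => m _; rewrite mule_ge0 ?lee_fin ?Aint_ge0. Qed.

Lemma lmf_Vsum c M : lmf (Vsum c M).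
Proof. by apply: lmf_sum => m; apply: lmfM; [exact: lmf_cst|exact: lmf_Aint]. Qed.

Lemma lmf_attach_arg x xs (G : seq X -> \bar R) : lmf G ->
  lmf (fun ys => (wprod w x ys)%:E * G (ys ++ xs)).
Proof. by move=> mG; apply: lmfM; [exact/lmf_EFin/lmf_wprod|exact: lmf_catr]. Qed.

Lemma attach_ge0 x k G : (forall s, 0 <= G s) -> 0 <= attach x k G.
Proof. by move=> G0; apply: J_ge0 => s; rewrite mule_ge0 ?lee_fin. Qed.

Lemma sum_triangle_ereal (F : nat -> nat -> \bar R) M :
  \sum_(m < M) \sum_(k < m.+1) F k (m - k)%N = \sum_(k < M) \sum_(l < M - k) F k l.
Proof. exact: sum_triangle. Qed.

(** When [x] is removed with [k] neighbours, at most [M - k] points remain to be integrated and the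
    coefficients are read from index [k] on. *)
Lemma Vsum_cons c M x xs : (forall m, (0 <= c m)%R) -> Vsum c M (x :: xs) =
  (cprod w x xs)%:E * \sum_(k < M.+1)
    attach x k (fun ys => Vsum (fun m => c (k + m)%N) (M - k) (ys ++ xs)).
Proof.
move=> c0; rewrite /Vsum.
have at0 k m : 0 <= attach x k (fun ys => Aint m (ys ++ xs)).
  by apply: attach_ge0 => s; exact: Aint_ge0.
under eq_bigr => m _ do rewrite Aint_cons muleCA ge0_sume_distrr //.
rewrite -ge0_sume_distrr; last first.
  by move=> m _; apply: sume_ge0 => k _; rewrite mule_ge0 ?lee_fin.
congr (_ * _).
pose F k l := (c (k + l)%N)%:E * attach x k (fun ys => Aint l (ys ++ xs)).
transitivity (\sum_(m < M.+1) \sum_(k < m.+1) F k (m - k)%N).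
  by apply: eq_bigr => m _; apply: eq_bigr => k _; rewrite /F subnKC // -ltnS.
rewrite sum_triangle_ereal; apply: eq_bigr => k _.
rewrite subSn; last by rewrite -ltnS.
transitivity (J nu k (fun ys => \sum_(l < (M - k).+1) (c (k + l)%N)%:E *
   ((wprod w x ys)%:E * Aint l (ys ++ xs)))); last first.
  apply: eq_J => ys _; rewrite ge0_sume_distrr; last first.
    by move=> l _; rewrite mule_ge0 ?lee_fin ?Aint_ge0.
  by apply: eq_bigr => l _; rewrite muleCA.
have m1 l := lmf_attach_arg x xs (lmf_Aint l).
rewrite J_sum.
- apply: eq_bigr => l _; rewrite /F /attach JZl ?lee_fin //.
  by move=> s; rewrite mule_ge0 ?lee_fin ?Aint_ge0.
- by move=> l; apply: lmfM => //; exact: lmf_cst.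
- by move=> l s; rewrite mule_ge0 ?lee_fin // mule_ge0 ?lee_fin ?Aint_ge0.
Qed.
End Expansion.

Lemma Zprod_cat_le (T : eqType) (R : realDomainType) (w : T -> T -> R)
  (w01 : forall x y, 0 <= w x y <= 1) s t : Zprod w (s ++ t) <= Zprod w s * Zprod w t.
Proof.
have Z0 u : 0 <= Zprod w u by case/andP: (Zprod01 w01 u).
have c0 x u : 0 <= cprod w x u by case/andP: (cprod01 w01 x u).
elim: s => [|x s IH] /=; first by rewrite mul1r.
rewrite cprod_cat -!mulrA ler_wpM2l //; apply: le_trans IH.
by rewrite ler_piMl //; case/andP: (cprod01 w01 x t).
Qed.

(** * Propagation of the exponential bound and of the alternating inequalities *)

Section Bounds.
Context {d : measure_display} {X : measurableType d} {R : realType}.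
Variable nu : {sigma_finite_measure set X -> \bar R}.
Variable w : X -> X -> R.
Hypothesis w01 : forall x y, (0 <= w x y <= 1)%R.
Hypothesis mw : measurable_fun setT (uncurry w).
Variable N0 : set X.
Hypothesis mN0 : measurable N0.
Hypothesis nuN0 : nu N0 = 0%E.
Variables (a : X -> R) (t : R).
Hypothesis a0 : forall x, 0 <= a x.
Hypothesis ma : measurable_fun setT a.
Hypothesis t0 : 0 < t.
Local Open Scope ereal_scope.

Definition ea s : R := (\prod_(y <- s) expR (a y))%R.

Hypothesis cond : forall x, ~ N0 x ->
  \sum_(1 <= k <oo) (expR (t * k%:R))%:E * attach nu w x k (fun ys => (Zprod w ys * ea ys)%:E)
  <= (expR (a x) - 1)%:E.

Let wp0 x s : (0 <= wprod w x s)%R. Proof. by case/andP: (wprod01 w01 x s). Qed.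
Let cp0 x s : (0 <= cprod w x s)%R. Proof. by case/andP: (cprod01 w01 x s). Qed.
Let Z0 s : (0 <= Zprod w s)%R. Proof. by case/andP: (Zprod01 w01 s). Qed.

Lemma ea_ge1 s : (1 <= ea s)%R.
Proof.
rewrite /ea; elim: s => [|y s IH]; first by rewrite big_nil.
rewrite big_cons; apply: (le_trans IH); rewrite ler_peMl //; first exact: le_trans IH.
by rewrite -expR0 ler_expR.
Qed.
Let ea0 s : (0 <= ea s)%R. Proof. exact: le_trans (ea_ge1 s). Qed.

Lemma ea_cons x s : ea (x :: s) = (expR (a x) * ea s)%R.
Proof. by rewrite /ea big_cons. Qed.
Lemma ea_cat s u : ea (s ++ u) = (ea s * ea u)%R.
Proof. by rewrite /ea big_cat. Qed.

Lemma lmf_ea : lmf ea.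
Proof. by apply: lmf_prod; exact: measurableT_comp. Qed.

Let Zea s : \bar R := (Zprod w s * ea s)%:E.
Let Zea0 s : 0 <= Zea s. Proof. by rewrite lee_fin mulr_ge0. Qed.
Let mZea : lmf Zea.
Proof. by apply: lmf_EFin => d' T us mus; apply: measurable_funM; [exact: lmf_Zprod|exact: lmf_ea]. Qed.

Lemma lmf_attach_fun x (G : seq X -> \bar R) : lmf G -> lmf (fun ys => (wprod w x ys)%:E * G ys).
Proof. by move=> mG; apply: lmfM => //; exact/lmf_EFin/lmf_wprod. Qed.

Lemma attachD x k G G' : lmf G -> lmf G' -> (forall s, 0 <= G s) -> (forall s, 0 <= G' s) ->
  attach nu w x k (fun s => G s + G' s) = attach nu w x k G + attach nu w x k G'.
Proof.
move=> mG mG' G0 G0'; rewrite /attach -JD; try exact: lmf_attach_fun.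
- by apply: eq_J => s _; rewrite ge0_muleDr.
- by move=> s; apply: mule_ge0 => //; rewrite lee_fin.
- by move=> s; apply: mule_ge0 => //; rewrite lee_fin.
Qed.

Lemma attachZ x k c G : lmf G -> (forall s, 0 <= G s) -> 0 <= c ->
  attach nu w x k (fun s => c * G s) = c * attach nu w x k G.
Proof.
move=> mG G0 c0; rewrite /attach -JZl //; try exact: lmf_attach_fun.
- by apply: eq_J => s _; rewrite muleCA.
- by move=> s; apply: mule_ge0 => //; rewrite lee_fin.
Qed.

Lemma le_attach x k G G' : lmf G -> lmf G' -> (forall s, 0 <= G s) -> (forall s, 0 <= G' s) ->
  (forall s, size s = k -> avoids N0 s -> G s <= G' s) ->
  attach nu w x k G <= attach nu w x k G'.
Proof.
move=> mG mG' G0 G0' le; apply: (@le_J_ae _ _ _ nu N0) => //; try exact: lmf_attach_fun.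
- by move=> s; apply: mule_ge0 => //; rewrite lee_fin.
- by move=> s; apply: mule_ge0 => //; rewrite lee_fin.
- by move=> s sk gs; rewrite lee_wpmul2l ?lee_fin // le.
Qed.

Lemma attach0 x G : attach nu w x 0 G = G [::].
Proof. by rewrite /attach /J /= /wprod big_nil invr1 !mul1e. Qed.

(** The term [k = 0], equal to 1, turns the bound [expR (a x) - 1] of the hypothesis into
    [expR (a x)]. *)
Lemma attach_sum_le x M : ~ N0 x ->
  \sum_(k < M.+1) (expR (t * k%:R))%:E * attach nu w x k Zea <= (expR (a x))%:E.
Proof.
move=> Nx; pose F k := (expR (t * k%:R))%:E * attach nu w x k Zea.
have F0 k : 0 <= F k by rewrite mule_ge0 ?lee_fin ?expR_ge0 // attach_ge0.
rewrite -(big_mkord xpredT F) big_nat_recl //.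
have -> : (expR (a x))%:E = 1 + (expR (a x) - 1)%:E by rewrite -EFinD addrC subrK.
have -> : F 0%N = 1.
  by rewrite /F attach0 mulr0 expR0 mul1e /Zea /= /ea big_nil mulr1.
rewrite leeD2l //; apply: le_trans (cond Nx).
rewrite -(big_add1 _ _ 0 M.+1 xpredT F) /=.
by apply: (nneseries_lim_ge (u_ := F) M.+1) => n _ _; exact: F0.
Qed.

Lemma Vsum_nil c M : Vsum nu w c M [::] = (c 0%N)%:E.
Proof.
rewrite /Vsum big_ord_recl Aint_nil mule1 big1 ?adde0 // => i _.
by rewrite Aint_nil mule0.
Qed.

(** Induction on [M + size xs], which drops by one when [x] is removed: its [k] neighbours become
    roots while [M] becomes [M - k]. The induction hypothesis bounds the inner sum, the cross
    factors of [Zprod] are dropped, and [attach_sum_le] supplies the missing [expR (a x)]. *)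
Lemma Vsum_expR_le M xs : avoids N0 xs ->
  Vsum nu w (fun m => expR (t * m%:R)) M xs <= (Zprod w xs * ea xs)%:E.
Proof.
move: {2}(M + size xs)%N (leqnn (M + size xs)%N) => n; elim: n M xs => [|n IH] M [|x xs] le; try by move: le; rewrite /= addnS.
- by move=> _; rewrite Vsum_nil mulr0 expR0 /= /ea big_nil mulr1.
- by move=> _; rewrite Vsum_nil mulr0 expR0 /= /ea big_nil mulr1.
move=> /avoids_cons[Nx gxs]; rewrite Vsum_cons //.
apply: (@le_trans _ _ ((cprod w x xs)%:E * (Zea xs *
  \sum_(k < M.+1) (expR (t * k%:R))%:E * attach nu w x k Zea))); last first.
  apply: (@le_trans _ _ ((cprod w x xs)%:E * (Zea xs * (expR (a x))%:E))).
    by rewrite lee_wpmul2l ?lee_fin // lee_wpmul2l // attach_sum_le.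
  by rewrite /Zea -!EFinM lee_fin /= ea_cons; lra.
rewrite lee_wpmul2l ?lee_fin // ge0_sume_distrr; last first.
  by move=> k _; rewrite mule_ge0 ?lee_fin ?expR_ge0 // attach_ge0.
apply: lee_sum => k _.
have e m : expR (t * (k + m)%N%:R) = (expR (t * k%:R) * expR (t * m%:R))%R.
  by rewrite natrD mulrDr expRD.
have kM : (k <= M)%N by rewrite -ltnS.
rewrite muleCA -attachZ // -attachZ ?lee_fin ?expR_ge0 //; last 2 first.
- by apply: lmfM => //; exact: lmf_cst.
- by move=> s; exact: mule_ge0.
apply: le_attach.
- by apply: lmf_catr; exact: lmf_Vsum.
- by apply: lmfM; [exact: lmf_cst|]; apply: lmfM; [exact: lmf_cst|].
- by move=> s; apply: Vsum_ge0 => // m; exact: expR_ge0.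
- by move=> s; apply: mule_ge0; [rewrite lee_fin expR_ge0|exact: mule_ge0].
move=> ys sk gys; rewrite /Vsum.
under eq_bigr do rewrite e EFinM -muleA.
rewrite -ge0_sume_distrr; last by move=> m _; rewrite mule_ge0 ?lee_fin ?expR_ge0 ?Aint_ge0.
rewrite lee_wpmul2l ?lee_fin ?expR_ge0 //.
apply: (@le_trans _ _ (Zprod w (ys ++ xs) * ea (ys ++ xs))%:E).
  apply: IH; last exact/avoids_cat.
  by rewrite size_cat sk; move: le; rewrite /=; lia.
rewrite /Zea -EFinM lee_fin ea_cat.
rewrite [leRHS](_ : _ = (Zprod w ys * Zprod w xs * (ea ys * ea xs))%R); last by ring.
by rewrite ler_wpM2r ?mulr_ge0 // Zprod_cat_le.
Qed.

Lemma attach_fin_num x k : ~ N0 x -> attach nu w x k Zea \is a fin_num.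
Proof.
move=> Nx; rewrite ge0_fin_numE ?attach_ge0 //.
have e0 j : 0 <= (expR (t * j%:R))%:E :> \bar R by rewrite lee_fin expR_ge0.
apply: (@le_lt_trans _ _ (expR (a x))%:E); last exact: ltry.
apply: le_trans (attach_sum_le k Nx).
rewrite big_ord_recr /=; apply: (@le_trans _ _ ((expR (t * k%:R))%:E * attach nu w x k Zea)).
  rewrite -[leLHS]mul1e lee_wpmul2r ?attach_ge0 // lee_fin -expR0 ler_expR.
  by rewrite mulr_ge0 ?ler0n // ltW.
by rewrite leeDr //; apply: sume_ge0 => j _; rewrite mule_ge0 ?attach_ge0.
Qed.

Section Bonferroni.
Variable Rt : seq X -> R.
Hypothesis mRt : lmf Rt.
Hypothesis Rt0 : forall s, (0 <= Rt s)%R.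
Hypothesis Rt_nil : Rt [::] = 1%R.
Hypothesis Rt_le : forall ys xs, (Rt (ys ++ xs) <= Zprod w ys)%R.

(** Indicator of the odd ([b = true]) or even numbers. In [ks] and [bonferroni] the right side minus
    the left side is [(-1)^N], respectively [(-1)^M], times a partial alternating sum minus the
    value of [Rt]; separating the parities leaves only nonnegative extended reals. *)
Definition par b n : R := (odd n == b)%:R.

Hypothesis ks : forall x xs N, ~ N0 x -> avoids N0 xs ->
  (cprod w x xs)%:E * (\sum_(k < N.+1) (par true (N + k))%:E *
      attach nu w x k (fun ys => (Rt (ys ++ xs))%:E)) + (par false N * Rt (x :: xs))%:E <=
  (cprod w x xs)%:E * (\sum_(k < N.+1) (par false (N + k))%:E *
      attach nu w x k (fun ys => (Rt (ys ++ xs))%:E)) + (par true N * Rt (x :: xs))%:E.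

Lemma par_ge0 b n : (0 <= par b n)%R. Proof. by rewrite /par ler0n. Qed.
Lemma parE b n m : odd n = odd m -> par b n = par b m. Proof. by rewrite /par => ->. Qed.

Let mRE xs : lmf (fun ys => (Rt (ys ++ xs))%:E).
Proof. exact/lmf_EFin/lmf_catr. Qed.
Let RE0 xs ys : 0 <= (Rt (ys ++ xs))%:E. Proof. by rewrite lee_fin. Qed.

Lemma attach_Rt_fin_num x k xs : ~ N0 x ->
  attach nu w x k (fun ys => (Rt (ys ++ xs))%:E) \is a fin_num.
Proof.
move=> Nx; rewrite ge0_fin_numE ?attach_ge0 //.
apply: (@le_lt_trans _ _ (attach nu w x k Zea)); last first.
  by rewrite -ge0_fin_numE ?attach_ge0 // attach_fin_num.
apply: le_attach => // s _ _; rewrite lee_fin; apply: (le_trans (Rt_le s xs)).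
by rewrite ler_peMr // ea_ge1.
Qed.

(** After removal of [x], the induction hypothesis is applied for each [k] at [M - k], which has the
    parity of [M + k], and integrated over the [k] neighbours. This compares the sums [B] with the
    integrals [I] of [Rt]; adding [ks] at [N = M] eliminates [I]. *)
Lemma bonferroni M xs : avoids N0 xs ->
  Vsum nu w (fun m => par true (M + m)) M xs + (par false M * Rt xs)%:E <=
  Vsum nu w (fun m => par false (M + m)) M xs + (par true M * Rt xs)%:E.
Proof.
move: {2}(M + size xs)%N (leqnn (M + size xs)%N) => n.
elim: n M xs => [|n IH] M [|x xs] le; try by move: le; rewrite /= addnS.
1,2: by move=> _; rewrite !Vsum_nil Rt_nil !mulr1 addn0 addeC.
move=> /avoids_cons[Nx gxs]; rewrite !Vsum_cons //; try by move=> m; exact: par_ge0.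
pose I k := attach nu w x k (fun ys => (Rt (ys ++ xs))%:E).
pose B b k := attach nu w x k (fun ys => Vsum nu w (fun m => par b (M + (k + m))) (M - k) (ys ++ xs)).
have I0 k : 0 <= I k by exact: attach_ge0.
have Ifin k : I k \is a fin_num by exact: attach_Rt_fin_num.
have B0 b k : 0 <= B b k.
  by apply: attach_ge0 => // s; apply: Vsum_ge0 => // m; exact: par_ge0.
have p0 b k : 0 <= (par b k)%:E by rewrite lee_fin par_ge0.
have c0 : 0 <= (cprod w x xs)%:E by rewrite lee_fin.
have step (k : 'I_M.+1) : B true k + (par false (M + k))%:E * I k <=
    B false k + (par true (M + k))%:E * I k.
  have kM : (k <= M)%N by rewrite -ltnS.
  have mV b : lmf (fun ys => Vsum nu w (fun m => par b (M + (k + m))) (M - k) (ys ++ xs)).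
    by apply: lmf_catr; exact: lmf_Vsum.
  have V0 b ys : 0 <= Vsum nu w (fun m => par b (M + (k + m))) (M - k) (ys ++ xs).
    by apply: Vsum_ge0 => // m; exact: par_ge0.
  have mpR b : lmf (fun ys => (par b (M + k))%:E * (Rt (ys ++ xs))%:E).
    by apply: lmfM => //; exact: lmf_cst.
  have pR0 b ys : 0 <= (par b (M + k))%:E * (Rt (ys ++ xs))%:E by exact: mule_ge0.
  rewrite -!attachZ // -!attachD //; apply: le_attach => //.
  - exact: lmfD.
  - exact: lmfD.
  - by move=> s; exact: adde_ge0.
  - by move=> s; exact: adde_ge0.
  move=> ys sk gys.
  have eV b : Vsum nu w (fun m => par b (M + (k + m))) (M - k) (ys ++ xs) =
      Vsum nu w (fun m => par b ((M - k) + m)) (M - k) (ys ++ xs).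
    apply: eq_bigr => m _; congr (_%:E * _); apply: parE.
    by rewrite -{1}(subnK kM) !oddD; case: odd; case: (odd k); case: (odd m).
  have ep b : par b (M + k) = par b (M - k).
    by apply: parE; rewrite -{1}(subnK kM) !oddD; case: odd; case: (odd k).
  rewrite !eV !ep -!EFinM; apply: IH; last exact/avoids_cat.
  by rewrite size_cat sk; move: le; rewrite /=; lia.
have S b b' : \sum_(k < M.+1) (B b k + (par b' (M + k))%:E * I k) =
    \sum_(k < M.+1) B b k + \sum_(k < M.+1) (par b' (M + k))%:E * I k by rewrite big_split.
have Sle : \sum_(k < M.+1) (B true k + (par false (M + k))%:E * I k) <=
    \sum_(k < M.+1) (B false k + (par true (M + k))%:E * I k) by apply: lee_sum => k _; exact: step.
pose T b := (cprod w x xs)%:E * \sum_(k < M.+1) (par b (M + k))%:E * I k.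
have Tfin b : T b \is a fin_num.
  rewrite fin_numM //; apply/sum_fin_numP => k _ _; rewrite fin_numM //.
have SB0 b : 0 <= \sum_(k < M.+1) B b k by apply: sume_ge0 => k _.
have SP0 b : 0 <= \sum_(k < M.+1) (par b (M + k))%:E * I k.
  by apply: sume_ge0 => k _; exact: mule_ge0.
have cS : (cprod w x xs)%:E * (\sum_(k < M.+1) B true k) + T false <=
    (cprod w x xs)%:E * (\sum_(k < M.+1) B false k) + T true.
  by rewrite -!ge0_muleDr // lee_wpmul2l // -!S.
(* Both sides now contain [T true + T false], which is finite and cancels. *)
have K := leeD cS (ks M Nx gxs).
rewrite -/(T true) -/(T false) in K.
have cancel u v u' v' : u + T false + (T true + v) <= u' + T true + (T false + v') ->
    u + v <= u' + v'.
  have -> : u + T false + (T true + v) = (u + v) + (T false + T true).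
    by rewrite -!addeA; congr (_ + _); rewrite [RHS]addeC -addeA.
  have -> : u' + T true + (T false + v') = (u' + v') + (T false + T true).
    rewrite -!addeA; congr (_ + _); rewrite [RHS]addeC -addeA addeCA; congr (_ + _).
  by rewrite leeD2rE // fin_numD !Tfin.
exact: cancel K.
Qed.
End Bonferroni.
End Bounds.

(** * The expansion of the truncated functions *)

Section EBounded.
Context {R : realType}.
Local Open Scope ereal_scope.
Implicit Types u v : nat -> \bar R.

Definition ebounded u := exists C : R, forall M, \sum_(m < M) u m <= C%:E.

Lemma ebounded_fin u m : (forall k, 0 <= u k) -> ebounded u -> u m \is a fin_num.
Proof.
move=> u0 [C uC]; rewrite ge0_fin_numE //; apply: (@le_lt_trans _ _ C%:E); last exact: ltry.
by apply: le_trans (uC m.+1); rewrite big_ord_recr /= leeDr // sume_ge0.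
Qed.

Lemma ebounded_le u v : (forall m, u m <= v m) -> ebounded v -> ebounded u.
Proof.
by move=> uv [C vC]; exists C => M; apply: le_trans (vC M); apply: lee_sum => k _; exact: uv.
Qed.

Lemma eboundedD u v : ebounded u -> ebounded v -> ebounded (fun m => u m + v m).
Proof.
by move=> [C uC] [C' vC]; exists (C + C')%R => M; rewrite big_split EFinD; apply: leeD; [exact: uC|exact: vC].
Qed.

Lemma ebounded0 : ebounded (fun=> 0).
Proof. by exists 0%R => M; rewrite big1. Qed.

Lemma sum_fine u M : (forall k, 0 <= u k) -> ebounded u ->
  \sum_(m < M) u m = (\sum_(m < M) fine (u m))%R%:E.
Proof.
by move=> u0 bu; rewrite -sumEFin; apply: eq_bigr => m _; rewrite fineK //; exact: ebounded_fin.
Qed.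

Lemma ebounded_fine u : (forall k, 0 <= u k) -> ebounded u ->
  exists C, forall M, (\sum_(m < M) fine (u m) <= C)%R.
Proof. by move=> u0 bu; case: (bu) => C uC; exists C => M; rewrite -lee_fin -sum_fine. Qed.

Lemma conv_fine u v m : (forall k, 0 <= u k) -> (forall k, 0 <= v k) -> ebounded u -> ebounded v ->
  \sum_(k < m.+1) u k * v (m - k)%N = (seq_conv (fine \o u) (fine \o v) m)%:E.
Proof.
move=> u0 v0 bu bv; rewrite /seq_conv -sumEFin; apply: eq_bigr => k _.
by rewrite EFinM /= !fineK //; exact: ebounded_fin.
Qed.

Lemma ebounded_conv u v : (forall k, 0 <= u k) -> (forall k, 0 <= v k) ->
  ebounded u -> ebounded v -> ebounded (fun m => \sum_(k < m.+1) u k * v (m - k)%N).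
Proof.
move=> u0 v0 bu bv; have [C uC] := ebounded_fine u0 bu; have [C' vC] := ebounded_fine v0 bv.
have f0 (f : nat -> \bar R) : (forall k, 0 <= f k) -> forall k, (0 <= (fine \o f) k)%R.
  by move=> h k; exact: fine_ge0.
exists (C * C')%R => M; under eq_bigr do rewrite conv_fine //.
rewrite sumEFin lee_fin; apply: (le_trans (conv_sum_le M (f0 _ u0) (f0 _ v0))).
by apply: ler_pM => //; apply: sumr_ge0 => k _; exact: f0.
Qed.

Lemma ebounded_spl (T : eqType) (F : nat -> seq T -> seq T -> \bar R) s :
  (forall a b, perm_eq (a ++ b) s -> ebounded (fun m => F m a b)) ->
  ebounded (fun m => spl (F m) s).
Proof.
elim: s F => [|x s IH] F h /=; first exact: h.
apply: eboundedD.
- by apply: (IH (fun m a b => F m (x :: a) b)) => a b p; apply: h; rewrite /= perm_cons.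
- apply: (IH (fun m a b => F m a (x :: b))) => a b p; apply: h.
  by rewrite perm_catC /= perm_cons perm_catC.
Qed.

Lemma cvg_spl (T : eqType) (F : nat -> seq T -> seq T -> R) (l : seq T -> seq T -> R) s :
  (forall a b, perm_eq (a ++ b) s -> (fun m => F m a b) @ \oo --> l a b) ->
  (fun m => spl (F m) s) @ \oo --> spl l s.
Proof.
elim: s F l => [|x s IH] F l h /=; first exact: h.
apply: cvgD.
- by apply: (IH (fun m a b => F m (x :: a) b)) => a b p; apply: h; rewrite /= perm_cons.
- apply: (IH (fun m a b => F m a (x :: b)) (fun a b => l a (x :: b))) => a b p; apply: h.
  by rewrite perm_catC /= perm_cons perm_catC.
Qed.

Lemma spl_sum (T : Type) (V : nmodType) (F : nat -> seq T -> seq T -> V) M s :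
  (\sum_(m < M) spl (F m) s = spl (fun a b => \sum_(m < M) F m a b) s)%R.
Proof.
elim: s F => [|x s IH] F //=.
by rewrite big_split /= (IH (fun m a b => F m (x :: a) b)) (IH (fun m a b => F m a (x :: b))).
Qed.

Lemma ler_norm_spl (T : Type) (H : seq T -> seq T -> R) s :
  (`|spl H s| <= spl (fun a b => `|H a b|) s)%R.
Proof.
elim: s H => [|x s IH] H //=; apply: (le_trans (ler_normD _ _)); apply: lerD; exact: IH.
Qed.
End EBounded.

Lemma bounded_sum_cvg0 (R : realType) (u : nat -> R) C : (forall k, 0 <= u k) ->
  (forall M, \sum_(k < M) u k <= C) -> u @ \oo --> 0.
Proof.
move=> u0 uC; apply: cvg_series_cvg_0.
rewrite (_ : series u = fun M => \sum_(k < M) u k); first exact: nneg_bounded_cvg uC.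
by apply/funext => M; rewrite /series /= big_mkord.
Qed.

Section TruncatedExpansion.
Context {d : measure_display} {X : measurableType d} {R : realType}.
Variable nu : {sigma_finite_measure set X -> \bar R}.
Variable w : X -> X -> R.
Hypothesis w_sym : forall x y, w x y = w y x.
Hypothesis w01 : forall x y, (0 <= w x y <= 1)%R.
Hypothesis mw : measurable_fun setT (uncurry w).
Variable N0 : set X.
Variable Rt : seq X -> R.
Local Open Scope ereal_scope.

Definition Ar m xs : R := fine (Aint nu w m xs).

Hypothesis A_bounded : forall xs, avoids N0 xs -> ebounded (fun m => Aint nu w m xs).
Hypothesis A_cvg : forall xs, avoids N0 xs ->
  (fun M => (\sum_(m < M) (-1) ^+ m * Ar m xs)%R) @ \oo --> Rt xs.

Let ga0 := ga_ge0 w01.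

(** For [w = - f], the integral of the absolute Ursell function of [x], [s] and [m] further points,
    divided by [m!]. In contrast to [Aint m (x :: s)], the points of [s] must themselves be
    connected to [x]. *)
Definition Tint m (xs : seq X) : \bar R :=
  if xs is x :: s then J nu m (fun ys => (ga w [:: x] (s ++ ys))%:E) else 0.
Definition Tr m xs : R := fine (Tint m xs).

Lemma Tint_ge0 m xs : 0 <= Tint m xs.
Proof. by case: xs => [|x s] //=; apply: J_ge0 => ys; rewrite lee_fin. Qed.

(** The summand of [ga_cons_spl] up to sign: [a] joins the component of [x], while [b] stays as
    roots. Its integral is the Cauchy product [TA]. *)
Let Kspl x a b (ys : seq X) : R := spl (fun c e => ga w [:: x] (a ++ c) * ga w b e)%R ys.
Let TA x m a b : \bar R := \sum_(k < m.+1) Tint k (x :: a) * Aint nu w (m - k) b.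

Let Kspl0 x a b ys : (0 <= Kspl x a b ys)%R.
Proof. by apply: spl_ge0 => c e _; rewrite mulr_ge0. Qed.

Lemma lmf_ga1 x a : lmf (fun ys => ga w [:: x] (a ++ ys)).
Proof. by apply: (lmf_catl (G := ga w [:: x])); exact/lmf2_lmf1/lmf2_ga. Qed.

Lemma lmf_ga2 b : lmf (ga w b).
Proof. exact/lmf2_lmf1/lmf2_ga. Qed.

Let mK x a b : lmf (Kspl x a b).
Proof.
apply: lmf2_spl => d' T us vs mus mvs; apply: measurable_funM; first exact: lmf_ga1.
exact: lmf_ga2.
Qed.

Lemma J_Kspl x m a b : J nu m (fun ys => (Kspl x a b ys)%:E) = TA x m a b.
Proof.
rewrite (@eq_J _ _ _ nu m _ (spl (fun c e => (ga w [:: x] (a ++ c))%:E * (ga w b e)%:E))); last first.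
  by move=> ys _; rewrite /Kspl spl_EFin.
rewrite J_spl.
- apply: eq_bigr => k _.
  rewrite (@eq_J _ _ _ nu k _ (fun c => Aint nu w (m - k) b * (ga w [:: x] (a ++ c))%:E)).
    rewrite JZl.
    + by rewrite muleC.
    + exact/lmf_EFin/lmf_ga1.
    + by move=> s; rewrite lee_fin.
    + by apply: J_ge0 => s; rewrite lee_fin.
  move=> c _; rewrite JZl; first by rewrite muleC.
  + exact/lmf_EFin/lmf_ga2.
  + by move=> s; rewrite lee_fin.
  + by rewrite lee_fin.
- apply: lmf2M; first exact/lmf2_fst/lmf_EFin/lmf_ga1.
  exact/lmf2_snd/lmf_EFin/lmf_ga2.
- by move=> c e; apply: mule_ge0; rewrite lee_fin.
Qed.

Lemma ga_Kspl x s t : ga w (x :: s) t = spl (fun a b => (-1) ^+ size a * Kspl x a b t)%R s.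
Proof. exact: ga_cons_spl. Qed.

Lemma Kspl_nil x s t : Kspl x s [::] t = ga w [:: x] (s ++ t).
Proof.
rewrite /Kspl spl_nil2 => [|c y e]; last by rewrite ga_nil mulr0.
by rewrite ga_nil eqxx mulr1.
Qed.

Lemma ga_le_Kspl x s t : (ga w [:: x] (s ++ t) <= ga w (x :: s) t +
  spl (fun a b => if b is _ :: _ then Kspl x a b t else 0) s)%R.
Proof.
rewrite [in leRHS]ga_Kspl spl_split_last -Kspl_nil.
set S1 := spl _ s; set S2 := spl _ s.
have S12 : (`|S1| <= S2)%R.
  apply: (le_trans (ler_norm_spl _ _)); rewrite le_eqVlt; apply/orP; left; apply/eqP.
  apply: eq_spl => c [|y e]; rewrite ?normr0 //.
  by rewrite normrM normrX normrN1 expr1n mul1r ger0_norm.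
(* the left-hand side is the absolute value of one of the two terms, whose sum is ga >= 0 *)
have g0 := ga0 (x :: s) t; rewrite ga_Kspl spl_split_last -/S1 in g0.
have := Kspl0 x s [::] t; move: S12 g0; rewrite ler_norml => /andP[].
by rewrite -signr_odd; case: odd => /=; rewrite ?expr1 ?expr0; lra.
Qed.

Lemma lmf_spl_fun (K : seq X -> seq X -> seq X -> R) s :
  (forall a b, lmf (K a b)) -> lmf (fun ys => spl (fun a b => K a b ys) s).
Proof.
elim: s K => [|x s IH] K hK; first exact: hK.
move=> d' T us mus; apply: measurable_funD; first exact: (IH (fun a b => K (x :: a) b)).
exact: (IH (fun a b => K a (x :: b))).
Qed.

Lemma J_spl_coef x m s (q : seq X -> seq X -> R) : (forall a b, 0 <= q a b)%R ->
  J nu m (fun ys => (spl (fun a b => q a b * Kspl x a b ys)%R s)%:E) =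
  spl (fun a b => (q a b)%:E * TA x m a b) s.
Proof.
move=> q0; rewrite (@eq_J _ _ _ nu m _ (fun ys => spl (fun a b => (q a b)%:E * (Kspl x a b ys)%:E) s)); last first.
  by move=> ys _; rewrite spl_EFin.
rewrite (J_spl_fin nu m (K := fun a b ys => (q a b)%:E * (Kspl x a b ys)%:E)).
- apply: eq_spl => a b; rewrite JZl;
    [by rewrite J_Kspl|exact/lmf_EFin/mK|by move=> ys; rewrite lee_fin|by rewrite lee_fin].
- by move=> a b; apply: lmfM; [exact: lmf_cst|exact/lmf_EFin/mK].
- by move=> a b ys; apply: mule_ge0; rewrite lee_fin.
Qed.

Lemma Tint_le m x s : Tint m (x :: s) <= Aint nu w m (x :: s) +
  spl (fun a b => (b != [::])%:R%:E * TA x m a b) s.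
Proof.
have q0 (a b : seq X) : (0 <= (b != [::])%:R :> R)%R by rewrite ler0n.
have mS : lmf (fun ys => (spl (fun a b => (b != [::])%:R * Kspl x a b ys)%R s)%:E).
  apply: lmf_EFin; apply: lmf_spl_fun => a b d' T us mus; apply: measurable_funM => //.
  exact: mK.
have S0 ys : 0 <= (spl (fun a b => (b != [::])%:R * Kspl x a b ys)%R s)%:E.
  by rewrite lee_fin; apply: spl_ge0 => a b _; rewrite mulr_ge0.
have mg : lmf (fun ys => (ga w (x :: s) ys)%:E) by exact/lmf_EFin/lmf_ga2.
rewrite -J_spl_coef // -JD //; last by move=> ys; rewrite lee_fin.
apply: le_J.
- exact/lmf_EFin/lmf_ga1.
- exact: lmfD.
- by move=> ys; rewrite lee_fin.
- by move=> ys; apply: adde_ge0 => //; rewrite lee_fin.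
move=> ys _; rewrite -EFinD lee_fin; apply: (le_trans (ga_le_Kspl x s ys)).
rewrite lerD2l le_eqVlt; apply/orP; left; apply/eqP; apply: eq_spl => a [|y b] /=.
  by rewrite mul0r.
by rewrite mul1r.
Qed.

(** Induction on the length of [s]: in [Tint_le] the terms with [b] nonempty are Cauchy products of
    [Tint] on a shorter list with [Aint], both summable. *)
Lemma Tint_bounded x s : avoids N0 (x :: s) -> ebounded (fun m => Tint m (x :: s)).
Proof.
move: (ltnSn (size s)); move: {2}(size s).+1 => n; elim: n s => [//|n IH] s le gs.
apply: (ebounded_le (fun m => Tint_le m x s)); apply: eboundedD; first exact: A_bounded.
apply: ebounded_spl => a b p; case: b p => [|y b] p.
  by apply: (@ebounded_le _ _ (fun=> 0)); [move=> m; rewrite mul0e|exact: ebounded0].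
apply: (@ebounded_le _ _ (fun m => TA x m a (y :: b))); first by move=> m; rewrite mul1e.
have [gxa gb] : avoids N0 (x :: a) /\ avoids N0 (y :: b).
  have/avoids_cat[]// : avoids N0 ((x :: a) ++ y :: b).
  by move=> u; rewrite /= inE (perm_mem p) -in_cons; exact: gs.
apply: (ebounded_conv (u := Tint ^~ (x :: a)) (v := (Aint nu w) ^~ (y :: b))).
- by move=> k; exact: Tint_ge0.
- by move=> k; apply: J_ge0 => ys; rewrite lee_fin.
- by apply: IH => //; move/perm_size: p; rewrite size_cat /=; move: le; lia.
- exact: A_bounded.
Qed.

(** The integrated form of [ga_cons_spl]. Its signs are first separated by the parity of [size a],
    recorded in [q], to give an identity of nonnegative extended reals; finiteness then permits the
    subtraction. *)
Lemma Ar_cons m x s : avoids N0 (x :: s) -> Ar m (x :: s) =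
  spl (fun a b => (-1) ^+ size a * seq_conv (Tr ^~ (x :: a)) (Ar ^~ b) m)%R s.
Proof.
move=> gs; pose q c (a b : seq X) : R := (odd (size a) == c)%:R.
have q0 c a b : (0 <= q c a b)%R by rewrite ler0n.
have A0 k b : 0 <= Aint nu w k b by apply: J_ge0 => ys; rewrite lee_fin.
have mS c : lmf (fun ys => (spl (fun a b => q c a b * Kspl x a b ys)%R s)%:E).
  apply: lmf_EFin; apply: lmf_spl_fun => a b d' T us mus; apply: measurable_funM => //.
  exact: mK.
have S0 c ys : 0 <= (spl (fun a b => q c a b * Kspl x a b ys)%R s)%:E.
  by rewrite lee_fin; apply: spl_ge0 => a b _; rewrite mulr_ge0.
have mg : lmf (fun ys => (ga w (x :: s) ys)%:E) by exact/lmf_EFin/lmf_ga2.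
have eqE : Aint nu w m (x :: s) + spl (fun a b => (q true a b)%:E * TA x m a b) s =
    spl (fun a b => (q false a b)%:E * TA x m a b) s.
  rewrite -!J_spl_coef // -JD //; last by move=> ys; rewrite lee_fin.
  apply: eq_J => ys _; rewrite -EFinD ga_Kspl -splD; congr (_%:E); apply: eq_spl => a b.
  by rewrite /q -signr_odd; case: odd => /=; rewrite ?expr1 ?expr0; lra.
have fTA a b : perm_eq (a ++ b) s ->
    TA x m a b = (seq_conv (Tr ^~ (x :: a)) (Ar ^~ b) m)%:E.
  move=> p; have [gxa gb] : avoids N0 (x :: a) /\ avoids N0 b.
    have/avoids_cat[]// : avoids N0 ((x :: a) ++ b).
    by move=> u; rewrite /= inE (perm_mem p) -in_cons; exact: gs.
  rewrite /TA (conv_fine m (u := Tint ^~ (x :: a)) (v := (Aint nu w) ^~ b)) //.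
  - by move=> k; exact: Tint_ge0.
  - exact: Tint_bounded.
  - exact: A_bounded.
have fS c : spl (fun a b => (q c a b)%:E * TA x m a b) s =
    (spl (fun a b => q c a b * seq_conv (Tr ^~ (x :: a)) (Ar ^~ b) m)%R s)%:E.
  by rewrite spl_EFin; apply: eq_in_spl => a b p; rewrite fTA.
move: eqE; rewrite !fS -[Aint _ _ _ _]fineK; last first.
  by apply: (ebounded_fin m (fun k => A0 k (x :: s))); exact: A_bounded.
rewrite -EFinD => -[] /(canRL (addrK _)); rewrite -/(Ar m (x :: s)) => ->.
rewrite -[X in (_ + X)%R]mulN1r spl_mull -splD; apply: eq_spl => a b.
by rewrite /q -[in RHS]signr_odd; case: odd => /=; rewrite ?expr1 ?expr0; ring.
Qed.

(** The sum of the whole Ursell series, its term without integration included. An Ursell function of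
    [j + 1] points has sign [(-1)^j]: the points of [xs] beyond the first give the factor in front,
    the [m] integrated ones the alternating sign. *)
Definition Ulim (xs : seq X) : R :=
  ((-1) ^+ (size xs).-1 * limn (fun M => \sum_(m < M) (-1) ^+ m * Tr m xs))%R.

Lemma Tr_abs_bounded x s : avoids N0 (x :: s) ->
  abs_bounded (fun m => (-1) ^+ m * Tr m (x :: s))%R.
Proof.
move=> gs; have [C hC] := ebounded_fine (fun m => Tint_ge0 m (x :: s)) (Tint_bounded gs).
exists C => M; apply: le_trans (hC M); apply: ler_sum => m _.
by rewrite normrM normrX normrN1 expr1n mul1r ger0_norm // fine_ge0 // Tint_ge0.
Qed.

Lemma Ar_abs_bounded s : avoids N0 s -> abs_bounded (fun m => (-1) ^+ m * Ar m s)%R.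
Proof.
have A0 m : 0 <= Aint nu w m s by apply: J_ge0 => ys; rewrite lee_fin.
move=> gs; have [C hC] := ebounded_fine A0 (A_bounded gs).
exists C => M; apply: le_trans (hC M); apply: ler_sum => m _.
by rewrite normrM normrX normrN1 expr1n mul1r ger0_norm // fine_ge0.
Qed.

Lemma Tr_cvg x s : avoids N0 (x :: s) ->
  (fun M => (\sum_(m < M) (-1) ^+ m * Tr m (x :: s))%R) @ \oo -->
  ((-1) ^+ size s * Ulim (x :: s))%R.
Proof.
move=> gs; rewrite /Ulim /= mulrA -exprMn mulrNN mulr1 expr1n mul1r.
exact: abs_bounded_cvg (Tr_abs_bounded gs).
Qed.

(** The signed sum of [Ar_cons] passes to the limit by [cauchy_product], and the factor
    [(-1) ^+ size a] is absorbed by the one in [Ulim]. The result has the form of the recursion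
    assumed for [Psum_rh]. *)
Lemma Rt_Ulim x s : avoids N0 (x :: s) ->
  Rt (x :: s) = spl (fun a b => Ulim (x :: a) * Rt b)%R s.
Proof.
move=> gs; apply: (cvg_unique _ (A_cvg gs)) => //.
rewrite (_ : (fun M => _) = (fun M => spl (fun a b => (-1) ^+ size a * \sum_(m < M)
   seq_conv (fun k => (-1) ^+ k * Tr k (x :: a)) (fun k => (-1) ^+ k * Ar k b) m)%R s)); last first.
  apply/funext => M; transitivity (\sum_(m < M) spl (fun a b => (-1) ^+ size a *
     seq_conv (fun k => (-1) ^+ k * Tr k (x :: a)) (fun k => (-1) ^+ k * Ar k b) m) s)%R.
    apply: eq_bigr => m _; rewrite Ar_cons // spl_mull; apply: eq_spl => a b.
    rewrite mulrCA; congr (_ * _)%R; rewrite /seq_conv mulr_sumr; apply: eq_bigr => k _.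
    by rewrite mulrACA -exprD subnKC // -ltnS.
  rewrite (spl_sum (fun m a b => (-1) ^+ size a *
     seq_conv (fun k => (-1) ^+ k * Tr k (x :: a)) (fun k => (-1) ^+ k * Ar k b) m)%R).
  by apply: eq_spl => a b; rewrite mulr_sumr.
apply: cvg_spl => a b p.
have [gxa gb] : avoids N0 (x :: a) /\ avoids N0 b.
  have/avoids_cat[]// : avoids N0 ((x :: a) ++ b).
  by move=> u; rewrite /= inE (perm_mem p) -in_cons; exact: gs.
rewrite (_ : (Ulim (x :: a) * Rt b)%R =
   ((-1) ^+ size a * (((-1) ^+ size a * Ulim (x :: a)) * Rt b))%R); last first.
  by rewrite !mulrA -exprMn mulrNN mulr1 expr1n mul1r.
apply: cvgMr; apply: cauchy_product; [exact: Tr_abs_bounded|exact: Ar_abs_bounded|exact: Tr_cvg|].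
exact: A_cvg.
Qed.
End TruncatedExpansion.

(** * Convergence of alternating sums, Ursell functions *)

Section AlternatingLimit.
Context {d : measure_display} {X : measurableType d} {R : realType}.
Variable nu : {sigma_finite_measure set X -> \bar R}.
Variable w : X -> X -> R.
Hypothesis w01 : forall x y, (0 <= w x y <= 1)%R.
Variables (t C : R) (xs : seq X).
Hypothesis t0 : 0 < t.
Local Open Scope ereal_scope.
Hypothesis VC : forall M, Vsum nu w (fun m => expR (t * m%:R)) M xs <= C%:E.

Let A0 m : 0 <= Aint nu w m xs.
Proof. by apply: J_ge0 => ys; rewrite lee_fin ga_ge0. Qed.

Lemma Aint_ebounded : ebounded (fun m => Aint nu w m xs).
Proof.
exists C => -[|M]; first by rewrite big_ord0; apply: le_trans (VC 0); exact: Vsum_ge0.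
apply: le_trans (VC M); apply: lee_sum => m _.
rewrite -[leLHS]mul1e lee_wpmul2r // lee_fin -expR0 ler_expR.
by rewrite mulr_ge0 ?ler0n // ltW.
Qed.

Variable r : R.
Hypothesis bon : forall M,
  Vsum nu w (fun m => par true (M + m)) M xs + (par false M * r)%:E <=
  Vsum nu w (fun m => par false (M + m)) M xs + (par true M * r)%:E.

Lemma parB n : (par false n - par true n = (-1) ^+ n :> R)%R.
Proof. by rewrite /par -[in RHS]signr_odd; case: odd; rewrite ?expr1 ?expr0 ?sub0r ?subr0. Qed.

Lemma Vsum_Ar c M : Vsum nu w c M xs = (\sum_(m < M.+1) c m * Ar nu w m xs)%R%:E.
Proof.
rewrite /Vsum -sumEFin; apply: eq_bigr => m _; rewrite EFinM /Ar fineK //.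
by apply: (ebounded_fin m A0); exact: Aint_ebounded.
Qed.

Lemma alternating_sum_sign M :
  (0 <= (-1) ^+ M * (\sum_(m < M.+1) (-1) ^+ m * Ar nu w m xs - r))%R.
Proof.
have := bon M; rewrite !Vsum_Ar -!EFinD lee_fin -subr_ge0 => h; apply: le_trans h _.
rewrite le_eqVlt; apply/orP; left; apply/eqP.
rewrite mulrBr mulr_sumr.
under [in RHS]eq_bigr do rewrite mulrA -exprD -parB mulrBl.
by rewrite sumrB -parB; ring.
Qed.

(** Consecutive partial sums lie on opposite sides of [r], so each is within the next term of it;
    the terms tend to 0 because their sums are bounded. *)
Lemma Aint_cvg : (fun M => (\sum_(m < M) (-1) ^+ m * Ar nu w m xs)%R) @ \oo --> r.
Proof.
have [D hD] := ebounded_fine A0 Aint_ebounded.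
have Ar0 m : (0 <= Ar nu w m xs)%R by exact: fine_ge0.
have c0 := bounded_sum_cvg0 Ar0 hD.
apply/cvgrPdist_lt => e e0; move/cvgr0Pnorm_lt: c0 => /(_ _ e0) [N _ hN].
exists N.+1 => // -[//|M] /= NM.
set S := (\sum_(m < _) _)%R; pose del := ((-1) ^+ M * (S - r))%R.
have d0 : (0 <= del)%R by exact: alternating_sum_sign.
have dA : (del <= Ar nu w M.+1 xs)%R.
  have := alternating_sum_sign M.+1; rewrite big_ord_recr /= -/S addrAC mulrDr mulrA -exprMn.
  by rewrite mulrNN mulr1 expr1n mul1r exprS mulN1r mulNr -/del addrC subr_ge0.
rewrite distrC; have -> : (`|S - r| = del)%R.
  by rewrite -(ger0_norm d0) normrM normrX normrN1 expr1n mul1r.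
apply: (le_lt_trans dA); have := hN M.+1; rewrite /= ger0_norm //; apply.
exact: ltnW NM.
Qed.
End AlternatingLimit.

(** * Negative exponentials, and Ursell functions as one-root graph sums *)

Section NegExp.
Context {R : realType}.
Implicit Types x y : \bar R.

Definition nexp x : R := fine (expeR (- x)%E).

Lemma nexpE x : (0 <= x)%E -> expeR (- x)%E = (nexp x)%:E.
Proof. by rewrite /nexp; case: x => [r| |]. Qed.

Lemma nexp01 x : (0 <= x)%E -> 0 <= nexp x <= 1.
Proof.
rewrite /nexp; case: x => [r| |] //=; rewrite ?lexx ?ler01 // lee_fin => r0.
by rewrite expR_ge0 -expR0 ler_expR oppr_le0.
Qed.

Lemma nexpD x y : (0 <= x)%E -> (0 <= y)%E -> nexp (x + y)%E = nexp x * nexp y.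
Proof.
rewrite /nexp; case: x => [r| |] //; case: y => [r'| |] //= _ _; rewrite ?mulr0 ?mul0r //.
by rewrite opprD expRD.
Qed.

Lemma nexp0 : nexp 0%E = 1.
Proof. by rewrite /nexp oppe0 expeR0. Qed.

Lemma measurable_nexp : measurable_fun setT nexp.
Proof.
have -> : nexp = fun x => if x == +oo%E then 0 else if x == -oo%E then 0 else expR (- fine x).
  by apply/funext => -[r| |].
have mc (c : \bar R) : measurable_fun setT (fun x : \bar R => x == c).
  by apply: measurable_fun_eqe; [exact: measurable_id|exact: measurable_cst].
apply: measurable_fun_ifT => //; apply: measurable_fun_ifT => //.
by apply: measurableT_comp => //; apply: measurableT_comp => //; exact: fine_measurable.
Qed.
End NegExp.

Section UrsellGs.
Context {d : measure_display} {X : measurableType d} {R : realType}.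
Variable v : X -> X -> \bar R.
Hypothesis v0 : forall x y, (0 <= v x y)%E.
Hypothesis v_sym : forall x y, v x y = v y x.

Definition wpot x y : R := - fpot v x y.

Lemma wpot01 x y : 0 <= wpot x y <= 1.
Proof.
rewrite /wpot /fpot opprB; have := v0 x y; case: (v x y) => [r| |] //=.
  rewrite lee_fin => r0; rewrite subr_ge0 gerBl ?expR_ge0 // andbT.
  by rewrite -expR0 ler_expR oppr_le0.
by rewrite subr0 ler01 lexx.
Qed.

Lemma wpot_sym x y : wpot x y = wpot y x.
Proof. by rewrite /wpot /fpot v_sym. Qed.

(** A graph is connected when all its vertices are connected to the root [x], so [Csum_gs] on the
    full index set applies. *)
Lemma ursellE x s : ursell v (x :: s) = (-1) ^+ size s * ga wpot [:: x] s.
Proof.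
set xs := x :: s; pose u (i : 'I_(size xs)) := nthX xs i.
have eu : map u (enum 'I_(size xs)) = xs.
  rewrite -[RHS](mkseq_nth point) /mkseq -val_enum_ord -map_comp.
  by apply: eq_map => i.
have -> : ursell v xs = Csum (fun e => - wpot (u e.1) (u e.2)) [set: 'I_(size xs)]%SET.
  rewrite /ursell /Csum; apply: eq_big => [E|E _]; last by apply: eq_bigr => e _; rewrite opprK.
  rewrite /conn_graph /connected_on; congr (_ && _).
    apply/forall_inP/fintype.subsetP => h e eE; first by rewrite in_pairs !inE h.
    by have := h e eE; rewrite in_pairs => /and3P[].
  apply: eq_forallb => i; rewrite inE; apply: eq_forallb => j; rewrite inE.
  by [].
case e : (enum [set: 'I_(size xs)]%SET) => [|i l].
  have : (ord0 : 'I_(size xs)) \in enum [set: 'I_(size xs)]%SET by rewrite mem_enum inE.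
  by rewrite e.
rewrite (Csum_gs wpot_sym u e) /gs.
have : map u (i :: l) = xs.
  by rewrite -e -[RHS]eu; congr map; apply: eq_enum => j; rewrite !inE.
by rewrite /xs => -[-> ->].
Qed.

Lemma measurable_wpot : measurable_fun setT (uncurry v) -> measurable_fun setT (uncurry wpot).
Proof.
move=> mv; rewrite (_ : uncurry _ = fun p => 1 - nexp (uncurry v p)); last first.
  by apply/funext => -[x y] /=; rewrite /wpot /fpot opprB.
apply: measurable_funB; first exact: measurable_cst.
exact: measurableT_comp measurable_nexp mv.
Qed.
End UrsellGs.

(** * Locally finite configurations *)

Import HBNNSimple.

Section Configurations.
Context {d : measure_display} {X : measurableType d} {R : realType}.
Variable dist : X -> X -> R.
Hypothesis Hmetric : is_metric dist.
Hypothesis Hborel : @measurable d X = <<s dopen dist >>.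
Local Open Scope ereal_scope.

Lemma dist_ge0 x y : (0 <= dist x y)%R. Proof. by case: Hmetric. Qed.
Lemma distxx x : dist x x = 0%R. Proof. by case: Hmetric => _ h _ _; apply/h. Qed.
Lemma dist_eq0 x y : dist x y = 0%R -> x = y. Proof. by case: Hmetric => _ h _ _ /h. Qed.
Lemma distC x y : dist x y = dist y x. Proof. by case: Hmetric. Qed.
Lemma dist_triangle x y z : (dist x z <= dist x y + dist y z)%R. Proof. by case: Hmetric. Qed.

Definition dball (x : X) (r : R) : set X := [set y | (dist x y < r)%R].

Lemma measurable_dball x r : measurable (dball x r).
Proof.
rewrite Hborel; apply: sub_sigma_algebra => y /= yr; exists (r - dist x y)%R.
  by rewrite subr_gt0.
move=> u; rewrite /dball /= => yu; apply: (le_lt_trans (dist_triangle x y u)).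
by rewrite -ltrBrDl.
Qed.

(** Balls around the default point: bounded, hence of finite mass for every configuration, and
    exhausting [X]. They serve for all cut-offs. *)
Definition oball (n : nat) : set X := dball point n%:R.

Lemma measurable_oball n : measurable (oball n). Proof. exact: measurable_dball. Qed.

Lemma dbounded_oball n A : dbounded dist (A `&` oball n).
Proof. by exists point, n%:R => y [_]; exact: ltW. Qed.

Lemma nd_oball : nondecreasing_seq oball.
Proof.
move=> m n mn; apply/subsetPset => y; rewrite /oball /dball /= => h; apply: (lt_le_trans h).
by rewrite ler_nat.
Qed.

Lemma oball_near y : exists N, forall n, (N <= n)%N -> oball n y.
Proof.
exists (Num.truncn (dist point y)).+1 => n Nn; rewrite /oball /dball /=.
by apply: (lt_le_trans (truncnS_gt _)); rewrite ler_nat.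
Qed.

Lemma bigcup_oball : \bigcup_n oball n = setT.
Proof.
by apply/seteqP; split=> // y _; have [N hN] := oball_near y; exists N => //; exact: hN.
Qed.

Lemma sigma_finite_balls (mu : {measure set X -> \bar R}) :
  (forall n, mu (oball n) < +oo) -> sigma_finite setT mu.
Proof.
by move=> h; exists oball => [|n]; [rewrite bigcup_oball|split; [exact: measurable_oball|exact: h]].
Qed.

Local Notation NX := (NN dist).

Definition mcfg (eta : NX) : {measure set X -> \bar R} := @lfcm_meas d X R dist eta.

Lemma measurable_count_bounded A n : measurable A ->
  measurable_fun setT (fun eta : NX => mcfg eta (A `&` oball n)).
Proof.
move=> mA _ Y mY; rewrite setTI; apply: sub_sigma_algebra.
exists (A `&` oball n), Y; split=> //; last exact: dbounded_oball.
by apply: measurableI => //; exact: measurable_oball.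
Qed.

Lemma cvg_oball (mu : {measure set X -> \bar R}) A : measurable A ->
  (fun n => mu (A `&` oball n)) @ \oo --> mu A.
Proof.
move=> mA; rewrite -[X in _ --> mu X]setIT -bigcup_oball setI_bigcupr.
have mAn n : measurable (A `&` oball n) by apply: measurableI => //; exact: measurable_oball.
apply: (nondecreasing_cvg_mu (F := fun n => A `&` oball n)) => //.
  exact: bigcup_measurable.
by move=> m n mn; apply/subsetPset; apply: setIS; exact/subsetPset/nd_oball.
Qed.

Lemma measurable_count A : measurable A -> measurable_fun setT (fun eta : NX => mcfg eta A).
Proof.
move=> mA; apply: (emeasurable_fun_cvg (fun n (eta : NX) => mcfg eta (A `&` oball n))).
  by move=> n; exact: measurable_count_bounded.
by move=> eta _; exact: cvg_oball.
Qed.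

Section ConfigurationKernel.
Context {d' : measure_display} {T : measurableType d'} (e : T -> NX).
Hypothesis me : measurable_fun setT e.

Definition cker of measurable_fun setT e := fun t : T => mcfg (e t).

Lemma cker_measurable U : measurable U -> measurable_fun setT ((cker me) ^~ U).
Proof. by move=> mU; exact: measurableT_comp (measurable_count mU) me. Qed.

HB.instance Definition _ := isKernel.Build _ _ _ _ R (cker me) cker_measurable.

(** The kernel of configurations may have infinite mass, but it is finite on each ball;
    measurability on balls passes to the limit by continuity from below. *)
Lemma measurable_cker_xsection (A : set (T * X)) : measurable A ->
  measurable_fun setT (fun t => mcfg (e t) (xsection A t)).
Proof.
move=> mA; apply: (emeasurable_fun_cvg (fun n t => mcfg (e t) (xsection A t `&` oball n))).
  move=> n; have [] // := @measurable_prod_subset_xsection_kernel _ _ T X R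
    (cker me : R.-ker T ~> X) (oball n) (measurable_oball n) _ A mA.
  (* The bound may depend on [t]; the added 1 makes it strict. *)
  move=> t; exists (fine (mcfg (e t) (oball n)) + 1)%R => B mB.
  have fin : mcfg (e t) (oball n) < +oo.
    apply: (@lfcm_lf d X R dist (e t)); first exact: measurable_oball.
    by exists point, n%:R => y; exact: ltW.
  rewrite EFinD fineK; last by rewrite ge0_fin_numE.
  apply: (@le_lt_trans _ _ (mcfg (e t) (oball n))).
    by apply: le_measure; rewrite ?inE; [apply: measurableI|..]; rewrite ?measurable_oball //; exact: measurable_oball.
  by rewrite lteDl // ?lte_fin // ge0_fin_numE.
by move=> t _; apply: cvg_oball; exact: measurable_xsection.
Qed.

Lemma measurable_integral_cfg (k : T * X -> \bar R) : (forall p, 0 <= k p) ->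
  measurable_fun setT k -> measurable_fun setT (fun t => \int[mcfg (e t)]_y k (t, y)).
Proof.
move=> k0 mk; pose k_ := nnsfun_approx measurableT mk.
apply: (@measurable_fun_xsection_integral _ _ T X R k (cker me) k_).
- by move=> a b ab; exact/nd_nnsfun_approx.
- by move=> z; exact/cvg_nnsfun_approx.
- move=> n r; apply: measurable_cker_xsection.
  by apply: measurable_funPTI; exact: measurable_set1.
Qed.
End ConfigurationKernel.
End Configurations.

(** * Newton's identities and points of counting measures *)

Section Newton.
Context {R : realType}.
Implicit Types p : nat -> R.

(* [Snewton p k] is the k-th elementary symmetric function expressed by Newton's
   identities through the power sums [p 1, p 2, ...]; [p 0] plays no role. *)
Fixpoint Slist p n : seq R :=
  if n is n'.+1 then
    (n'.+1%:R^-1 * \sum_(i < n'.+1) (-1) ^+ i * (Slist p n')`_i * p i.+1) :: Slist p n'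
  else [:: 1].
Definition Snewton p n : R := (Slist p n)`_0.

Lemma nth_Slist p n i : (i <= n)%N -> (Slist p n)`_i = Snewton p (n - i).
Proof. by elim: n i => [|n IH] [|i] //= le; rewrite IH. Qed.

Lemma Snewton0 p : Snewton p 0 = 1. Proof. by []. Qed.

Lemma SnewtonS p n : n.+1%:R * Snewton p n.+1 = \sum_(i < n.+1) (-1) ^+ i * Snewton p (n - i) * p i.+1.
Proof.
rewrite {1}/Snewton /= mulVKf ?pnatr_eq0 //; apply: eq_bigr => i _.
by rewrite nth_Slist // -ltnS.
Qed.

Lemma eq_Snewton p p' n : (forall i, (0 < i)%N -> p i = p' i) -> Snewton p n = Snewton p' n.
Proof.
move=> e; rewrite /Snewton; congr (_`_0); elim: n => [//|n IH] /=; rewrite IH.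
by congr (_ * _ :: _); apply: eq_bigr => i _; rewrite e.
Qed.

Definition Sprev p k : R := if k is k'.+1 then Snewton p k' else 0.

(* Formal division of the generating polynomial by [1 + h X]. *)
Lemma alternating_division p (h : R) k (S : nat -> R) :
  (forall j, (j <= k)%N -> S j = Snewton p j + h * Sprev p j) ->
  \sum_(i < k.+1) (- h) ^+ i * S (k - i)%N = Snewton p k.
Proof.
elim: k => [|k IH] hS; first by rewrite big_ord1 expr0 mul1r hS // mulr0 addr0.
rewrite big_ord_recl expr0 mul1r subn0 hS //= .
under eq_bigr => i _ do rewrite /bump /= add1n subSS exprS -mulrA.
rewrite -mulr_sumr IH; last by move=> j jk; apply: hS; exact: leqW.
by ring.
Qed.

(** One more number [h] multiplies the generating polynomial by [1 + h X]. The identity is formal in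
    [p], so it applies to power sums given as integrals against a configuration. *)
Lemma Snewton_add p h n :
  Snewton (fun i => p i + h ^+ i) n = Snewton p n + h * Sprev p n.
Proof.
set p' := fun i => _; elim: n {-2}n (leqnn n) => [|m IH] [|n] //= nm; rewrite ?mulr0 ?addr0 //.
have n0 : n.+1%:R != 0 :> R by rewrite pnatr_eq0.
apply: (mulfI n0); rewrite SnewtonS.
have e : \sum_(i < n.+1) (-1) ^+ i * Snewton p' (n - i) * p' i.+1 =
    \sum_(i < n.+1) (-1) ^+ i * Snewton p (n - i) * p i.+1
    + h * \sum_(i < n.+1) (-1) ^+ i * Sprev p (n - i) * p i.+1
    + h * \sum_(i < n.+1) (- h) ^+ i * Snewton p' (n - i).
  rewrite !mulr_sumr -!big_split /=; apply: eq_bigr => i _.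
  rewrite [X in _ = _ + h * (_ * X)]IH; last by rewrite (leq_trans (leq_subr _ _)).
  rewrite IH /p'; last by rewrite (leq_trans (leq_subr _ _)).
  by rewrite exprS [(- h) ^+ i]exprNn; ring.
rewrite e -SnewtonS (alternating_division (p := p)); last first.
  by move=> j jn; apply: IH; apply: leq_trans jn _.
have -> : \sum_(i < n.+1) (-1) ^+ i * Sprev p (n - i) * p i.+1 = n%:R * Snewton p n.
  rewrite big_ord_recr /= subnn mulr0 mul0r addr0.
  case: n {nm n0 e} => [|n]; first by rewrite big_ord0 mul0r.
  rewrite SnewtonS; apply: eq_bigr => i _; rewrite subSn //.
  by rewrite -ltnS.
by rewrite -natr1; ring.
Qed.

Definition psum (s : seq R) i : R := \sum_(h <- s) h ^+ i.
Definition elsym s k : R := Snewton (psum s) k.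

Lemma psum_perm s s' : perm_eq s s' -> psum s = psum s'.
Proof. by move=> e; apply/funext => i; exact: perm_big. Qed.

Lemma elsym_nil k : elsym [::] k = (k == 0%N)%:R.
Proof.
case: k => [|k]; first by [].
have k0 : k.+1%:R != 0 :> R by rewrite pnatr_eq0.
apply: (mulfI k0); rewrite /elsym SnewtonS mulr0 big1 // => i _.
by rewrite /psum big_nil mulr0.
Qed.

Lemma elsym_cons h s k : elsym (h :: s) k = elsym s k + h * Sprev (psum s) k.
Proof.
rewrite /elsym -Snewton_add; apply: eq_Snewton => i _.
by rewrite /psum big_cons addrC.
Qed.

Lemma elsym_ge0 s k : (forall h, h \in s -> 0 <= h) -> 0 <= elsym s k.
Proof.
elim: s k => [|h s IH] k h0; first by rewrite elsym_nil.
have h0' g : g \in s -> 0 <= g by move=> gs; apply: h0; rewrite inE gs orbT.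
rewrite elsym_cons; apply: addr_ge0; first exact: IH.
apply: mulr_ge0; first by apply: h0; exact: mem_head.
by case: k => [|k]; [exact: lexx|exact: (IH k h0')].
Qed.

(** Dividing the generating polynomial by [1 + h X] removes [h] from the list: the sum is an
    elementary symmetric function of the other entries. *)
Lemma division_ge0 s h k : (forall h, h \in s -> 0 <= h) -> h \in s ->
  0 <= \sum_(i < k.+1) (- h) ^+ i * elsym s (k - i).
Proof.
move=> h0 hs; have p := perm_to_rem hs.
have e j : elsym s j = elsym (h :: rem h s) j by rewrite /elsym (psum_perm p).
rewrite (alternating_division (p := psum (rem h s))).
  by apply: elsym_ge0 => g /mem_rem; exact: h0.
by move=> j _; rewrite e elsym_cons.
Qed.

(** Let [r_N(s)] be the partial sum up to [N] minus the product. Then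
    [r_N(h :: s) = r_N(s) - h r_{N-1}(s)], and by induction both terms have the sign [(-1)^N]. *)
Lemma elsym_bonferroni s N : (forall h, h \in s -> 0 <= h <= 1) ->
  0 <= (-1) ^+ N * (\sum_(k < N.+1) (-1) ^+ k * elsym s k - \prod_(h <- s) (1 - h)).
Proof.
have prod01 (u : seq R) : (forall h, h \in u -> 0 <= h <= 1) -> 0 <= \prod_(h <- u) (1 - h).
  move=> u01; rewrite big_seq; apply: prodr_ge0 => h /u01 /andP[_].
  by rewrite subr_ge0.
elim: s N => [|h s IH] N h01.
  rewrite big_nil big_ord_recl elsym_nil mulr1 expr0 big1 ?addr0 ?subrr ?mulr0 // => i _.
  by rewrite elsym_nil mulr0.
have s01 g : g \in s -> 0 <= g <= 1 by move=> gs; apply: h01; rewrite inE gs orbT.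
have /andP[hge0 h1] := h01 _ (mem_head h s).
have -> : \sum_(k < N.+1) (-1) ^+ k * elsym (h :: s) k - \prod_(g <- h :: s) (1 - g) =
    (\sum_(k < N.+1) (-1) ^+ k * elsym s k - \prod_(g <- s) (1 - g))
    - h * (\sum_(k < N) (-1) ^+ k * elsym s k - \prod_(g <- s) (1 - g)).
  have -> : \sum_(k < N.+1) (-1) ^+ k * elsym (h :: s) k =
      \sum_(k < N.+1) (-1) ^+ k * elsym s k - h * \sum_(k < N) (-1) ^+ k * elsym s k.
    have -> : \sum_(k < N) (-1) ^+ k * elsym s k =
        - \sum_(k < N.+1) (-1) ^+ k * Sprev (psum s) k.
      rewrite big_ord_recl /= mulr0 add0r -sumrN; apply: eq_bigr => k _.
      by rewrite /bump /= add1n exprS mulN1r mulNr opprK.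
    rewrite mulrN opprK mulr_sumr -big_split /=; apply: eq_bigr => k _.
    by rewrite elsym_cons mulrDr mulrCA.
  by rewrite big_cons; ring.
rewrite mulrBr addr_ge0 ?IH //.
case: N => [|N]; first by rewrite big_ord0 expr0 sub0r mul1r mulrN opprK mulr_ge0 // prod01.
rewrite exprS mulN1r mulNr opprK mulrCA mulr_ge0 // IH //.
Qed.
End Newton.

(** * Finite counting measures as sums of point masses *)

Section PointMeasures.
Context {d : measure_display} {X : measurableType d} {R : realType}.
Local Open Scope ereal_scope.

Fixpoint mpts (s : seq X) : {measure set X -> \bar R} :=
  if s is x :: s' then measure_add (@dirac _ X x R) (mpts s') else @mzero _ X R.

Lemma integral_mpts s (f : X -> \bar R) : (forall x, 0 <= f x) -> measurable_fun setT f ->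
  \int[mpts s]_x f x = \sum_(x <- s) f x.
Proof.
move=> f0 mf; elim: s => [|x s IH] /=; first by rewrite integral_measure_zero big_nil.
by rewrite ge0_integral_measure_add // IH big_cons integral_dirac // diracT mul1e.
Qed.

Lemma mpts_cons x s A : mpts (x :: s) A = (\1_A x)%:E + mpts s A.
Proof. exact: (measure_addE (@dirac _ X x R) (mpts s) A). Qed.

Variable dist : X -> X -> R.
Hypothesis Hmetric : is_metric dist.
Hypothesis Hborel : @measurable d X = <<s dopen dist >>.
Hypothesis Hsep : dseparable dist.

Lemma dense_seq : exists q : nat -> X, forall x e, (0 < e)%R -> exists n, (dist x (q n) < e)%R.
Proof.
have [D [/countable_injP[g ginj] hD]] := Hsep.
(* The injection [g] codes the points of the dense set by naturals; numbers that code no point are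
   sent to [point]. *)
exists (fun n => xget point [set y | D y /\ g y = n]) => x e e0.
have [y Dy xy] := hD x e e0; exists (g y).
case: xgetP => [z _ [Dz gz]|/(_ y)]; last by case; split.
by rewrite (ginj z y) // ?inE.
Qed.

Lemma measurable_point (x : X) : measurable [set x].
Proof.
rewrite (_ : [set x] = \bigcap_n dball dist x (n.+1%:R^-1)).
  by apply: bigcap_measurable => // n _; exact: measurable_dball.
apply/seteqP; split=> [y -> n _|y h].
  by rewrite /dball /= distxx // invr_gt0 ltr0n.
suff -> : y = x by [].
apply: (dist_eq0 Hmetric); rewrite distC //; apply/eqP; rewrite eq_le dist_ge0 // andbT.
apply/ler_addgt0Pr => e e0; rewrite add0r.
have [n hn] : exists n, (n.+1%:R^-1 < e)%R.
  exists (Num.truncn e^-1); rewrite invf_plt ?posrE ?ltr0n //; exact: truncnS_gt.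
by apply: ltW; apply: lt_trans hn; exact: h.
Qed.

Definition natural_measure (mu : {measure set X -> \bar R}) :=
  forall A, measurable A -> exists k : nat, mu A = k%:R%:E.

Lemma natural_gt0 mu A : natural_measure mu -> measurable A -> mu A != 0 -> 1 <= mu A.
Proof.
move=> nm mA; have [k ->] := nm A mA; case: k => [|k]; first by rewrite eqxx.
by rewrite lee_fin ler1n.
Qed.

(** Countably many balls of radius [1 / (n + 1)] cover [X], and a set that is not null has mass at
    least 1. Hence decreasing sets [C n] of mass at least 1 can be chosen, each inside a smaller
    ball. By continuity from above their intersection has mass at least 1, so it is nonempty, and it
    can only be one point. *)
Lemma exists_atom mu : natural_measure mu -> mu setT != 0 -> exists x, 1 <= mu [set x].
Proof.
move=> nm mT; have [q hq] := dense_seq.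
pose ball n m := dball dist (q m) (n.+1%:R^-1).
have mball n m : measurable (ball n m) by exact: measurable_dball.
have step n C : measurable C /\ 1 <= mu C -> exists m, 1 <= mu (C `&` ball n m).
  move=> [mC C1]; apply: contrapT => h.
  have z m : mu (C `&` ball n m) = 0.
    apply/eqP; apply: contrapT => /negP nz; apply: h; exists m.
    by apply: natural_gt0 => //; exact: measurableI.
  have : mu C <= 0.
    rewrite -[leRHS](eseries0 (N := 0) (P := xpredT) (f := fun m => mu (C `&` ball n m))) //.
    apply: (measure_sigma_subadditive mu (F := fun m => C `&` ball n m)) => //.
      by move=> m; exact: measurableI.
    move=> x Cx; have e0 : (0 < n.+1%:R^-1 :> R)%R by rewrite invr_gt0 ltr0n.
    have [m hm] := hq x _ e0.
    by exists m => //; split => //; rewrite /ball /dball /= distC.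
  by move=> /(le_trans C1); rewrite lee_fin ler10.
pose pick n C : nat := xget 0%N [set m | 1 <= mu (C `&` ball n m)].
pose C := fix C n : set X := if n is n'.+1 then C n' `&` ball n' (pick n' (C n')) else setT.
have hC n : measurable (C n) /\ 1 <= mu (C n).
  elim: n => [|n [mC C1]] /=; first by split => //; exact: natural_gt0.
  split; first exact: measurableI.
  have [m hm] := step n (C n) (conj mC C1).
  by rewrite /pick; case: xgetP => [k _ //|/(_ m)].
have ndC : {homo C : n m / (n <= m)%N >-> (m <= n)%O}.
  apply/nonincreasing_seqP => n; apply/subsetPset => /=; exact: subIsetl.
have mI : measurable (\bigcap_n C n) by apply: bigcap_measurable => // n _; case: (hC n).
have muI : 1 <= mu (\bigcap_n C n).
  have C0 : mu (C 0%N) < +oo by have [k e] := nm setT measurableT; rewrite /= e ltry.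
  have := nonincreasing_cvg_mu C0 (fun n => (hC n).1) mI ndC.
  move=> cv; have <- := cvg_lim _ cv => //.
  apply: lime_ge; first by apply/cvg_ex; eexists; exact: cv.
  by near=> n; case: (hC n).
have [x Ix] : (\bigcap_n C n) !=set0.
  apply/set0P/eqP => e; move: muI; rewrite e measure0 lee_fin ler10 //.
exists x; rewrite (_ : [set x] = \bigcap_n C n) //.
apply/seteqP; split=> [y -> //|y Iy].
suff -> : y = x by [].
apply: (dist_eq0 Hmetric); rewrite distC //; apply/eqP; rewrite eq_le dist_ge0 // andbT.
apply/ler_addgt0Pr => e e0; rewrite add0r.
have [n hn] : exists n, (n.+1%:R^-1 < e / 2)%R.
  have e2 : (0 < e / 2)%R by rewrite divr_gt0.
  exists (Num.truncn (e / 2)^-1); rewrite invf_plt ?posrE ?ltr0n //; exact: truncnS_gt.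
have [_ bx] := Ix n.+1 I; have [_ by_] := Iy n.+1 I.
apply: (le_trans (dist_triangle Hmetric x (q (pick n (C n))) y)); rewrite (distC Hmetric x).
apply: ltW; apply: (lt_le_trans (ltrD (bx : (_ < _)%R) (by_ : (_ < _)%R))).
by rewrite [leRHS](splitr e) lerD // ltW.
Unshelve. all: by end_near.
Qed.

Lemma mpts_nseq m x s A : mpts (nseq m x ++ s) A = (m%:R * \1_A x)%:E + mpts s A.
Proof.
elim: m => [|m IH]; first by rewrite mul0r add0e.
by rewrite [LHS]mpts_cons IH addeA -EFinD; congr (_%:E + _); rewrite -natr1; ring.
Qed.

(** Induction on the total mass: an atom is removed together with its whole mass [m], which is at
    least 1. *)
Lemma natural_measure_points mu : natural_measure mu ->
  exists s, forall A, measurable A -> mu A = mpts s A.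
Proof.
move=> nm; have [k] := nm setT measurableT.
have null (nu : {measure set X -> \bar R}) A : nu setT = 0 -> measurable A -> nu A = 0.
  move=> nu0 mA; apply/eqP; rewrite eq_le measure_ge0 andbT -nu0.
  by apply: le_measure; rewrite ?inE.
move: {2}k (leqnn k) => n; elim: n k mu nm => [|n IH] k mu nm kn ek.
  by exists [::] => A mA; apply: null => //; move: kn ek; rewrite leqn0 => /eqP ->.
have [mz|mnz] := eqVneq (mu setT) 0; first by exists [::] => A mA; exact: null.
have [x x1] := exists_atom nm mnz.
have mx := measurable_point x; have mCx := measurableC mx.
have [m em] := nm _ mx.
pose mu' : {measure set X -> \bar R} := mrestr mu mCx.
have nm' : natural_measure mu' by move=> A mA; apply: nm; exact: measurableI.
have split_mu A : measurable A -> mu A = (m%:R * \1_A x)%:E + mu' A.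
  move=> mA; rewrite (measureDI mu mA mx) addeC setDE; congr (_ + _).
  have [xA|xA] := boolP (x \in A).
    rewrite indicE xA mulr1 -em; congr (mu _); apply/seteqP; split=> y [] //.
    by move: xA; rewrite inE => xA' ->.
  rewrite indicE (negbTE xA) mulr0 (_ : A `&` [set x] = set0) ?measure0 //.
  apply/seteqP; split=> y // [Ay yx]; move: xA; rewrite notin_setE; apply.
  by rewrite -yx.
have [k' ek'] := nm' setT measurableT.
have kE : k = (m + k')%N.
  have := split_mu setT measurableT; rewrite ek ek' indicT mulr1 -EFinD -natrD => -[] /eqP.
  by rewrite eqr_nat => /eqP.
have m1 : (0 < m)%N by move: x1; rewrite em lee_fin ler1n.
have k'n : (k' <= n)%N by move: kn m1; rewrite kE; lia.
have [s hs] := IH k' mu' nm' k'n ek'; exists (nseq m x ++ s) => A mA.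
by rewrite mpts_nseq -hs // split_mu.
Qed.
End PointMeasures.

(** * The Gibbs equation *)

Lemma measurable_Snewton (R : realType) d (T : measurableType d) (p : T -> nat -> R) k :
  (forall i, measurable_fun setT (p ^~ i)) -> measurable_fun setT (fun t => Snewton (p t) k).
Proof.
move=> mp; elim: k {-2}k (leqnn k) => [|m IH] [|k] // km; try exact: measurable_cst.
have k0 : k.+1%:R != 0 :> R by rewrite pnatr_eq0.
under eq_fun do rewrite -[Snewton _ _](mulKf k0) SnewtonS.
apply: measurable_funM; first exact: measurable_cst.
apply: measurable_sum => i; apply: measurable_funM => //.
apply: measurable_funM; first exact: measurable_cst.
by apply: IH; apply: leq_trans (leq_subr _ _) _.
Qed.

Lemma integral_probability1 d (T : measurableType d) (R : realType) (P : probability T R) :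
  (\int[P]_x 1%:E = 1%:E)%E.
Proof. by rewrite integral_cst // mul1e; exact: probability_setT. Qed.

Lemma measurable_lmf_head d dU (X : measurableType d) (U : measurableType dU) (G : seq X -> U) xs :
  lmf G -> measurable_fun setT (fun y => G (y :: xs)).
Proof.
by move=> mG; exact: (lmf_catr xs mG (us := [:: id]) (conj (@measurable_id _ _ _) I)).
Qed.

Section GNZ.
Context {d : measure_display} {X : measurableType d} {R : realType}.
Variable dist : X -> X -> R.
Hypothesis Hmetric : is_metric dist.
Hypothesis Hborel : @measurable d X = <<s dopen dist >>.
Hypothesis Hsep : dseparable dist.
Local Open Scope ereal_scope.
Local Notation NX := (NN dist).

Lemma mcfg_addd (eta : NX) y A : mcfg (addd eta y : NX) A = mcfg eta A + (\d_y)%R A.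
Proof.
rewrite /mcfg /addd; case: pselect => [p|np] /=; first exact: measure_addE.
case: np; split=> [B mB|B mB bB].
  rewrite measure_addE; case: (@lfcm_count d X R dist eta _ mB) => [->|[k ->]]; first by left.
  by right; exists (k + (y \in B))%N; rewrite natrD EFinD.
rewrite measure_addE; apply: lte_add_pinfty; first exact: (@lfcm_lf d X R dist eta) bB.
exact: ltry.
Qed.

Lemma integral_addd (eta : NX) y (f : X -> \bar R) : (forall x, 0 <= f x) ->
  measurable_fun setT f ->
  \int[mcfg (addd eta y : NX)]_x f x = \int[mcfg eta]_x f x + f y.
Proof.
move=> f0 mf.
rewrite (eq_measure_integral (measure_add (mcfg eta) (@dirac _ X y R))); last first.
  by move=> A mA _; rewrite [RHS]measure_addE; exact: mcfg_addd.
by rewrite ge0_integral_measure_add // integral_dirac // diracT mul1e.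
Qed.

Lemma cfg_points (eta : NX) n : exists s, forall f : X -> \bar R, (forall x, 0 <= f x) ->
  measurable_fun setT f -> (forall x, ~ oball dist n x -> f x = 0) ->
  \int[mcfg eta]_x f x = \sum_(x <- s) f x.
Proof.
have mB : measurable (oball dist n) by exact: measurable_oball.
pose mu : {measure set X -> \bar R} := mrestr (mcfg eta) mB.
have nm : natural_measure mu.
  move=> A mA; have mAB : measurable (A `&` oball dist n) by exact: measurableI.
  case: (@lfcm_count d X R dist eta _ mAB) => [e|[k e]]; last by exists k.
  by have := @lfcm_lf d X R dist eta _ mAB (dbounded_oball _ _ _); rewrite e ltxx.
have [s hs] := natural_measure_points Hmetric Hborel Hsep nm.
exists s => f f0 mf fB; rewrite -integral_mpts //.
have fE : f \_ (oball dist n) = f.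
  apply/funext => x; rewrite patchE; case: ifPn => // /negP; rewrite inE => /fB //.
rewrite -[in LHS]fE -[in RHS]fE -!integral_mkcond.
apply: eq_measure_integral => A mA /setIidPl AB; rewrite -hs //.
by rewrite -[in LHS]AB.
Qed.

Section FixedTestFunction.
Variables (n : nat) (g : X -> R).
Hypothesis mg : measurable_fun setT g.
Hypothesis g01 : forall y, (0 <= g y <= 1)%R.
Hypothesis gB : forall y, ~ oball dist n y -> g y = 0%R.

Definition pw (eta : NX) i : R := fine (\int[mcfg eta]_y (g y ^+ i)%:E).
(** The elementary symmetric function of the values of [g] at the points of [eta] (see [pw_points]),
    written through integrals so that it is measurable in [eta]. *)
Definition Sg k (eta : NX) : R := Snewton (pw eta) k.

Let g0 y : (0 <= g y)%R. Proof. by case/andP: (g01 y). Qed.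
Let mgi i : measurable_fun setT (fun y => (g y ^+ i)%:E).
Proof. by apply/measurable_EFinP; exact: measurable_funX. Qed.
Let gi0 i y : 0 <= (g y ^+ i)%:E. Proof. by rewrite lee_fin exprn_ge0. Qed.
Let giB i y : (0 < i)%N -> ~ oball dist n y -> (g y ^+ i)%:E = 0.
Proof. by case: i => // i _ /gB ->; rewrite expr0n. Qed.

Lemma pw_points eta s : (forall f : X -> \bar R, (forall x, 0 <= f x) ->
    measurable_fun setT f -> (forall x, ~ oball dist n x -> f x = 0) ->
    \int[mcfg eta]_x f x = \sum_(x <- s) f x) ->
  forall k, Sg k eta = elsym [seq g x | x <- s] k.
Proof.
move=> hs k; apply: eq_Snewton => i i0.
by rewrite /pw hs // ?sumEFin /psum ?big_map // => y; exact: giB.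
Qed.

Lemma pw_fin_num (eta : NX) i : (0 < i)%N -> \int[mcfg eta]_y (g y ^+ i)%:E \is a fin_num.
Proof.
move=> i0; have [s hs] := cfg_points eta n; rewrite hs // ?sumEFin // => y; exact: giB.
Qed.

Lemma Sg_ge0 k eta : (0 <= Sg k eta)%R.
Proof.
have [s hs] := cfg_points eta n; rewrite (pw_points hs).
by apply: elsym_ge0 => h /mapP[x _ ->].
Qed.

Lemma pw_addd eta y i : (0 < i)%N -> pw (addd eta y) i = (pw eta i + g y ^+ i)%R.
Proof.
by move=> i0; rewrite /pw integral_addd // fineD // pw_fin_num.
Qed.

Lemma Sg_addd k eta y : Sg k (addd eta y) = (Sg k eta + g y * Sprev (pw eta) k)%R.
Proof. by rewrite /Sg -Snewton_add; apply: eq_Snewton => i i0; rewrite pw_addd. Qed.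

Lemma measurable_Sg d' (T : measurableType d') (e : T -> NX) k : measurable_fun setT e ->
  measurable_fun setT (fun t => Sg k (e t)).
Proof.
move=> me; apply: measurable_Snewton => i; apply: measurableT_comp; first exact: fine_measurable.
apply: (measurable_integral_cfg Hmetric Hborel me (k := fun p => (g p.2 ^+ i)%:E)) => //.
by apply: measurableT_comp (mgi i) _; exact: measurable_snd.
Qed.

Variable v : X -> X -> \bar R.
Hypothesis v0 : forall x y, 0 <= v x y.
Hypothesis mv : measurable_fun setT (uncurry v).
Hypothesis v_sym : forall x y, v x y = v y x.

Let mvx x : measurable_fun setT (v x).
Proof. exact: measurableT_comp mv (pair1_measurable x). Qed.

Lemma Wint_ge0 x (eta : NX) : 0 <= Wint v x eta.
Proof. by apply: integral_ge0 => y _. Qed.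

Lemma Wint_addd x (eta : NX) y : Wint v x (addd eta y) = Wint v x eta + v x y.
Proof. exact: integral_addd. Qed.

Lemma measurable_Wint d' (T : measurableType d') (u : T -> X) (e : T -> NX) :
  measurable_fun setT u -> measurable_fun setT e ->
  measurable_fun setT (fun t => Wint v (u t) (e t)).
Proof.
move=> mu me; apply: (measurable_integral_cfg Hmetric Hborel me (k := fun p => v (u p.1) p.2)) => //.
have mu1 : measurable_fun setT (fun p : T * X => u p.1).
  exact: measurableT_comp mu measurable_fst.
exact: (measurableT_comp mv (measurable_fun_pair mu1 measurable_snd)).
Qed.

Definition Gx xs (eta : NX) : R := (\prod_(x <- xs) nexp (Wint v x eta))%R.

Lemma Gx01 xs eta : (0 <= Gx xs eta <= 1)%R.
Proof.
rewrite /Gx; elim: xs => [|x xs /andP[IH0 IH1]]; first by rewrite big_nil ler01 lexx.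
have /andP[n0 n1] := nexp01 (Wint_ge0 x eta).
by rewrite big_cons mulr_ge0 //= mulr_ile1.
Qed.

Lemma Gx_addd xs eta y :
  Gx xs (addd eta y) = (Gx xs eta * \prod_(x <- xs) nexp (v x y))%R.
Proof.
rewrite /Gx -big_split /=; apply: eq_bigr => x _.
by rewrite Wint_addd nexpD // Wint_ge0.
Qed.

Lemma measurable_Gx d' (T : measurableType d') (e : T -> NX) us : measurable_fun setT e ->
  mall us -> measurable_fun setT (fun t => Gx (ev us t) (e t)).
Proof.
move=> me; elim: us => [|u us IH] /=.
  by move=> _; rewrite /Gx; under eq_fun do rewrite big_nil; exact: measurable_cst.
case=> mu /IH h; rewrite /Gx; under eq_fun do rewrite /= big_cons.
apply: measurable_funM => //; apply: measurableT_comp measurable_nexp _.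
exact: measurable_Wint.
Qed.
Variables (lam : {measure set X -> \bar R}) (z : X -> R).
Hypothesis z0 : forall x, (0 <= z x)%R.
Hypothesis mz : measurable_fun setT z.
Variable P : probability (NN dist) R.
Hypothesis HP : is_gibbs lam v z P.

Definition ES k xs : \bar R := \int[P]_eta (Sg k eta * Gx xs eta)%:E.

Lemma SG_ge0 k xs eta : 0 <= (Sg k eta * Gx xs eta)%:E.
Proof. by rewrite lee_fin mulr_ge0 ?Sg_ge0 //; case/andP: (Gx01 xs eta). Qed.

Lemma ES_ge0 k xs : 0 <= ES k xs.
Proof. by apply: integral_ge0 => eta _; exact: SG_ge0. Qed.

Lemma measurable_SG k xs : measurable_fun setT (fun eta : NX => (Sg k eta * Gx xs eta)%:E).
Proof.
apply/measurable_EFinP; apply: measurable_funM; first exact: (measurable_Sg k (@measurable_id _ NX setT)).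
have := measurable_Gx (@measurable_id _ NX setT) (mall_cstl NX xs).
by under eq_fun do rewrite ev_cstl.
Qed.

Lemma lmf_ES k : lmf (ES k).
Proof.
move=> d' T us mus.
have mf : measurable_fun setT (fun p : T * NX => (Sg k p.2 * Gx (ev us p.1) p.2)%:E).
  apply/measurable_EFinP; apply: measurable_funM; first exact: measurable_Sg measurable_snd.
  have := measurable_Gx measurable_snd (mall_comp measurable_fst mus).
  by under eq_fun do rewrite ev_comp.
by apply: (measurable_fun_fubini_tonelli_F (m2 := P) _ mf) => p; exact: SG_ge0.
Qed.

(* The test function of the Gibbs equation must be nonnegative, but the alternating
   sum [D] below is so only when [y] is a point of [eta]; hence the truncation at 0,
   which is inactive on both sides of the equation. *)
Lemma gnz_step k xs : k.+1%:R%:E * ES k.+1 xs =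
  \int[lam]_y (((g y * \prod_(x <- xs) nexp (v x y))%R%:E * ES k (y :: xs)) * (z y)%:E).
Proof.
pose D (y : X) (eta : NX) : R := (\sum_(i < k.+1) (- g y) ^+ i * Sg (k - i) eta)%R.
pose F (p : X * NX) : R := (Num.max 0 (g p.1 * D p.1 p.2) * Gx xs p.2)%R.
have G0 eta : (0 <= Gx xs eta)%R by case/andP: (Gx01 xs eta).
have F0 p : (0 <= F p)%R by rewrite mulr_ge0 // le_max lexx.
have mg1 : measurable_fun setT (fun p : X * NX => g p.1).
  exact: measurableT_comp mg measurable_fst.
have mF : measurable_fun setT F.
  apply: measurable_funM; last first.
    have := measurable_Gx (measurable_snd : measurable_fun _ (snd : X * NX -> NX)) (mall_cstl _ xs).
    by under eq_fun do rewrite ev_cstl.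
  apply: measurable_maxr; first exact: measurable_cst.
  apply: measurable_funM => //; apply: measurable_sum => i; apply: measurable_funM.
    by apply: measurable_funX; exact: measurableT_comp mg1.
  exact: measurable_Sg measurable_snd.
have := HP mF F0.
(* At a point [y] of [eta], [D y eta] is the symmetric function of the other points, hence
   nonnegative. Summing [g y * D y eta] over the points is Newton's identity for [Sg k.+1]. *)
have -> : \int[P]_eta \int[@lfcm_meas d X R dist eta]_x (F (x, eta))%:E =
    k.+1%:R%:E * ES k.+1 xs.
  rewrite -ge0_integralZl //; last 2 first.
  - exact: measurable_SG.
  - by move=> eta _; exact: SG_ge0.
  apply: eq_integral => eta _; have [s hs] := cfg_points eta n.
  rewrite -[LHS]/(\int[mcfg eta]_x (F (x, eta))%:E) hs.
  - have FE y : y \in s -> F (y, eta) = (g y * D y eta * Gx xs eta)%R.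
      move=> ys; rewrite /F /= max_r // mulr_ge0 // /D.
      under eq_bigr do rewrite (pw_points hs).
      by apply: division_ge0 => [h /mapP[x _ ->] //|]; exact: map_f.
    rewrite big_seq (eq_bigr (fun y => (g y * D y eta * Gx xs eta)%R%:E)); last first.
      by move=> y ys; rewrite FE.
    rewrite -big_seq sumEFin -mulr_suml -EFinM mulrA; congr ((_ * _)%R%:E).
    rewrite /Sg SnewtonS -/(Sg _ _).
    under eq_bigr do rewrite /D mulr_sumr.
    rewrite exchange_big /=; apply: eq_bigr => i _.
    have pwE : pw eta i.+1 = (\sum_(y <- s) g y ^+ i.+1)%R.
      by rewrite /pw hs // ?sumEFin // => y; exact: giB.
    rewrite pwE mulr_sumr; apply: eq_bigr => y _.
    by rewrite -/(Sg _ _) exprS (exprNn (g y)); ring.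
  - by move=> y; rewrite lee_fin.
  - apply/measurable_EFinP; exact: (measurableT_comp mF (pair2_measurable eta)).
  - by move=> y yB; rewrite /F /= (gB yB) mul0r maxxx mul0r.
move=> ->; apply: eq_integral => y _; congr (_ * _).
rewrite -ge0_integralZl //; last 3 first.
- exact: measurable_SG.
- by move=> eta _; exact: SG_ge0.
- by rewrite lee_fin mulr_ge0 // prodr_ge0 // => x _; case/andP: (nexp01 (v0 x y)).
apply: eq_integral => eta _; rewrite nexpE ?Wint_ge0 // -!EFinM; congr (_%:E).
rewrite /F /= Gx_addd /Gx big_cons -/(Gx xs eta).
(* Adding [y] multiplies the generating polynomial by [1 + g y X], and [D] divides by it again. *)
have -> : D y (addd eta y) = Sg k eta.
  by rewrite /D; apply: alternating_division => j _; exact: Sg_addd.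
rewrite max_r ?mulr_ge0 ?Sg_ge0 //; ring.
Qed.
Variable nu : {sigma_finite_measure set X -> \bar R}.
Hypothesis nuE : forall f : X -> \bar R, (forall x, 0 <= f x) -> measurable_fun setT f ->
  \int[nu]_x f x = \int[lam]_x ((z x)%:E * f x).
Local Notation w := (wpot v).

Definition EG xs : R := fine (\int[P]_eta (Gx xs eta)%:E).
Definition Rt xs : R := (Zprod w xs * EG xs)%R.

Let w_sym := wpot_sym v_sym.
Let w01 := wpot01 v0.
Let mw := measurable_wpot mv.
Let Z0 s : (0 <= Zprod w s)%R. Proof. by case/andP: (Zprod01 w01 s). Qed.

Lemma wpotE x y : (1 - w x y)%R = nexp (v x y).
Proof. by rewrite /wpot /fpot opprK addrC subrK. Qed.

Lemma measurable_Gx_cst xs : measurable_fun setT (fun eta : NX => Gx xs eta).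
Proof.
have := measurable_Gx (@measurable_id _ NX setT) (mall_cstl NX xs).
by under eq_fun do rewrite ev_cstl.
Qed.

Lemma EG_E xs : (EG xs)%:E = \int[P]_eta (Gx xs eta)%:E.
Proof.
rewrite /EG fineK // ge0_fin_numE; last first.
  by apply: integral_ge0 => eta _; rewrite lee_fin; case/andP: (Gx01 xs eta).
apply: (@le_lt_trans _ _ (\int[P]_eta 1%:E)); last first.
  by rewrite integral_probability1 ltry.
apply: ge0_le_integral => //.
- by move=> eta _; rewrite lee_fin; case/andP: (Gx01 xs eta).
- by apply/measurable_EFinP; exact: measurable_Gx_cst.
- by move=> eta _; rewrite lee_fin; case/andP: (Gx01 xs eta).
Qed.

Lemma EG01 xs : (0 <= EG xs <= 1)%R.
Proof.
rewrite -!lee_fin EG_E; apply/andP; split.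
  by apply: integral_ge0 => eta _; rewrite lee_fin; case/andP: (Gx01 xs eta).
rewrite -[leRHS](_ : \int[P]_eta 1%:E = 1%:E); last exact: integral_probability1.
apply: ge0_le_integral => //.
- by move=> eta _; rewrite lee_fin; case/andP: (Gx01 xs eta).
- by apply/measurable_EFinP; exact: measurable_Gx_cst.
- by move=> eta _; rewrite lee_fin; case/andP: (Gx01 xs eta).
Qed.

Lemma Rt_ge0 xs : (0 <= Rt xs)%R.
Proof. by rewrite mulr_ge0 //; case/andP: (EG01 xs). Qed.

Lemma Rt_nil : Rt [::] = 1%R.
Proof.
rewrite /Rt /= mul1r; apply: EFin_inj; rewrite EG_E.
under eq_integral do rewrite /Gx big_nil.
exact: integral_probability1.
Qed.

Lemma Rt_perm xs ys : perm_eq xs ys -> Rt xs = Rt ys.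
Proof.
move=> e; rewrite /Rt (Zprod_perm w_sym e); congr (_ * fine _)%R.
by apply: eq_integral => eta _; rewrite /Gx (perm_big _ e).
Qed.

Lemma Rt_cat_le ys xs : (Rt (ys ++ xs) <= Zprod w ys)%R.
Proof.
have /andP[e0 e1] := EG01 (ys ++ xs); rewrite /Rt.
apply: (@le_trans _ _ (Zprod w (ys ++ xs))); first by rewrite ler_piMr.
apply: (le_trans (Zprod_cat_le w01 ys xs)); rewrite ler_piMr //.
by case/andP: (Zprod01 w01 xs).
Qed.

Lemma lmf_Rt : lmf Rt.
Proof.
move=> d' T us mus; apply: measurable_funM; first exact: (lmf_Zprod mw mus).
apply: measurableT_comp; first exact: fine_measurable.
have mf : measurable_fun setT (fun p : T * NX => (Gx (ev us p.1) p.2)%:E).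
  apply/measurable_EFinP; have := measurable_Gx measurable_snd (mall_comp measurable_fst mus).
  by under eq_fun do rewrite ev_comp.
apply: (measurable_fun_fubini_tonelli_F (m2 := P) _ mf) => p.
by rewrite lee_fin; case/andP: (Gx01 (ev us p.1) p.2).
Qed.

Definition gprod (s : seq X) : R := (\prod_(y <- s) g y)%R.

Let gp0 s : (0 <= gprod s)%R. Proof. exact: prodr_ge0. Qed.

(** Iterates [gnz_step]: each step lowers the degree of the symmetric function by one and produces
    an integrated point [y], whose interaction with [xs] turns [Zprod w xs] into
    [Zprod w (y :: xs)]. The moments are thus expressed by [Rt] itself. *)
Lemma J_gprod_Rt k xs : J nu k (fun ys => (gprod ys * Rt (ys ++ xs))%:E) =
  (Zprod w xs)%:E * ES k xs.
Proof.
elim: k xs => [|k IH] xs.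
  rewrite /J /= /gprod big_nil invr1 !mul1e mul1r /Rt EFinM EG_E; congr (_ * _).
  by apply: eq_integral => eta _; rewrite /Sg Snewton0 mul1r.
have mGR us : lmf (fun ys => (gprod ys * Rt (ys ++ us))%:E).
  apply: lmf_EFin => d' T vs mvs; apply: measurable_funM; first exact: (lmf_prod mg).
  exact: (lmf_catr us lmf_Rt).
have GR0 us ys : 0 <= (gprod ys * Rt (ys ++ us))%:E by rewrite lee_fin mulr_ge0 ?Rt_ge0.
have k1 : 0 <= (k.+1%:R^-1)%:E :> \bar R by rewrite lee_fin invr_ge0 ler0n.
have fE : (((k.+1)`!)%:R^-1 = k.+1%:R^-1 * (k`!)%:R^-1 :> R)%R by rewrite factS natrM invfM.
have f0 : 0 <= ((k`!)%:R^-1)%:E :> \bar R by rewrite lee_fin invr_ge0 ler0n.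
transitivity ((k.+1%:R^-1)%:E * \int[nu]_y ((g y)%:E *
    J nu k (fun ys => (gprod ys * Rt (ys ++ y :: xs))%:E))).
  rewrite {1}/J fE EFinM -muleA; congr (_ * _); rewrite [It _ _ _]/= -ge0_integralZl //; last 2 first.
  - apply: (measurable_It nu k (G := fun ys => (gprod ys * Rt (ys ++ xs))%:E)) => //.
  - by move=> y _; apply: It_ge0 => ys; exact: (GR0 xs (y :: ys)).
  apply: eq_integral => y _; rewrite /J muleCA -[in RHS]ItZl //; last by rewrite lee_fin.
  congr (_ * _); apply: eq_It => ys _; rewrite /gprod big_cons -EFinM -mulrA.
  congr (_ * (_ * _))%R%:E.
  by apply: Rt_perm; rewrite -(cat1s y xs) -(cat1s y (ys ++ xs)) perm_catCA.
under eq_integral => y _ do rewrite IH.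
have ES' : ES k.+1 xs = (k.+1%:R^-1)%:E * (k.+1%:R%:E * ES k.+1 xs).
  by rewrite muleA -EFinM mulVf ?mul1e // pnatr_eq0.
rewrite [in RHS]ES' gnz_step muleCA; congr (_ * _).
rewrite nuE; last 2 first.
- by move=> y; rewrite mule_ge0 ?lee_fin // mule_ge0 ?lee_fin ?ES_ge0.
- apply: emeasurable_funM; first exact/measurable_EFinP.
  apply: emeasurable_funM; last exact: measurable_lmf_head (lmf_ES k).
  by apply/measurable_EFinP; exact: measurable_lmf_head (lmf_Zprod mw).
rewrite -ge0_integralZl //.
- apply: eq_integral => y _.
  rewrite /= /cprod; under eq_bigr do rewrite wpotE v_sym.
  move: (ES k (y :: xs)) => e; rewrite !EFinM -!muleA [LHS]muleCA [RHS]muleCA.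
  congr ((g y)%:E * _).
  rewrite [LHS]muleC -!muleA.
  exact: muleCA.

- apply: emeasurable_funM; last exact/measurable_EFinP.
  apply: emeasurable_funM; last exact: measurable_lmf_head (lmf_ES k).
  apply/measurable_EFinP; apply: measurable_funM => //.
  by apply: measurable_prod => x _; apply: measurableT_comp measurable_nexp _.
- move=> y _; rewrite mule_ge0 ?lee_fin // mule_ge0 ?ES_ge0 // lee_fin mulr_ge0 // prodr_ge0 // => x _.
  by case/andP: (nexp01 (v0 x y)).
- by rewrite lee_fin.
Qed.
End FixedTestFunction.
End GNZ.

(** * Kirkwood-Salsburg inequalities *)

Section NexpLimit.
Context {R : realType}.
Local Open Scope ereal_scope.

Lemma le_nexp (x y : \bar R) : 0 <= x -> x <= y -> (nexp y <= nexp x)%R.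
Proof.
move=> x0 xy; rewrite -lee_fin -!nexpE ?lee_expeR ?leeN2 //.
exact: le_trans xy.
Qed.

Lemma cvg_nexp (u : nat -> \bar R) l : (forall n, 0 <= u n) -> u @ \oo --> l ->
  (fun n => nexp (u n)) @ \oo --> nexp l.
Proof.
move=> u0; case: l => [r| |] ul.
- have /fine_cvgP[fu cu] := ul.
  have : (fun n => expR (- fine (u n))%R) @ \oo --> expR (- r)%R.
    by apply: (continuous_cvg _ (@continuous_expR R _)); exact: cvgN.
  apply: cvg_trans; apply: near_eq_cvg; near=> n.
  have : u n \is a fin_num by near: n.
  by rewrite /nexp; case: (u n).
- rewrite [nexp _](_ : _ = 0%R); last by rewrite /nexp.
  apply/cvgrPdist_le => /= e e0.
  (* For the tolerance [e] the threshold [1 / e] works: [1 + x <= expR x] at [x = 1 / e] gives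
     [expR (- x) <= e]. *)
  move/cvgeyPge: ul => /(_ (e^-1)%R) ul; near=> n.
  have une : (e^-1)%:E <= u n by near: n.
  have [n0 n1] := andP (nexp01 (u0 n)); rewrite sub0r normrN ger0_norm //.
  have ei0 : (0 < e^-1)%R by rewrite invr_gt0.
  apply: (le_trans (le_nexp _ une)); first by rewrite lee_fin ltW.
  rewrite /nexp /= expRN -[leRHS]invrK lef_pV2 ?posrE ?expR_gt0 //.
  by apply: le_trans (expR_ge1Dx _); rewrite lerDr.
- have : 0 <= -oo :> \bar R.
    by apply: (cvge_ge _ ul) => //; exact: nearW.
  by [].
Unshelve. all: end_near. Qed.
End NexpLimit.

Section ItMonotone.
Context {d : measure_display} {X : measurableType d} {R : realType}.
Variable nu : {sigma_finite_measure set X -> \bar R}.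
Local Open Scope ereal_scope.

Lemma cvg_It k (G_ : nat -> seq X -> \bar R) G : (forall n, lmf (G_ n)) ->
  (forall n s, 0 <= G_ n s) -> (forall s, nondecreasing_seq (G_ ^~ s)) ->
  (forall s, G_ ^~ s @ \oo --> G s) ->
  (fun n => It nu k (G_ n)) @ \oo --> It nu k G.
Proof.
elim: k G_ G => [|k IH] G_ G mG G0 ndG cG /=; first exact: cG.
have nd x : nondecreasing_seq (fun n => It nu k (fun s => G_ n (x :: s))).
  move=> m n mn; apply: le_It => // [||s _]; try exact: lmf_cons.
  exact: ndG.
have c x : (fun n => It nu k (fun s => G_ n (x :: s))) @ \oo --> It nu k (fun s => G (x :: s)).
  by apply: (IH (fun n s => G_ n (x :: s))) => // n; exact: lmf_cons.
under [X in _ --> X]eq_integral => x _ do rewrite -(cvg_lim (@ereal_hausdorff R) (c x)).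
apply: (@cvg_monotone_convergence _ _ _ nu setT measurableT
    (fun n x => It nu k (fun s => G_ n (x :: s)))) => //.
- by move=> n; exact: measurable_It.
- by move=> n x _; exact: It_ge0.
Qed.
End ItMonotone.

Section KirkwoodSalsburg.
Context {d : measure_display} {X : measurableType d} {R : realType}.
Variable dist : X -> X -> R.
Hypothesis Hmetric : is_metric dist.
Hypothesis Hborel : @measurable d X = <<s dopen dist >>.
Hypothesis Hsep : dseparable dist.
Variable v : X -> X -> \bar R.
Hypothesis v0 : forall x y, (0 <= v x y)%E.
Hypothesis mv : measurable_fun setT (uncurry v).
Hypothesis v_sym : forall x y, v x y = v y x.
Variables (lam : {measure set X -> \bar R}) (z : X -> R).
Hypothesis z0 : forall x, 0 <= z x.
Hypothesis mz : measurable_fun setT z.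
Variable P : probability (NN dist) R.
Hypothesis HP : is_gibbs lam v z P.
Variable nu : {sigma_finite_measure set X -> \bar R}.
Hypothesis nuE : forall f : X -> \bar R, (forall x, 0 <= f x)%E -> measurable_fun setT f ->
  (\int[nu]_x f x = \int[lam]_x ((z x)%:E * f x))%E.
Local Open Scope ereal_scope.
Local Notation NX := (NN dist).
Local Notation w := (wpot v).
Local Notation par := (@par R).

Let w01 := wpot01 v0.
Let mw := measurable_wpot mv.
Let mvx x : measurable_fun setT (v x).
Proof. exact: measurableT_comp mv (pair1_measurable x). Qed.
Let mwx x : measurable_fun setT (w x).
Proof. exact: measurableT_comp mw (pair1_measurable x). Qed.

(** The cut-off to a ball leaves finitely many contributing points in each configuration.
    [nexp_vball] relates the cut-off of [w] to that of [v]; the limit in [n] is taken only in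
    integrated inequalities. *)
Definition gball n x y : R := (\1_(oball dist n) y * w x y)%R.
Definition vball n x y : \bar R := (\1_(oball dist n) y)%:E * v x y.

Lemma measurable_gball n x : measurable_fun setT (gball n x).
Proof.
by apply: measurable_funM => //; apply: measurable_indic; exact: measurable_oball.
Qed.

Lemma indic01 (A : set X) y : (0 <= (\1_A y : R) <= 1)%R.
Proof. by rewrite indicE; case: (_ \in _); rewrite ?lexx ler01. Qed.

Lemma gball01 n x y : (0 <= gball n x y <= 1)%R.
Proof.
have /andP[i0 i1] := indic01 (oball dist n) y; have /andP[w0 w1] := w01 x y.
by rewrite mulr_ge0 //= mulr_ile1.
Qed.

Lemma indic_oball_out n y : ~ oball dist n y -> \1_(oball dist n) y = 0%R :> R.
Proof. by move=> nB; rewrite indicE memNset. Qed.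

Lemma gball_out n x y : ~ oball dist n y -> gball n x y = 0%R.
Proof. by rewrite /gball => /indic_oball_out ->; rewrite mul0r. Qed.

Lemma vball_ge0 n x y : 0 <= vball n x y.
Proof. by rewrite mule_ge0 // lee_fin; case/andP: (indic01 (oball dist n) y). Qed.

Lemma measurable_vball n x : measurable_fun setT (vball n x).
Proof.
apply: emeasurable_funM => //; apply/measurable_EFinP; apply: measurable_indic.
exact: measurable_oball.
Qed.

Lemma vball_out n x y : ~ oball dist n y -> vball n x y = 0.
Proof. by rewrite /vball => /indic_oball_out ->; rewrite mul0e. Qed.

Lemma nexp_vball n x y : nexp (vball n x y) = (1 - gball n x y)%R.
Proof.
rewrite /vball /gball indicE; case: (_ \in _); last by rewrite mul0e mul0r subr0 nexp0.
by rewrite mul1e mul1r wpotE.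
Qed.

Lemma nd_indic_oball y : nondecreasing_seq (fun n => \1_(oball dist n) y : R).
Proof.
move=> m n mn; rewrite !indicE ler_nat; case: (boolP (y \in oball dist m)) => // /set_mem h.
by rewrite mem_set //; exact: (subsetPset _ _ (nd_oball dist mn)) h.
Qed.

Lemma near_indic_oball y : \forall n \near \oo, \1_(oball dist n) y = 1%R :> R.
Proof.
have [N hN] := oball_near dist y; exists N => // n /= Nn.
by rewrite indicE mem_set //; exact: hN.
Qed.

Lemma cvg_vball x (eta : NX) :
  (fun n => \int[mcfg eta]_y vball n x y) @ \oo --> Wint v x eta.
Proof.
have c y : (fun n => vball n x y) @ \oo --> v x y.
  apply: cvg_near_cst; near=> n.
  by rewrite /vball (_ : \1_(oball dist n) y = 1%R) ?mul1e //; near: n; exact: near_indic_oball.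
rewrite /Wint -/(mcfg eta).
under [X in _ --> X]eq_integral => y _ do rewrite -(cvg_lim (@ereal_hausdorff R) (c y)).
apply: (@cvg_monotone_convergence _ _ _ _ setT measurableT (fun n => vball n x)) => //.
- by move=> n; exact: measurable_vball.
- by move=> n y _; exact: vball_ge0.
- by move=> y _ m n mn; apply: lee_wpmul2r => //; rewrite lee_fin; exact: nd_indic_oball.
Unshelve. all: end_near. Qed.

Let vint0 n x (eta : NX) : 0 <= \int[mcfg eta]_y vball n x y.
Proof. by apply: integral_ge0 => y _; exact: vball_ge0. Qed.

Let par_ge0 b n : (0 <= par b n)%R. Proof. exact: ler0n. Qed.

Definition nball n x (eta : NX) : R := nexp (\int[mcfg eta]_y vball n x y).

(** [nball n x eta] is the product of [1 - gball n x y] over the points [y] of [eta], so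
    [elsym_bonferroni] applies to these numbers. *)
Lemma bonferroni_cfg N n x (eta : NX) :
  (\sum_(k < N.+1) par true (N + k) * Sg (gball n x) k eta + par false N * nball n x eta <=
   \sum_(k < N.+1) par false (N + k) * Sg (gball n x) k eta + par true N * nball n x eta)%R.
Proof.
have [s hs] := cfg_points Hmetric Hborel Hsep eta n.
have e : nball n x eta = (\prod_(h <- [seq gball n x y | y <- s]) (1 - h))%R.
  rewrite /nball hs; [|exact: vball_ge0|exact: measurable_vball|exact: vball_out].
  rewrite big_map; elim: s {hs} => [|y s IH]; first by rewrite !big_nil nexp0.
  rewrite !big_cons nexpD ?vball_ge0 ?sume_ge0 // => [|i _]; last exact: vball_ge0.
  by rewrite IH nexp_vball.
have g01 h : h \in [seq gball n x y | y <- s] -> (0 <= h <= 1)%R.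
  by case/mapP => y _ ->; exact: gball01.
have := elsym_bonferroni N g01; rewrite -e mulrBr mulr_sumr -parB => h.
rewrite -subr_ge0; apply: (le_trans h).
rewrite le_eqVlt; apply/orP; left; apply/eqP.
transitivity (\sum_(k < N.+1) (par false (N + k) * Sg (gball n x) k eta -
    par true (N + k) * Sg (gball n x) k eta) - (par false N - par true N) * nball n x eta)%R.
  congr (_ - _)%R; apply: eq_bigr => k _.
  rewrite (pw_points (measurable_gball n x) (gball01 n x) (@gball_out n x) hs).
  by rewrite !parB mulrA -exprD -mulrBl parB.
rewrite big_split /= sumrN; ring.
Qed.

Lemma measurable_nball n x : measurable_fun setT (nball n x).
Proof.
apply: measurableT_comp measurable_nexp _.
apply: (measurable_integral_cfg Hmetric Hborel (@measurable_id _ NX setT)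
  (k := fun p => vball n x p.2)) => [p|]; first exact: vball_ge0.
exact: measurableT_comp (measurable_vball n x) measurable_snd.
Qed.

Definition Eb n x xs : \bar R := \int[P]_eta (nball n x eta * Gx v xs eta)%:E.

Let Gx0 xs (eta : NX) : (0 <= Gx v xs eta)%R. Proof. by case/andP: (Gx01 v0 xs eta). Qed.
Let nball01 n x (eta : NX) : (0 <= nball n x eta <= 1)%R. Proof. exact: nexp01. Qed.

Let nG0 n x xs (eta : NX) : 0 <= (nball n x eta * Gx v xs eta)%:E.
Proof. by rewrite lee_fin mulr_ge0 //; case/andP: (nball01 n x eta). Qed.

Let measurable_nG n x xs : measurable_fun setT (fun eta : NX => (nball n x eta * Gx v xs eta)%:E).
Proof.
apply/measurable_EFinP; apply: measurable_funM; first exact: measurable_nball.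
exact: measurable_Gx_cst.
Qed.

Let mSG n x := @measurable_SG _ _ _ _ Hmetric Hborel _ (measurable_gball n x) (gball01 n x) _ v0 mv.
Let SG0 n x := @SG_ge0 _ _ _ _ Hmetric Hborel Hsep _ _
  (measurable_gball n x) (gball01 n x) (@gball_out n x) _ v0.
Let Sg0 n x := @Sg_ge0 _ _ _ _ Hmetric Hborel Hsep _ _
  (measurable_gball n x) (gball01 n x) (@gball_out n x).

Lemma integral_bonferroni b N n x xs :
  \sum_(k < N.+1) (par b (N + k))%:E * ES (gball n x) v P k xs + (par (~~ b) N)%:E * Eb n x xs =
  \int[P]_eta ((\sum_(k < N.+1) par b (N + k) * Sg (gball n x) k eta +
                par (~~ b) N * nball n x eta) * Gx v xs eta)%:E.
Proof.
have pSG0 (k : nat) (eta : NX) : 0 <= (par b (N + k))%:E * (Sg (gball n x) k eta * Gx v xs eta)%:E.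
  by apply: mule_ge0; [rewrite lee_fin|exact: SG0].
rewrite [RHS](_ : _ = \int[P]_eta (
  \sum_(k < N.+1) (par b (N + k))%:E * (Sg (gball n x) k eta * Gx v xs eta)%:E +
  (par (~~ b) N)%:E * (nball n x eta * Gx v xs eta)%:E)); last first.
  apply: eq_integral => eta _; rewrite sumEFin -EFinD; congr _%:E.
  by rewrite mulrDl mulr_suml -mulrA; congr (_ + _)%R; apply: eq_bigr => k _; rewrite mulrA.
rewrite ge0_integralD //.
- congr (_ + _); last by rewrite ge0_integralZl // lee_fin.
  rewrite ge0_integral_sum //; last by move=> k; exact: measurable_funeM (mSG _ _ _ _).
  apply: eq_bigr => k _; rewrite ge0_integralZl //; last by rewrite lee_fin.
- by move=> eta _; apply: sume_ge0.
- by apply: emeasurable_sum => k; exact: measurable_funeM (mSG _ _ _ _).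
- by move=> eta _; apply: mule_ge0 => //; rewrite lee_fin.
- exact: measurable_funeM.
Qed.

Lemma bonferroni_mean N n x xs :
  \sum_(k < N.+1) (par true (N + k))%:E * ES (gball n x) v P k xs + (par false N)%:E * Eb n x xs <=
  \sum_(k < N.+1) (par false (N + k))%:E * ES (gball n x) v P k xs + (par true N)%:E * Eb n x xs.
Proof.
rewrite (integral_bonferroni true) (integral_bonferroni false).
have m b : measurable_fun setT (fun eta : NX => ((\sum_(k < N.+1) par b (N + k) * Sg (gball n x) k eta +
    par (~~ b) N * nball n x eta) * Gx v xs eta)%:E).
  apply/measurable_EFinP; apply: measurable_funM; last exact: measurable_Gx_cst.
  apply: measurable_funD; last by apply: measurable_funM => //; exact: measurable_nball.
  apply: measurable_sum => k; apply: measurable_funM => //.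
  exact: (measurable_Sg Hmetric Hborel (measurable_gball n x) (gball01 n x) k (@measurable_id _ NX setT)).
have p b (eta : NX) : 0 <= ((\sum_(k < N.+1) par b (N + k) * Sg (gball n x) k eta +
    par (~~ b) N * nball n x eta) * Gx v xs eta)%:E.
  rewrite lee_fin mulr_ge0 // addr_ge0 ?mulr_ge0 ?sumr_ge0 // => [k _|].
    by rewrite mulr_ge0 ?Sg0.
  by case/andP: (nball01 n x eta).
apply: ge0_le_integral => //.
by move=> eta _; rewrite lee_fin ler_wpM2r // bonferroni_cfg.
Qed.

(** The cut-off energies increase to [Wint v x eta], possibly infinite, and the integrands are
    dominated by 1. *)
Lemma cvg_Eb x xs : (fun n => Eb n x xs) @ \oo --> (EG v P (x :: xs))%:E.
Proof.
rewrite EG_E //.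
have [] := @dominated_convergence _ _ _ P setT measurableT
  (fun n (eta : NX) => (nball n x eta * Gx v xs eta)%:E) (fun eta : NX => (Gx v (x :: xs) eta)%:E) (cst 1%:E).
- by move=> n; exact: measurable_nG.
- by apply/measurable_EFinP; exact: measurable_Gx_cst.
- apply: aeW => eta _; apply: cvg_EFin; first exact: nearW.
  rewrite /Gx big_cons -/(Gx v xs eta); apply: cvgMl.
  by apply: cvg_nexp => //; exact: cvg_vball.
- exact: finite_measure_integrable_cst.
- apply: aeW => eta n _; rewrite gee0_abs // lee_fin.
  have /andP[a0 a1] := nball01 n x eta; have /andP[b0 b1] := Gx01 v0 xs eta.
  exact: mulr_ile1.
by [].
Qed.

Lemma cvg_J_gball k x xs : (fun n => J nu k (fun ys => (gprod (gball n x) ys * Rt v P (ys ++ xs))%:E))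
  @ \oo --> attach nu w x k (fun ys => (Rt v P (ys ++ xs))%:E).
Proof.
have mR := lmf_Rt Hmetric Hborel v0 mv P.
rewrite /attach /J; apply: cvgeZl => //; apply: cvg_It.
- move=> n; apply: lmf_EFin => d' T us mus; apply: measurable_funM; last exact: lmf_catr.
  exact: lmf_prod (measurable_gball n x) _ _ _ mus.
- move=> n s; rewrite lee_fin mulr_ge0 ?Rt_ge0 // prodr_ge0 // => y _.
  by case/andP: (gball01 n x y).
- move=> s m n mn; rewrite lee_fin ler_wpM2r ?Rt_ge0 //; apply: ler_prod => y _.
  have /andP[g0 _] := gball01 m x y; rewrite g0 ler_wpM2r //; first by case/andP: (w01 x y).
  exact: nd_indic_oball.
- move=> s; apply: cvg_near_cst.
  have : \forall n \near \oo, gprod (gball n x) s = wprod w x s.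
    elim: s => [|y s IH]; first by apply: nearW => n; rewrite /gprod /wprod !big_nil.
    near=> n; rewrite /gprod /wprod !big_cons; congr (_ * _)%R; last by near: n.
    by rewrite /gball (_ : \1_(oball dist n) y = 1%R) ?mul1r //; near: n; exact: near_indic_oball.
  by apply: filterS => n ->; rewrite EFinM.
Unshelve. all: end_near. Qed.

(** Multiplying [bonferroni_mean] by [Zprod w xs] lets [J_gprod_Rt] express its terms by [Rt]; the
    cut-off is then removed by monotone and dominated convergence. *)
Lemma kirkwood_salsburg x xs N :
  (cprod w x xs)%:E * (\sum_(k < N.+1) (par true (N + k))%:E *
      attach nu w x k (fun ys => (Rt v P (ys ++ xs))%:E)) + (par false N * Rt v P (x :: xs))%:E <=
  (cprod w x xs)%:E * (\sum_(k < N.+1) (par false (N + k))%:E *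
      attach nu w x k (fun ys => (Rt v P (ys ++ xs))%:E)) + (par true N * Rt v P (x :: xs))%:E.
Proof.
have c0 : 0 <= (cprod w x xs)%:E by rewrite lee_fin; case/andP: (cprod01 w01 x xs).
have Z0 : 0 <= (Zprod w xs)%:E by rewrite lee_fin; case/andP: (Zprod01 w01 xs).
have R0 s : (0 <= Rt v P s)%R by exact: Rt_ge0.
have J0 n k : 0 <= J nu k (fun ys => (gprod (gball n x) ys * Rt v P (ys ++ xs))%:E).
  apply: J_ge0 => ys; rewrite lee_fin mulr_ge0 // prodr_ge0 // => y _.
  by case/andP: (gball01 n x y).
have E0 n : 0 <= Eb n x xs by apply: integral_ge0 => eta _; exact: nG0.
pose side b (n : nat) := \sum_(k < N.+1) (par b (N + k))%:E *
  J nu k (fun ys => (gprod (gball n x) ys * Rt v P (ys ++ xs))%:E) +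
  (par (~~ b) N)%:E * ((Zprod w xs)%:E * Eb n x xs).
have side_le n : side true n <= side false n.
  have sE b : side b n = (Zprod w xs)%:E * (\sum_(k < N.+1) (par b (N + k))%:E *
      ES (gball n x) v P k xs + (par (~~ b) N)%:E * Eb n x xs).
    rewrite ge0_muleDr ?mule_ge0 ?lee_fin ?sume_ge0 // => [|k _]; last first.
      by rewrite mule_ge0 ?lee_fin //; apply: integral_ge0 => eta _; exact: SG0.
    rewrite /side muleCA; congr (_ + _); rewrite ge0_sume_distrr // => [|k _]; last first.
      by rewrite mule_ge0 ?lee_fin //; apply: integral_ge0 => eta _; exact: SG0.
    apply: eq_bigr => k _; rewrite [RHS]muleCA; congr (_%:E * _).
    exact: (J_gprod_Rt Hmetric Hborel Hsep (measurable_gball n x) (gball01 n x) (@gball_out n x)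
      v0 mv v_sym z0 mz HP nuE).
  by rewrite !sE lee_wpmul2l // bonferroni_mean.
pose lims b := \sum_(k < N.+1) (par b (N + k))%:E *
  attach nu w x k (fun ys => (Rt v P (ys ++ xs))%:E) +
  (par (~~ b) N)%:E * ((Zprod w xs)%:E * (EG v P (x :: xs))%:E).
have at0 k : 0 <= attach nu w x k (fun ys => (Rt v P (ys ++ xs))%:E).
  by apply: attach_ge0 => // ys; rewrite lee_fin.
have sc b : side b @ \oo --> lims b.
  apply: cvgeD.
  - apply: ge0_adde_def; rewrite inE; first by apply: sume_ge0 => k _; rewrite mule_ge0 ?lee_fin.
    by rewrite !mule_ge0 ?lee_fin //; case/andP: (EG01 Hmetric Hborel v0 mv P (x :: xs)).
  - apply: cvg_nnesum => [k _|k _]; first by apply: nearW => n; rewrite mule_ge0 ?lee_fin.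
    by apply: cvgeZl => //; exact: cvg_J_gball.
  - by do 2 apply: cvgeZl => //; exact: cvg_Eb.
(* The factor [cprod w x xs] completes [Zprod w xs] to [Zprod w (x :: xs)], which turns the
   expectation into [Rt (x :: xs)]. *)
have limE b : (cprod w x xs)%:E * (\sum_(k < N.+1) (par b (N + k))%:E *
      attach nu w x k (fun ys => (Rt v P (ys ++ xs))%:E)) + (par (~~ b) N * Rt v P (x :: xs))%:E =
    (cprod w x xs)%:E * lims b.
  rewrite ge0_muleDr //; last 2 first.
  - by apply: sume_ge0 => k _; rewrite mule_ge0 ?lee_fin.
  - by rewrite !mule_ge0 ?lee_fin //; case/andP: (EG01 Hmetric Hborel v0 mv P (x :: xs)).
  congr (_ + _); rewrite /Rt /= -!EFinM; congr _%:E; ring.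
rewrite (limE true) (limE false) lee_wpmul2l //.
rewrite -(cvg_lim (@ereal_hausdorff R) (sc true)) -(cvg_lim (@ereal_hausdorff R) (sc false)).
by apply: lee_lim; [exact: cvgP (sc true)|exact: cvgP (sc false)|exact: nearW].
Qed.
End KirkwoodSalsburg.

(** * Cluster expansion *)

Section IndexedLists.
Context {d : measure_display} {X : measurableType d} {R : realType}.
Implicit Types (xs : seq X) (w : X -> X -> R).

Lemma map_nthX xs : [seq nthX xs (val i) | i <- enum 'I_(size xs)] = xs.
Proof.
rewrite -[RHS](mkseq_nth point) /mkseq -val_enum_ord -map_comp.
by apply: eq_map => i.
Qed.

Lemma prod_nthX (f : X -> R) xs : \prod_(j < size xs) f (nthX xs j) = \prod_(x <- xs) f x.
Proof. by rewrite [RHS](big_nth point) big_mkord. Qed.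

Lemma Zprod_nthX w xs :
  \prod_(i < size xs) \prod_(j < size xs | (i < j)%N) (1 - w (nthX xs i) (nthX xs j)) = Zprod w xs.
Proof.
have -> : Zprod w xs = Zprod w [seq nthX xs (val i) | i <- enum 'I_(size xs)] by rewrite map_nthX.
rewrite Zprod_map Zprod_sorted ?big_enum /=.
  by apply: eq_bigr => i _; rewrite big_enum_cond.
have <- : enum [set: 'I_(size xs)]%SET = enum 'I_(size xs) by apply: eq_enum => i; rewrite !inE.
exact: sorted_enum_set.
Qed.

Lemma nexp_sum (I : Type) (r : seq I) (Q : pred I) (F : I -> \bar R) : (forall i, 0 <= F i)%E ->
  nexp (\sum_(i <- r | Q i) F i)%E = \prod_(i <- r | Q i) nexp (F i).
Proof.
move=> F0; elim: r => [|i r IH]; first by rewrite !big_nil nexp0.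
by rewrite !big_cons; case: (Q i) => //; rewrite nexpD ?IH // sume_ge0.
Qed.

Lemma abs_ursell (v : X -> X -> \bar R) (v0 : forall x y, (0 <= v x y)%E)
  (v_sym : forall x y, v x y = v y x) x s : `|ursell v (x :: s)| = ga (wpot v) [:: x] s.
Proof.
rewrite ursellE // normrM normrX normrN1 expr1n mul1r ger0_norm //.
by apply: ga_ge0; exact: wpot01.
Qed.
End IndexedLists.

Section IprodLemmas.
Context {d : measure_display} {X : measurableType d} {R : realType}.
Local Open Scope ereal_scope.

Lemma eq_Iprod (mu : set X -> \bar R) k (F G : seq X -> \bar R) :
  (forall ys, size ys = k -> F ys = G ys) -> Iprod mu k F = Iprod mu k G.
Proof.
case: k => [|k] e; first exact: e.
by congr integral; apply/funext => p; rewrite e // size_plist.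
Qed.

(** The integrand has one sign throughout, so the signed integral reduces to a nonnegative one, to
    which Tonelli's theorem applies. *)
Lemma Iprod_sign (mu : {sigma_finite_measure set X -> \bar R}) k j (G : seq X -> R) : lmf G ->
  (forall s, 0 <= G s)%R ->
  Iprod mu k (fun ys => ((-1) ^+ j * G ys)%:E) = ((-1) ^+ j)%:E * It mu k (fun ys => (G ys)%:E).
Proof.
move=> mG G0; have pos : Iprod mu k (fun ys => (G ys)%:E) = It mu k (fun ys => (G ys)%:E).
  by apply: Iprod_It; [exact: lmf_EFin|move=> s; rewrite lee_fin].
rewrite -signr_odd; case: (odd j); last first.
  by rewrite expr0 mul1e -pos; apply: eq_Iprod => ys _; rewrite mul1r.
rewrite expr1 EFinN mulNe mul1e -pos.
under eq_Iprod => ys _ do rewrite mulN1r EFinN.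
case: k {pos} => [//|k]; rewrite /Iprod pmeasE integral_ge0N // => p _.
by rewrite lee_fin.
Qed.
End IprodLemmas.

Section RhoFormula.
Context {d : measure_display} {X : measurableType d} {R : realType}.
Variable dist : X -> X -> R.
Hypothesis Hmetric : is_metric dist.
Hypothesis Hborel : @measurable d X = <<s dopen dist >>.
Variable v : X -> X -> \bar R.
Hypothesis v0 : forall x y, (0 <= v x y)%E.
Hypothesis mv : measurable_fun setT (uncurry v).
Local Open Scope ereal_scope.

Lemma rhoE (z : X -> R) (P : probability (NN dist) R) xs :
  rho v z P xs = (\prod_(x <- xs) z x * Rt v P xs)%:E.
Proof.
rewrite /rho prod_nthX EFinM -muleA /Rt EFinM; congr (_ * (_ * _)).
  rewrite nexpE; last by apply: sume_ge0 => i _; apply: sume_ge0 => j _.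
  rewrite nexp_sum => [|i]; last exact: sume_ge0.
  rewrite -Zprod_nthX; congr _%:E; apply: eq_bigr => i _; rewrite nexp_sum //.
  by apply: eq_bigr => j _; rewrite wpotE.
rewrite EG_E //; apply: eq_integral => eta _.
have W0 x : 0 <= Wint v x (eta : lfcm dist) by exact: Wint_ge0.
rewrite nexpE ?sume_ge0 // nexp_sum //.
by congr _%:E; exact: (prod_nthX (fun x => nexp (Wint v x (eta : lfcm dist)))).
Qed.
End RhoFormula.

Section TruncatedCorrelations.
Context {d : measure_display} {X : measurableType d} {R : realType}.
Variables (zr q rhoT : seq X -> R) (N0 : set X).
Hypothesis zr_nil : zr [::] = 1.
Hypothesis zrq : forall x s, avoids N0 (x :: s) ->
  zr (x :: s) = spl (fun a b => q (x :: a) * zr b) s.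
Hypothesis HrhoT : is_truncated (fun xs => (zr xs)%:E) rhoT.

Lemma truncatedE xs : (0 < size xs)%N -> avoids N0 xs -> rhoT xs = q xs.
Proof.
(* [is_truncated] leaves [rhoT [::]] free, whereas the comparison over proper subsets includes the
   empty one; [q'] takes that value over. *)
pose q' s := if s is [::] then rhoT [::] else q s.
suff h xs' : avoids N0 xs' -> rhoT xs' = q' xs' by case: xs => // x s _ /h.
move: {2}(size xs') (leqnn (size xs')) => n; elim: n xs' => [[]//|n IH] s sn gs.
case: (posnP (size s)) => [/size0nil -> //|s0].
pose u (i : 'I_(size s)) := nthX s i; have eu := map_nthX s; rewrite -/u in eu.
have us i : u i \in s by rewrite -[X in _ \in X]eu map_f // mem_enum.
have gu l : {subset l <= [pred y | y \in codom u]} -> avoids N0 l.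
  by move=> h y /h /= /codomP[i ->]; apply: gs; exact: us.
have := @truncated_unique _ _ zr q' zr_nil _ u _ rhoT s0; rewrite eu; apply.
- by move=> x l /gu gl; exact: zrq.
- move=> V VT; apply: IH.
    rewrite size_map -cardE -ltnS; apply: leq_trans sn.
    by rewrite -[ltnRHS]card_ord -cardsT; exact: proper_card.
  by apply: gu => y /mapP[i _ ->]; rewrite inE codom_f.
- by have := HrhoT s0 => -[].
Qed.
End TruncatedCorrelations.

(** The left side is one term in the binomial expansion of [(1 + (expR t - 1)) ^+ m]. *)
Lemma bin_expR_le (R : realType) (t : R) p m : 0 < t ->
  'C(m, p)%:R * (expR t - 1) ^+ p <= expR (t * m%:R).
Proof.
move=> t0; have y0 : 0 <= expR t - 1 by rewrite subr_ge0 -expR0 ler_expR ltW.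
rewrite (mulrC t) expRM_natl -{2}(subrK 1 (expR t)) exprD1n.
case: (leqP p m) => pm; last first.
  rewrite bin_small // mul0r; apply: sumr_ge0 => i _.
  by rewrite mulrn_wge0 // exprn_ge0.
rewrite (bigD1 (Ordinal (pm : (p < m.+1)%N))) //= mulr_natl lerDl; apply: sumr_ge0 => i _.
by rewrite mulrn_wge0 // exprn_ge0.
Qed.

Section ClusterBound.
Context {d : measure_display} {X : measurableType d} {R : realType}.
Variable nu : {sigma_finite_measure set X -> \bar R}.
Variable w : X -> X -> R.
Hypothesis w01 : forall x y, 0 <= w x y <= 1.
Variables (t C : R) (x : X).
Hypothesis t0 : 0 < t.
Local Open Scope ereal_scope.
Hypothesis VC : forall M, Vsum nu w (fun m => expR (t * m%:R)) M [:: x] <= C%:E.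

(** Writing [1 / k!] as ['C(p + k, p)] times [p! / (p + k)!] and bounding the binomial by
    [bin_expR_le] compares the series with the terms [m >= p] of [Vsum] at the single root [x]. *)
Lemma cluster_bound p : \sum_(0 <= k <oo) ((k`!)%:R^-1)%:E * It nu (p + k) (fun ys => (ga w [:: x] ys)%:E)
  <= ((p`!)%:R / (expR t - 1) ^+ p * C)%:E.
Proof.
have I0 k : 0 <= It nu k (fun ys => (ga w [:: x] ys)%:E).
  by apply: It_ge0 => s; rewrite lee_fin; exact: ga_ge0.
have y0 : (0 < (expR t - 1) ^+ p)%R by rewrite exprn_gt0 // subr_gt0 -expR0 ltr_expR.
have c0 : (0 <= (p`!)%:R / (expR t - 1) ^+ p)%R by rewrite divr_ge0 ?ler0n // ltW.
apply: lime_le.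
  by apply: is_cvg_nneseries => k _ _; rewrite mule_ge0 // lee_fin invr_ge0 ler0n.
apply: nearW => M; rewrite big_mkord EFinM.
apply: le_trans (lee_wpmul2l _ (VC (p + M))); last by rewrite lee_fin.
rewrite /Vsum -(big_mkord xpredT (fun m => (expR (t * m%:R))%:E * Aint nu w m [:: x])).
rewrite -addnS (big_cat_nat (n := p)) ?leq_addr //= ge0_muleDr; last 2 first.
- by apply: sume_ge0 => m _; rewrite mule_ge0 ?lee_fin ?expR_ge0 ?Aint_ge0.
- by apply: sume_ge0 => m _; rewrite mule_ge0 ?lee_fin ?expR_ge0 ?Aint_ge0.
rewrite -[leLHS]add0e leeD //.
  by rewrite mule_ge0 ?lee_fin // sume_ge0 // => m _; rewrite mule_ge0 ?lee_fin ?expR_ge0 ?Aint_ge0.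
rewrite -[X in \big[_/_]_(X <= _ < _) _]add0n big_addn addKn big_mkord big_ord_recr /= ge0_muleDr; last 2 first.
- by apply: sume_ge0 => m _; rewrite mule_ge0 ?lee_fin ?expR_ge0 ?Aint_ge0.
- by rewrite mule_ge0 ?lee_fin ?expR_ge0 ?Aint_ge0.
rewrite -[leLHS]adde0 leeD //; last first.
  by rewrite !mule_ge0 ?lee_fin ?expR_ge0 ?Aint_ge0.
rewrite ge0_sume_distrr => [|m _]; last by rewrite mule_ge0 ?lee_fin ?expR_ge0 ?Aint_ge0.
apply: lee_sum => k _; rewrite /Aint /J !muleA -!EFinM (addnC k); apply: lee_wpmul2r => //.
rewrite lee_fin.
have := bin_expR_le p (p + k) t0; rewrite -(ler_pdivlMr _ _ y0) => h.
have bf : ('C(p + k, p)%:R * ((p`!)%:R * (k`!)%:R) = ((p + k)`!)%:R :> R)%R.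
  by rewrite -(bin_fact (leq_addr k p)) addKn !natrM.
have f0 m : ((m`!)%:R != 0 :> R)%R by rewrite pnatr_eq0 -lt0n fact_gt0.
rewrite (_ : (k`!)%:R^-1 = 'C(p + k, p)%:R * ((p`!)%:R / ((p + k)`!)%:R))%R; last first.
  by rewrite -bf; field; rewrite !f0 /= pnatr_eq0 -lt0n bin_gt0 leq_addr.
rewrite (_ : (p`!)%:R / _ * _ / _ = expR (t * (p + k)%:R) / (expR t - 1) ^+ p *
  ((p`!)%:R / ((p + k)`!)%:R))%R; last by ring.
by rewrite ler_wpM2r // divr_ge0 ?ler0n.
Qed.
End ClusterBound.

Section UrsellExpansion.
Context {d : measure_display} {X : measurableType d} {R : realType}.
Variable v : X -> X -> \bar R.
Hypothesis v0 : forall x y, (0 <= v x y)%E.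
Hypothesis mv : measurable_fun setT (uncurry v).
Hypothesis v_sym : forall x y, v x y = v y x.
Variable nu : {sigma_finite_measure set X -> \bar R}.
Variable N0 : set X.
Hypothesis A_bounded : forall xs, avoids N0 xs -> ebounded (fun m => Aint nu (wpot v) m xs).
Local Open Scope ereal_scope.
Local Notation w := (wpot v).

Let w01 := wpot01 v0.
Let w_sym := wpot_sym v_sym.
Let mw := measurable_wpot mv.

(** The series starts at [k = 1]; its term [k = 0] is the Ursell function itself, hence the
    subtraction in the limit. For fixed [k] the integrand has a constant sign, so each integral is
    given by [Tr] up to that sign. *)
Lemma cvg_ursell_series x s : avoids N0 (x :: s) ->
  (fun N : nat => \sum_(1 <= k < N) (((k`!)%:R)^-1%:E *
     Iprod nu k (fun ys => (ursell v ((x :: s) ++ ys))%:E))) @ \oo -->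
  (Ulim nu w (x :: s) - ursell v (x :: s))%:E.
Proof.
move=> gs.
have Tfin k : (Tr nu w k (x :: s))%:E = Tint nu w k (x :: s).
  rewrite fineK // (ebounded_fin (u := fun m => Tint nu w m (x :: s))) // => [m|].
    exact: Tint_ge0.
  exact: (Tint_bounded w_sym w01 mw A_bounded gs).
have mga : lmf (fun ys => ga w [:: x] (s ++ ys)).
  by apply: (lmf_catl (G := ga w [:: x])); exact/lmf2_lmf1/lmf2_ga.
have termE k : ((k`!)%:R)^-1%:E * Iprod nu k (fun ys => (ursell v ((x :: s) ++ ys))%:E) =
    ((-1) ^+ size s * ((-1) ^+ k * Tr nu w k (x :: s)))%R%:E.
  rewrite (@eq_Iprod _ _ _ _ _ _ (fun ys => ((-1) ^+ (size s + k) * ga w [:: x] (s ++ ys))%:E)); last first.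
    by move=> ys sk; rewrite cat_cons ursellE // size_cat sk.
  rewrite Iprod_sign // => [|ys]; last exact: ga_ge0.
  by rewrite muleCA -/(J nu k (fun ys => (ga w [:: x] (s ++ ys))%:E)) -/(Tint nu w k (x :: s)) -Tfin -EFinM exprD mulrA.
under eq_fun => N do under eq_bigr => k _ do rewrite termE.
under eq_fun => N do rewrite sumEFin.
apply: cvg_EFin; first exact: nearW.
have : (fun N => (-1) ^+ size s * (\sum_(m < N) (-1) ^+ m * Tr nu w m (x :: s)) -
    ursell v (x :: s))%R @ \oo --> (Ulim nu w (x :: s) - ursell v (x :: s))%R.
  apply: cvgB; last exact: cvg_cst.
  have := cvgM (cvg_cst ((-1) ^+ size s : R)%R) (Tr_cvg w_sym w01 mw A_bounded gs).
  rewrite signrMK; exact.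
apply: cvg_trans; apply: near_eq_cvg; near=> N.
have N0' : (0 < N)%N by near: N; exists 1%N.
rewrite -(big_mkord xpredT (fun m => (-1) ^+ m * Tr nu w m (x :: s))%R) big_ltn //= mulrDr expr0 mul1r.
have -> : ursell v (x :: s) = ((-1) ^+ size s * Tr nu w 0 (x :: s))%R.
  rewrite ursellE //; congr (_ * _)%R; apply: EFin_inj; rewrite Tfin /= /J /= invr1 mul1e.
  by rewrite cats0.
by rewrite [X in (X - _)%R]addrC addrK mulr_sumr.
Unshelve. all: end_near. Qed.
End UrsellExpansion.
Local Open Scope ereal_scope.

Theorem mainTheorem3 (R : realType) (d : measure_display) (X : measurableType d)
  (dist : X -> X -> R)
  (Hmetric : is_metric dist) (Hcomplete : dcomplete dist) (Hsep : dseparable dist)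
  (Hborel : @measurable d X = <<s dopen dist >>)
  (lam : {measure set X -> \bar R})
  (Hlam : forall B, measurable B -> dbounded dist B -> lam B < +oo)
  (v : X -> X -> \bar R)
  (Hv0 : forall x y, 0 <= v x y) (Hvsym : forall x y, v x y = v y x)
  (Hvm : measurable_fun [set: X * X] (uncurry v))
  (z : X -> R) (Hz0 : forall x, (0 <= z x)%R) (Hzm : measurable_fun setT z)
  (Hzloc : forall B, measurable B -> dbounded dist B -> \int[lam]_(x in B) (z x)%:E < +oo)
  (Hf : ae_pow lam 1 (fun ys => (fpot v (nthX ys 0) (nthX ys 1) <= 0)%R))
  (a : X -> R) (t : R)
  (Ha0 : forall x, (0 <= a x)%R) (Ham : measurable_fun setT a) (Ht : (0 < t)%R)
  (Hcond : ae_pow lam 0 (fun xs0 =>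
     \sum_(1 <= k <oo)
        ((expR (t * k%:R) / (k`!)%:R)%:E
         * Iprod lam k (fun ys =>
             (\prod_(j < k) `|fpot v (nthX xs0 0) (nthX ys j)|
              * \prod_(i < k) \prod_(j < k | (i < j)%N) (1 + fpot v (nthX ys i) (nthX ys j))
              * \prod_(j < k) (z (nthX ys j) * expR (a (nthX ys j))))%:E))
     <= (expR (a (nthX xs0 0)) - 1)%:E))
  (P : probability (NN dist) R) (HP : is_gibbs lam v z P)
  (rhoT : seq X -> R) (HrhoT : is_truncated (rho v z P) rhoT) :
  forall n : nat, (0 < n)%N ->
    ae_pow lam n.-1 (fun xs =>
      exists L : R,
        (fun N : nat => \sum_(1 <= k < N)
            (((k`!)%:R)^-1%:E * Iprod (lamz lam z) k (fun ys => (ursell v (xs ++ ys))%:E)))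
          @ \oo --> L%:E
        /\ rhoT xs = (\prod_(j < n) z (nthX xs j) * (ursell v xs + L))%R)
    /\
    ae_pow lam 0 (fun xs1 =>
      \sum_(0 <= k <oo)
         (((k`!)%:R)^-1%:E
          * Iprod (lamz lam z) (n.-1 + k) (fun ys => `|ursell v (nthX xs1 0 :: ys)|%:E))
      <= (((n.-1)`!)%:R / (expR t - 1) ^+ n.-1 * expR (a (nthX xs1 0)))%:E).
Proof.
pose w := wpot v.
have w01 : forall x y, (0 <= w x y <= 1)%R := wpot01 Hv0.
have w_sym : forall x y, w x y = w y x := wpot_sym Hvsym.
have mw : measurable_fun setT (uncurry w) := measurable_wpot Hvm.
have bB n : dbounded dist (oball dist n) by exists point, n%:R => y /ltW.
have mB n : measurable (oball dist n) by exact: measurable_oball.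
have sfl : sigma_finite setT lam.
  by apply: (sigma_finite_balls Hmetric Hborel) => n; exact: Hlam.
have sfn : sigma_finite setT (densM lam Hz0 Hzm).
  by apply: (sigma_finite_balls Hmetric Hborel) => n; exact: Hzloc.
pose lamS : {sigma_finite_measure set X -> \bar R} := sfM sfl.
pose nu : {sigma_finite_measure set X -> \bar R} := sfM sfn.
have nuE (f : X -> \bar R) : (forall x, 0 <= f x) -> measurable_fun setT f ->
    \int[nu]_x f x = \int[lamS]_x ((z x)%:E * f x) by exact: integral_densM.
have [N0 [mN0 N00 cond0]] := Hcond.
(* [nu] has density [z] with respect to [lam], so it inherits the null set. *)
have nuN0 : nu N0 = 0.
  by apply: null_set_integral => //; apply/measurable_EFinP; exact: (measurable_funTS Hzm).
have fpotE x y : (fpot v x y = - w x y)%R by rewrite opprK.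
(* The hypothesis in terms of [nu]: the factors [z] move into the measure, [|f|] becomes [w], and
   the product of [1 + f] becomes [Zprod]. *)
have cond x : ~ N0 x ->
    \sum_(1 <= k <oo) (expR (t * k%:R))%:E * attach nu w x k (fun ys => (Zprod w ys * ea a ys)%:E)
    <= (expR (a x) - 1)%:E.
  move=> /cond0 /=; apply: le_trans; rewrite le_eqVlt; apply/orP; left; apply/eqP.
  apply: eq_eseriesr => k _; rewrite /attach /J muleA -EFinM; congr (_ * _).
  have mG : lmf (fun ys => (wprod w x ys)%:E * (Zprod w ys * ea a ys)%:E).
    apply: lmfM; first exact/lmf_EFin/lmf_wprod.
    by apply: lmf_EFin => d' T us mus; apply: measurable_funM; [exact: lmf_Zprod|exact: lmf_ea].
  have G0 ys : 0 <= (wprod w x ys)%:E * (Zprod w ys * ea a ys)%:E.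
    rewrite -EFinM lee_fin !mulr_ge0 //; first by case/andP: (wprod01 w01 x ys).
      by case/andP: (Zprod01 w01 ys).
    by apply: prodr_ge0 => y _; exact: expR_ge0.
  rewrite (It_density Hz0 Hzm nuE) // -Iprod_It //; last 2 first.
  - by apply: lmfM => //; apply: lmf_EFin; exact: lmf_prod.
  - by move=> s; rewrite mule_ge0 // lee_fin prodr_ge0.
  apply: eq_Iprod => ys <-; rewrite -!EFinM; congr _%:E.
  rewrite (prod_nthX (fun y => z y * expR (a y))%R) big_split /= -/(ea a ys).
  rewrite (eq_bigr (fun j : 'I_(size ys) => w x (nthX ys j))); last first.
    move=> j _; rewrite fpotE normrN ger0_norm //.
    by case/andP: (w01 x (nthX ys j)).
  rewrite (prod_nthX (w x)) -Zprod_nthX.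
  under [X in (_ * X * _)%R]eq_bigr => i _ do under eq_bigr => j _ do rewrite fpotE.
  by rewrite -/(wprod w x ys); ring.
have VC xs (gs : avoids N0 xs) M := Vsum_expR_le w01 mw mN0 nuN0 Ha0 Ham Ht cond M gs.
have A_bounded xs (gs : avoids N0 xs) := Aint_ebounded w01 Ht (VC xs gs).
have A_cvg xs : avoids N0 xs ->
    (fun M => (\sum_(m < M) (-1) ^+ m * Ar nu w m xs)%R) @ \oo --> Rt v P xs.
  move=> gs; apply: (Aint_cvg w01 Ht (VC xs gs)) => M.
  apply: (bonferroni w01 mw mN0 nuN0 Ha0 Ham Ht cond) => //.
  - exact: lmf_Rt.
  - by move=> s; exact: Rt_ge0.
  - exact: Rt_nil.
  - by move=> ys s; exact: Rt_cat_le.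
  - by move=> x s N _ _; exact: (kirkwood_salsburg Hmetric Hborel Hsep Hv0 Hvm Hvsym Hz0 Hzm HP nuE).
(* Each distribution of the points into two lists carries the same product of activities, so the
   recursion of [Rt_Ulim] passes to the correlation functions. *)
pose zr xs := (\prod_(x <- xs) z x * Rt v P xs)%R.
pose q xs := (\prod_(x <- xs) z x * Ulim nu w xs)%R.
have zr_nil : zr [::] = 1%R by rewrite /zr big_nil mul1r; exact: Rt_nil.
have zrq x s : avoids N0 (x :: s) -> zr (x :: s) = spl (fun a b => q (x :: a) * zr b)%R s.
  move=> gs; rewrite /zr (Rt_Ulim w_sym w01 mw A_bounded A_cvg gs) spl_mull.
  apply: eq_in_spl => b c p; rewrite /q !big_cons -(perm_big _ p) big_cat /=; ring.
have trunc : is_truncated (fun xs => (zr xs)%:E) rhoT.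
  by move=> xs xs0; rewrite -(rhoE Hmetric Hborel Hv0 Hvm); exact: HrhoT.
move=> n n0; split.
  have [N [mN NN0 hN]] := pmeas_null (mu := lamS) n.-1 mN0 N00.
  exists N; split=> // p /hN; move: (size_plist p); rewrite prednK //.
  case: (plist n.-1 p) => [/= n0'|x s sn gs]; first by rewrite -n0' in n0.
  exists (Ulim nu w (x :: s) - ursell v (x :: s))%R; split.
    exact: (cvg_ursell_series Hv0 Hvm Hvsym A_bounded gs).
  by rewrite (truncatedE zr_nil zrq trunc) // /q -sn prod_nthX addrC subrK.
exists N0; split=> // p Np /=; rewrite /nthX /=.
have gp : avoids N0 [:: p] by apply/avoids_cons.
(* For a single root [Zprod] is 1, so the constant is just [expR (a p)]. *)
have VCp M : Vsum nu w (fun m => expR (t * m%:R)) M [:: p] <= (expR (a p))%:E.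
  by have := VC _ gp M; rewrite /= /cprod /ea big_nil big_seq1 !mul1r.
apply: (le_trans _ (cluster_bound w01 Ht VCp n.-1)).
rewrite le_eqVlt; apply/orP; left; apply/eqP; apply: eq_eseriesr => k _; congr (_ * _).
rewrite -Iprod_It.
- by apply: eq_Iprod => ys _; rewrite abs_ursell.
- exact/lmf_EFin/lmf2_lmf1/lmf2_ga.
- by move=> s; rewrite lee_fin; exact: ga_ge0.
Qed.
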